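(* Let $\ell\in\{1,2\}$, let $\mathcal P_\ell=\Pi\circ F_\ell^{-1}$ be the pushforward prior probability measure on $(\mathbb S,\mathcal B(\mathbb S))$ for the random doping profile $C=F_\ell(X,C_{\mathrm p},C_{\mathrm n})$. Let $\mathcal G^h:\mathbb S\to\mathbb R^{N_{\mathrm{meas}}}$ be the discrete forward operator, in which the doping profile enters both through the source term and, via its plateau values $c_{\mathrm p},c_{\mathrm n}$, through the Dirichlet data $\operatorname{arcsinh}(c_{\mathrm p}/2\delta^2)$ and $\operatorname{arcsinh}(c_{\mathrm n}/2\delta^2)$. For $\boldsymbol y\in\mathbb R^{N_{\mathrm{meas}}}$, $s\in\mathbb S$ let $$\Phi(\boldsymbol y;s)=\frac{1}{2\sigma_{\mathrm{noise}}^2}\|\mathcal G^h(s)-\boldsymbol y\|_2^2$$ be the negative log-likelihood for the model $Y=\mathcal G^h(C)+E$, where $E\sim\mathcal N(0,\sigma_{\mathrm{noise}}^2 I_{N_{\mathrm{meas}}})$ is independent of $C$ and $\sigma_{\mathrm{noise}}>0$. Then the posterior distribution $\mathcal P^{\mathrm{post}}_{\ell,\boldsymbol y}$, defined as the conditional probability measure of $C$ given $Y=\boldsymbol y$, is absolutely continuous with respect to $\mathcal P_\ell$, with Radon--Nikodym derivative $$\frac{d\mathcal P^{\mathrm{post}}_{\ell,\boldsymbol y}}{d\mathcal P_\ell}(s)=\frac{1}{Z(\boldsymbol y)}\exp\bigl(-\Phi(\boldsymbol y;s)\bigr),\qquad Z(\boldsymbol y)=\int_{\mathbb S}\exp\bigl(-\Phi(\boldsymbol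 y;s)\bigr)\,\mathcal P_\ell(ds).$$ Furthermore, for every $r>0$ there is a constant $\kappa>0$ such that for any two data vectors $\boldsymbol y_1,\boldsymbol y_2\in\mathbb R^{N_{\mathrm{meas}}}$ with $\max\{\|\boldsymbol y_1\|_2,\|\boldsymbol y_2\|_2\}<r$, $$d_{\mathrm{Hell}}\bigl(\mathcal P^{\mathrm{post}}_{\ell,\boldsymbol y_1},\mathcal P^{\mathrm{post}}_{\ell,\boldsymbol y_2}\bigr)\le\kappa\,\|\boldsymbol y_1-\boldsymbol y_2\|_2,$$ where $\kappa$ is independent of $\boldsymbol y_1$ and $\boldsymbol y_2$.
   Context: Domain. $\Omega\subset\mathbb R^2$ is a square with boundary $\partial\Omega=\partial\Omega_1\cup\partial\Omega_2\cup\partial\Omega_3$, where $\partial\Omega_1$ is the union of the left and right sides, $\partial\Omega_2$ is the bottom side and $\partial\Omega_3$ is the top side; $\epsilon>0$, $\delta>0$. Prior. $X\sim\mu_X=\mathcal N(0,\mathcal C)$ is a Gaussian random function in a Hilbert space $\mathbb X$ of real functions on $\Omega$ ($\mathcal C$ symmetric, non-negative, trace class). $C_{\mathrm p},C_{\mathrm n}$ are real random variables with laws $\mu_{\mathrm p},\mu_{\mathrm n}$ (probability measures on $\mathbb R$); $X,C_{\mathrm p},C_{\mathrm n}$ are mutually independent, with joint law $\Pi=\mu_X\otimes\mu_{\mathrm p}\otimes\mu_{\mathrm n}$ on $\mathbb X\times\mathbb R\times\mathbb R$. With $H=\mathbf 1_{[0,\infty)}$ and a fixed $k>0$, the doping fields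 $F_1,F_2$ are defined pointwise on $\Omega$ by $$F_1(X,c_{\mathrm p},c_{\mathrm n})=c_{\mathrm p}+(c_{\mathrm n}-c_{\mathrm p})H(X),\qquad F_2(X,c_{\mathrm p},c_{\mathrm n})=c_{\mathrm p}+(c_{\mathrm n}-c_{\mathrm p})\frac{1}{1+\exp(-kX)}.$$ $\mathbb S$ is the space of (piecewise-constant or nearly piecewise-constant) doping profiles. Each $s\in\mathbb S$ is a field in $L^2(\Omega)$, denoted again by $s$, regarded as carrying its two plateau values $c_{\mathrm p}=c_{\mathrm p}(s)$, $c_{\mathrm n}=c_{\mathrm n}(s)\in\mathbb R$; the profile $F_\ell(X,c_{\mathrm p},c_{\mathrm n})$ carries the plateau values $c_{\mathrm p},c_{\mathrm n}$. $\mathbb S$ has the topology inherited from $L^2(\Omega)\times\mathbb R\times\mathbb R$, with Borel $\sigma$-algebra $\mathcal B(\mathbb S)$, and $F_1,F_2$ are regarded as measurable maps into $\mathbb S$, so that $\mathcal P_\ell=\Pi\circ F_\ell^{-1}$ is a probability measure on $\mathbb S$. Discrete forward operator. It discretizes the problem $-\nabla\cdot(\epsilon\nabla u)+2\delta^2\sinh(u)=s$ in $\Omega$, $\nabla u\cdot\boldsymbol n=0$ on $\partial\Omega_1$, $u=\operatorname{arcsinh}(c_{\mathrm p}(s)/2\delta^2)$ on $\partial\Omega_2$, $u=\operatorname{arcsinh}(c_{\mathrm n}(s)/2\delta^2)$ on $\partial\Omega_3$. Fix a triangulation of $\Omega$ and the first-order Lagrange finite element space on it. Let $\phi_1,\dots,\phi_{N_{\mathrm{FEM}}}$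 be the nodal basis functions vanishing on $\partial\Omega_2\cup\partial\Omega_3$. For $s\in\mathbb S$ let $g=g(c_{\mathrm p}(s),c_{\mathrm n}(s))$ be a finite element function (lifting) with $g=\operatorname{arcsinh}(c_{\mathrm p}(s)/2\delta^2)$ on $\partial\Omega_2$ and $g=\operatorname{arcsinh}(c_{\mathrm n}(s)/2\delta^2)$ on $\partial\Omega_3$, let $w=\sum_j[\boldsymbol w]_j\phi_j$ be the unique solution of $$\int_\Omega\epsilon\nabla w\cdot\nabla\phi_i\,d\boldsymbol x+2\delta^2\int_\Omega\sinh(w+g)\phi_i\,d\boldsymbol x=\int_\Omega s\,\phi_i\,d\boldsymbol x-\int_\Omega\epsilon\nabla g\cdot\nabla\phi_i\,d\boldsymbol x,\quad i=1,\dots,N_{\mathrm{FEM}},$$ and put $u^h=w+g$ (which does not depend on the choice of lifting). For fixed disjoint segments $I_1,\dots,I_{N_{\mathrm{meas}}}\subset\partial\Omega_3$ with outward unit normal $\boldsymbol n$, set $[\mathcal G^h(s)]_m=\int_{I_m}\nabla u^h\cdot\boldsymbol n\,d\sigma$ for $m=1,\dots,N_{\mathrm{meas}}$, where $d\sigma$ is arc length. Hellinger distance. For probability measures $\mu,\mu'$ absolutely continuous with respect to a probability measure $\nu$, $d_{\mathrm{Hell}}(\mu,\mu')^2=\frac12\int\bigl(\sqrt{d\mu/d\nu}-\sqrt{d\mu'/d\nu}\bigr)^2d\nu$. *)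

(* Defs.v *)
From HB Require Import structures.
From mathcomp Require Import all_boot all_order all_algebra.
From mathcomp Require Import all_classical all_reals all_analysis.
From mathcomp Require Import measurable_realfun.
Set Implicit Arguments.
Unset Strict Implicit.
Unset Printing Implicit Defensive.
Import Order.TTheory GRing.Theory Num.Theory numFieldNormedType.Exports.
Local Open Scope classical_set_scope.
Local Open Scope ring_scope.

Section L2_metric.
Context d (T : measurableType d) (R : realType).
Variable mu : {measure set T -> \bar R}.

(* The library's space of classes of square-integrable functions comes without
   a topology; the metric below is that of the L2 norm. *)
Definition L2 : Type := LspaceType2 mu.

Definition fun_of_L2 (f : L2) : T -> R :=
  aqEqMfun_to_fun (f : LspaceType mu (lee1n 2)).

HB.instance Definition _ := gen_eqMixin L2.
HB.instance Definition _ := gen_choiceMixin L2.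

Definition L2_dist (f g : L2) : R :=
  fine (Lnorm mu 2%:E (fun x => (fun_of_L2 f x - fun_of_L2 g x)%:E)).

Lemma fun_of_L2_Lfun (f : L2) : fun_of_L2 f \in Lfun mu 2%:E.
Proof.
rewrite inE; apply/andP; split; rewrite inE/=.
  exact: (@measurable_funPT _ _ _ (measurableTypeR R)).
exact: (@Lebesgue_finite _ _ _ _ _ _ (f : LspaceType mu (lee1n 2))).
Qed.

Lemma fun_of_L2B (f g : L2) : fun_of_L2 f - fun_of_L2 g \in Lfun mu 2%:E.
Proof.
have := @Lfun_submod_closed _ _ _ mu 2%:E (lee1n 2).
move=> -[_ /(_ (-1) _ _ (fun_of_L2_Lfun g) (fun_of_L2_Lfun f))].
by rewrite scaleN1r addrC.
Qed.

Lemma L2_distE (f g : L2) : (L2_dist f g)%:E =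
  Lnorm mu 2%:E (EFin \o (fun_of_L2 f - fun_of_L2 g)).
Proof.
rewrite /L2_dist fineK// ge0_fin_numE ?Lnorm_ge0//.
by have := fun_of_L2B f g; rewrite inE => /andP[_]; rewrite inE.
Qed.

Lemma L2_distxx f : L2_dist f f = 0.
Proof.
apply: EFin_inj; rewrite L2_distE subrr.
by rewrite (_ : _ \o _ = cst 0%E) ?Lnorm0.
Qed.

Lemma L2_dist_eq0 f g : L2_dist f g = 0 -> f = g.
Proof.
move=> fg0; have : (L2_dist f g)%:E = 0%E by rewrite fg0.
rewrite L2_distE => /Lnorm_eq0_eq0.
have /measurable_EFinP mfg : measurable_fun setT (fun_of_L2 f - fun_of_L2 g).
  by have := fun_of_L2B f g; rewrite inE => /andP[+ _]; rewrite inE.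
move=> /(_ mfg (lt_le_trans lte01 (lee1n 2))) fgE.
have {fgE} fgE : fun_of_L2 f = fun_of_L2 g %[ae mu].
  apply: filterS fgE => x /(_ I)/= [] /eqP.
  by rewrite subr_eq0 => /eqP.
case: f g {fg0 mfg} fgE => [f [[pf]]] [g [[pg]]] fgE.
have fg : f = g by rewrite -[f]reprK -[g]reprK; apply/eqmodP/asboolP.
by subst g; rewrite (Prop_irrelevance pf pg).
Qed.

Lemma L2_distC f g : L2_dist f g = L2_dist g f.
Proof.
apply: EFin_inj; rewrite !L2_distE -oppe_Lnorm; congr Lnorm.
by apply/funext => x; rewrite /= !fctE -[LHS]/((- _)%:E) opprB.
Qed.

Lemma L2_dist_triangle g f h : L2_dist f h <= L2_dist f g + L2_dist g h.
Proof.
rewrite -lee_fin EFinD !L2_distE.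
have -> : fun_of_L2 f - fun_of_L2 h =
    (fun_of_L2 f - fun_of_L2 g) + (fun_of_L2 g - fun_of_L2 h).
  by rewrite addrA subrK.
have m u v : measurable_fun setT (fun_of_L2 u - fun_of_L2 v).
  by have := fun_of_L2B u v; rewrite inE => /andP[+ _]; rewrite inE.
by apply: eminkowski; [exact: m|exact: m|exact: lee1n].
Qed.

HB.instance Definition _ := @isMetric.Build R L2 L2_dist L2_distxx
  L2_dist_eq0 L2_distC L2_dist_triangle.

End L2_metric.

Section domain.
Context {R : realType}.

Definition area : {measure set (measurableTypeR R * measurableTypeR R) -> \bar R} :=
  (lebesgue_measure \x lebesgue_measure)%E.

Record square := Square { xmin : R; ymin : R; side : R; side_gt0 : 0 < side }.

Variable Q : square.

Definition Omega : set (R * R) :=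
  `]xmin Q, xmin Q + side Q[ `*` `]ymin Q, ymin Q + side Q[.

Definition closed_Omega : set (R * R) :=
  `[xmin Q, xmin Q + side Q] `*` `[ymin Q, ymin Q + side Q].

Definition bottom_side : set (R * R) :=
  `[xmin Q, xmin Q + side Q] `*` [set ymin Q].

Definition top_side : set (R * R) :=
  `[xmin Q, xmin Q + side Q] `*` [set ymin Q + side Q].

Lemma measurable_Omega :
  measurable (Omega : set (measurableTypeR R * measurableTypeR R)).
Proof. by apply: measurableX; exact: measurable_itv. Qed.

Definition area_Omega :
    {measure set (measurableTypeR R * measurableTypeR R) -> \bar R} :=
  mrestr area measurable_Omega.

Definition L2_Omega : Type := L2 area_Omega.

End domain.
Arguments square : clear implicits.

Definition Borel (T : ptopologicalType) := g_sigma_algebraType (@open T).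

Section hilbert.
Context {R : realType}.

Definition is_inner_product (H : normedModType R) (ip : H -> H -> R) :=
  [/\ forall a x y z, ip (a *: x + y) z = a * ip x z + ip y z,
      forall x y, ip x y = ip y x
    & forall x, ip x x = `|x| ^+ 2].

(* [ev x] is the function on Omega that the vector [x] stands for; its values
   outside Omega are irrelevant. *)
Definition is_function_space (Q : square R) (H : normedModType R)
    (ev : H -> R * R -> R) :=
  (forall a x y p, Omega Q p -> ev (a *: x + y) p = a * ev x p + ev y p) /\
  (forall x y, (forall p, Omega Q p -> ev x p = ev y p) -> x = y).

Definition orthonormal_basis (H : normedModType R) (ip : H -> H -> R)
    (B : set H) :=
  [/\ forall e, B e -> ip e e = 1,
      forall e f, B e -> B f -> e <> f -> ip e f = 0
    & forall x, (forall e, B e -> ip x e = 0) -> x = 0].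

Definition covariance_operator (H : normedModType R) (ip : H -> H -> R)
    (C : {linear H -> H}) :=
  [/\ continuous C,
      forall x y, ip (C x) y = ip x (C y),
      forall x, 0 <= ip (C x) x
    & exists2 B, orthonormal_basis ip B &
        (\esum_(e in B) (ip (C e) e)%:E < +oo)%E].

(* [normal_prob] takes a standard deviation, and is not the Dirac mass when it
   vanishes. *)
Definition centered_normal (v : R) (A : set R) : \bar R :=
  if v == 0 then \d_(0 : R) A else normal_prob 0 (Num.sqrt v) A.

Definition centered_gaussian (H : completeNormedModType R) (ip : H -> H -> R)
    (C : H -> H) (mu : probability (Borel H) R) :=
  forall (h : H) (A : set R), measurable A ->
    mu [set x | A (ip x h)] = centered_normal (ip (C h) h) A.

End hilbert.

Variant doping_model := Sharp | Smooth.

Section profiles.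
Context {R : realType}.

Definition transition (k : R) (l : doping_model) (x : R) : R :=
  match l with
  | Sharp => if 0 <= x then 1 else 0
  | Smooth => (1 + expR (- (k * x)))^-1
  end.

Definition doping_field (k : R) (l : doping_model) (f : R * R -> R)
    (cp cn : R) : R * R -> R :=
  fun p => cp + (cn - cp) * transition k l (f p).

Variables (Q : square R) (S : ptopologicalType).

(* [carrier s] is the field of the profile [s] together with its two plateau
   values. *)
Definition is_profile_space (carrier : S -> L2_Omega Q * R * R) :=
  injective carrier /\
  forall U : set S, open U <-> exists2 V, open V & U = carrier @^-1` V.

Variables (H : completeNormedModType R) (ev : H -> R * R -> R).

Definition is_doping_map (k : R) (carrier : S -> L2_Omega Q * R * R)
    (l : doping_model) (F : Borel H * R * R -> Borel S) :=
  forall (x : H) (cp cn : R),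
    let s := carrier (F (x, cp, cn)) in
    [/\ fun_of_L2 s.1.1 = doping_field k l (ev x) cp cn %[ae area_Omega Q],
        s.1.2 = cp & s.2 = cn].

End profiles.

Section finite_elements.
Context {R : realType}.
Implicit Types (v : R * R -> R) (x y p : R * R).

Section nodes.
Context {n : nat}.
Variable pt : 'I_n -> R * R.
Implicit Type K : {set 'I_n}.

Definition combination (c : 'I_n -> R) : R * R :=
  (\sum_i c i * (pt i).1, \sum_i c i * (pt i).2).

Definition supported (c : 'I_n -> R) K := forall i, i \notin K -> c i = 0.

Definition hull K : set (R * R) :=
  [set x | exists c, [/\ forall i, 0 <= c i, supported c K, \sum_i c i = 1
                       & x = combination c]].

Definition affinely_independent K := forall c, supported c K ->
  \sum_i c i = 0 -> combination c = 0 -> forall i, c i = 0.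

End nodes.

Record triangulation (Q : square R) := Triangulation {
  nb_nodes : nat;
  node : 'I_nb_nodes -> R * R;
  cells : {set {set 'I_nb_nodes}};
  node_inj : injective node;
  node_used : forall i, exists2 K, K \in cells & i \in K;
  card_cell : forall K, K \in cells -> #|K| = 3%N;
  cell_nondegenerate : forall K, K \in cells -> affinely_independent node K;
  cells_cover : \bigcup_(K in [set` cells]) hull node K = closed_Omega Q;
  cells_conforming : forall K K', K \in cells -> K' \in cells ->
    hull node K `&` hull node K' = hull node (K :&: K')
}.
Arguments node {Q} t.

Variables (Q : square R) (tri : triangulation Q).

Definition dot x y : R := x.1 * y.1 + x.2 * y.2.

Definition slope_on K v p := forall x y,
  hull (node tri) K x -> hull (node tri) K y -> v y = v x + dot p (y - x).

(* Continuity on the closed square need not be required: [v] is a single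
   function that is affine on each of finitely many closed cells covering it. *)
Definition P1 v := forall K, K \in cells tri -> exists p, slope_on K v p.

(* At a point shared by several cells the gradient is that of one of them,
   chosen independently of [v]. These points are negligible, both for the area
   and for the arc length on the top side. *)
Definition grad v x : R * R :=
  if [pick K in cells tri | `[< hull (node tri) K x >]] is Some K
  then xget 0 [set p | slope_on K v p] else 0.

Definition nodal_basis (i : 'I_(nb_nodes tri)) : R * R -> R :=
  xget (fun=> 0) [set v | P1 v /\ forall j, v (node tri j) = (i == j)%:R].

Definition interior_index (i : 'I_(nb_nodes tri)) : bool :=
  `[< forall x, (bottom_side Q `|` top_side Q) x -> nodal_basis i x = 0 >].

End finite_elements.

Section forward_operator.
Context {R : realType}.
Variables (eps delta : R) (Q : square R) (tri : triangulation Q).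
Implicit Types (s : L2_Omega Q * R * R) (u v w g : R * R -> R).

Definition sinh (x : R) : R := (expR x - expR (- x)) / 2.

Definition arcsinh (x : R) : R := ln (x + Num.sqrt (x ^+ 2 + 1)).

Definition int_Omega (f : R * R -> R) : R :=
  (\int[area]_(x in Omega Q) f x)%R.

Definition is_lifting s g :=
  [/\ P1 tri g,
      forall x, bottom_side Q x -> g x = arcsinh (s.1.2 / (2 * delta ^+ 2))
    & forall x, top_side Q x -> g x = arcsinh (s.2 / (2 * delta ^+ 2))].

Definition weak_solution s g w :=
  (exists W : 'I_(nb_nodes tri) -> R, w = fun x =>
     \sum_(j | interior_index j) W j * nodal_basis j x) /\
  forall i : 'I_(nb_nodes tri), interior_index i ->
    let phi := nodal_basis i in
    int_Omega (fun x => eps * dot (grad tri w x) (grad tri phi x)) +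
    2 * delta ^+ 2 * int_Omega (fun x => sinh (w x + g x) * phi x) =
    int_Omega (fun x => fun_of_L2 s.1.1 x * phi x) -
    int_Omega (fun x => eps * dot (grad tri g x) (grad tri phi x)).

Definition discrete_solution s : R * R -> R :=
  xget (fun=> 0) [set u | exists g w,
    [/\ is_lifting s g, weak_solution s g w & u = fun x => w x + g x]].

Variables (M : nat) (I : 'I_M -> interval R).

(* The m-th segment is [I m] on the top side, where the outward normal is
   (0, 1) and the abscissa is an arc length parameter. *)
Definition forward s : M.-tuple R :=
  [tuple (\int[lebesgue_measure]_(t in [set` I m])
     dot (grad tri (discrete_solution s) (t, ymin Q + side Q)) (0, 1))%R
  | m < M].

End forward_operator.

Section bayes.
Context {R : realType}.

Definition addt M (y z : M.-tuple R) : M.-tuple R :=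
  [tuple tnth y m + tnth z m | m < M].

Definition subt M (y z : M.-tuple R) : M.-tuple R :=
  [tuple tnth y m - tnth z m | m < M].

Definition norm2 M (y : M.-tuple R) : R := Num.sqrt (\sum_m tnth y m ^+ 2).

(* The law N(0, sigma^2 Id) is the product of M copies of N(0, sigma^2), that
   is, it has the product value on boxes. *)
Definition isotropic_gaussian d (T : measurableType d) (P : probability T R)
    (sigma : R) M (E : T -> M.-tuple R) :=
  forall B : 'I_M -> set R, (forall m, measurable (B m)) ->
    P [set t | forall m, B m (tnth (E t) m)] =
    (\prod_m fine (normal_prob 0 sigma (B m)))%:E.

Definition independent d d1 d2 (T : measurableType d) (P : probability T R)
    (T1 : measurableType d1) (T2 : measurableType d2)
    (U : T -> T1) (V : T -> T2) :=
  forall A B, measurable A -> measurable B ->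
    P (U @^-1` A `&` V @^-1` B) = (P (U @^-1` A) * P (V @^-1` B))%E.

(* [post] is a regular conditional law of [U] given [V]: it is a kernel, and
   P(U in A, V in B) = E(1_(V in B) post_V(A)). *)
Definition is_conditional_law d d1 d2 (T : measurableType d)
    (P : probability T R) (T1 : measurableType d1) (T2 : measurableType d2)
    (U : T -> T1) (V : T -> T2) (post : T2 -> probability T1 R) :=
  (forall A, measurable A -> measurable_fun setT (fun y => post y A)) /\
  (forall A B, measurable A -> measurable B ->
    P (U @^-1` A `&` V @^-1` B) = (\int[P]_(t in V @^-1` B) post (V t) A)%E).

Definition density d (T : measurableType d) (mu nu : probability T R)
    : T -> \bar R :=
  Radon_Nikodym (charge_of_finite_measure mu) nu.

(* Both mu and mu' are meant to be dominated by nu. *)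
Definition hellinger d (T : measurableType d) (nu mu mu' : probability T R)
    : R :=
  Num.sqrt (2^-1 * (\int[nu]_s
    (Num.sqrt (fine (density mu nu s)) -
     Num.sqrt (fine (density mu' nu s))) ^+ 2)%R).

Definition neg_log_likelihood (S : Type) M (G : S -> M.-tuple R) (sigma : R)
    (y : M.-tuple R) (s : S) : R :=
  (2 * sigma ^+ 2)^-1 * norm2 (subt (G s) y) ^+ 2.

End bayes.

(* Main.v *)
Require Import Defs.
From HB Require Import structures.
From mathcomp Require Import all_boot all_order all_algebra.
From mathcomp Require Import all_classical all_reals all_analysis.
From mathcomp Require Import ring lra.
From mathcomp Require Import measurable_realfun.
Set Implicit Arguments.
Unset Strict Implicit.
Unset Printing Implicit Defensive.
Import Order.TTheory GRing.Theory Num.Theory numFieldNormedType.Exports.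
Local Open Scope classical_set_scope.
Local Open Scope ring_scope.

(* The likelihood exp(-Phi) is bounded by 1 and, the forward operator G being
   measurable, so is its integral Z(y) > 0. By the Cameron-Martin formula the
   law of Y = G(C) + E given C = s has density
   exp(|y|^2 / (2 sigma^2) - Phi(y; s)) with respect to the law of E, so Bayes'
   formula follows from Tonelli's theorem. The law of a profile given Y = y is
   unique up to null sets because L^2 is separable, which makes the Borel sets
   of the profile space countably generated.

   The Hellinger bound needs no integrability of G: with h = |G - y| / (2 sigma),
   sqrt(exp(-Phi)) = exp(-h^2) is a Lipschitz function of y uniformly in s, and
   Z is bounded below on balls.

   For the measurability of G, the nodal values U of the discrete solution solve
   A(U) = b(s) with A continuous and injective and b continuous, and G(s) is
   linear in U. If L is linear then {s : L(U(s)) >= a} is the union over k of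
   the closed sets b^-1(A({|U| <= k, L(U) >= a})); no a priori bound on U and no
   existence theorem is needed, since [discrete_solution] has the default value
   0. *)

(** * Bayes' formula for additive Gaussian noise *)

(** The noise is known only through the product values of its law [gamma] on boxes, and the Bayes
    computation keeps [gamma] as reference measure: its translates have densities with respect to
    it, built one coordinate at a time from the ratio of two normal densities. The factor exp(|y|^2
    / (2 sigma^2)) is the same for all profiles, so it cancels when the joint law of (C, Y) is
    divided by the law of Y.

    The value of the forward operator is defined by choosing a solution together with a lifting.
    Taking all nodal values as unknowns, with identity rows at the Dirichlet nodes, removes the
    lifting and makes A a map of R^n to itself. The Dirichlet part of b is continuous because the
    topology of S retains the plateau values and not only the field. *)

Section densities.
Context d (T : measurableType d) (R : realType).
Local Open Scope ereal_scope.

Lemma ge0_integral_mrestr (mu : {measure set T -> \bar R}) (D : set T)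
    (mD : measurable D) (E : set T) (f : T -> \bar R) : measurable E ->
  measurable_fun E f -> (forall x, E x -> 0 <= f x) ->
  \int[mrestr mu mD]_(x in E) f x = \int[mu]_(x in E `&` D) f x.
Proof.
move=> mE mf f0.
have mED : measurable (E `&` D) by exact: measurableI.
have mEnD : measurable (E `\` D) by exact: measurableD.
rewrite -{1}(setDUK (@subIsetl _ E D)) setDIr setDv set0U.
rewrite ge0_integral_setU//=; last 3 first.
- by apply: measurable_funS mf => // x [[]|[]].
- by move=> x [[]|[]] *; exact: f0.
- by rewrite disj_set2E; apply/eqP/seteqP; split => // x [[_ Dx] []].
rewrite [X in _ + X]null_set_integral// ?adde0.
- apply: eq_measure_integral => A mA AED; rewrite /= /mrestr setIidl//.
  by move=> x /AED[].
- by apply: measurable_funS mf => // x [].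
- by rewrite /= /mrestr setDKI measure0.
Qed.

(** The function [h] has the same integrals as the Radon-Nikodym derivative of [nu], so the two
    agree almost everywhere on [E], and the change of variables for the derivative carries over to
    [h]. *)
Lemma ge0_integral_density (mu : {sigma_finite_measure set T -> \bar R})
    (nu : {finite_measure set T -> \bar R}) (h : T -> R) :
  measurable_fun setT h -> (forall x, (0 <= h x)%R) ->
  (forall A, measurable A -> nu A = \int[mu]_(x in A) (h x)%:E) ->
  forall (E : set T) (f : T -> \bar R), measurable E -> measurable_fun E f ->
  (forall x, 0 <= f x) ->
  \int[nu]_(x in E) f x = \int[mu]_(x in E) (f x * (h x)%:E).
Proof.
move=> mh h0 nuE E f mE mf f0.
have numu : nu `<< mu.
  apply/null_content_dominatesP => A mA muA0; rewrite nuE//.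
  by apply: null_set_integral => //; apply/measurable_EFinP/measurable_funTS.
have mRN := measurable_int _ (Radon_Nikodym_SigmaFinite.f_integrable numu).
rewrite -(Radon_Nikodym_SigmaFinite.change_of_variables numu)//.
apply: ge0_ae_eq_integral => //.
- by apply: emeasurable_funM => //; exact: measurable_funTS.
- apply: emeasurable_funM => //.
  by apply/measurable_EFinP; exact: measurable_funTS.
- by move=> x _; rewrite mule_ge0 ?Radon_Nikodym_SigmaFinite.f_ge0.
- by move=> x _; rewrite mule_ge0// lee_fin.
have RNh : ae_eq mu E (Radon_Nikodym_SigmaFinite.f nu mu) (EFin \o h).
  apply: integral_ae_eq => //.
  - exact: integrableS (Radon_Nikodym_SigmaFinite.f_integrable numu).
  - by apply/measurable_EFinP; exact: measurable_funTS.
  - move=> A AE mA; rewrite -nuE//.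
    by rewrite -Radon_Nikodym_SigmaFinite.f_integral.
by apply: filterS RNh => x xh Ex; rewrite xh.
Qed.

(** The proofs about [h] are arguments, so that the measure structure attached below can be
    recovered from the term alone. *)
Definition weighted (mu : {measure set T -> \bar R}) (h : T -> R)
    of measurable_fun setT h & (forall x, (0 <= h x)%R) : set T -> \bar R :=
  fun A => \int[mu]_(x in A) (h x)%:E.

Section weighted_measure.
Variables (mu : {measure set T -> \bar R}) (h : T -> R).
Variables (mh : measurable_fun setT h) (h0 : forall x, (0 <= h x)%R).

Let weighted0 : weighted mu mh h0 set0 = 0.
Proof. by rewrite /weighted integral_set0. Qed.

Let weighted_ge0 A : 0 <= weighted mu mh h0 A.
Proof. by apply: integral_ge0 => x _; rewrite lee_fin. Qed.

Let weighted_sigma_additive : semi_sigma_additive (weighted mu mh h0).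
Proof.
move=> F mF tF mUF; rewrite /weighted ge0_integral_bigcup//=.
- apply: is_cvg_ereal_nneg_natsum_cond => n _ _; exact: weighted_ge0.
- by apply/measurable_EFinP; exact: measurable_funTS.
- by move=> x _; rewrite lee_fin.
Qed.

HB.instance Definition _ := isMeasure.Build _ _ _ (weighted mu mh h0)
  weighted0 weighted_ge0 weighted_sigma_additive.

End weighted_measure.

End densities.

(** * Tonelli's theorem on rectangles *)

Section tonelli.
Context d1 d2 (T1 : measurableType d1) (T2 : measurableType d2) (R : realType).
Variables (m1 : {sigma_finite_measure set T1 -> \bar R}).
Variables (m2 : {sigma_finite_measure set T2 -> \bar R}).
Local Open Scope ereal_scope.

(** This is Tonelli's theorem for the extension of [f] by zero outside the rectangle. *)
Lemma tonelli_on (A : set T1) (B : set T2) (f : T1 * T2 -> \bar R) :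
  measurable A -> measurable B -> measurable_fun setT f ->
  (forall x, 0 <= f x) ->
  \int[m1]_(x in A) \int[m2]_(y in B) f (x, y) =
  \int[m2]_(y in B) \int[m1]_(x in A) f (x, y).
Proof.
move=> mA mB mf f0.
transitivity (\int[m1]_x \int[m2]_y (f \_ (A `*` B)) (x, y)).
  rewrite integral_mkcond; apply: eq_integral => x _; rewrite patchE.
  case: ifPn => xA.
    rewrite integral_mkcond; apply: eq_integral => y _; rewrite !patchE.
    by rewrite in_setX/= xA.
  by rewrite integral0_eq// => y _; rewrite patchE in_setX/= (negbTE xA).
rewrite (fubini_tonelli (f \_ (A `*` B))).
- rewrite [RHS]integral_mkcond; apply: eq_integral => y _; rewrite patchE.
  case: ifPn => yB.
    rewrite [RHS]integral_mkcond; apply: eq_integral => x _; rewrite !patchE.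
    by rewrite in_setX/= yB andbT.
  by rewrite integral0_eq// => x _; rewrite patchE in_setX/= (negbTE yB) andbF.
- apply/(measurable_restrictT f); first exact: measurableX.
  exact: measurable_funTS.
- by move=> x; apply: erestrict_ge0.
Qed.

Lemma measurable_integral_on (A : set T1) (f : T1 * T2 -> \bar R) :
  measurable A -> measurable_fun setT f -> (forall x, 0 <= f x) ->
  measurable_fun setT (fun y => \int[m1]_(x in A) f (x, y)).
Proof.
move=> mA mf f0.
rewrite (_ : (fun _ => _) = fubini_G m1 (f \_ (A `*` setT))).
  apply: measurable_fun_fubini_tonelli_G.
    apply/(measurable_restrictT f); first exact: measurableX.
    exact: measurable_funTS.
  by move=> x; apply: erestrict_ge0.
apply/funext => y; rewrite integral_mkcond; apply: eq_integral => x _.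
by rewrite !patchE in_setX/= in_setT andbT.
Qed.

End tonelli.

(** * Translation of the normal law *)

Section normal_shift.
Context (R : realType).
Local Open Scope ereal_scope.

Definition shift_mfun (a : R) : {mfun measurableTypeR R >-> measurableTypeR R} :=
  let f x : R := (x + a)%R in
  let mf : measurable_fun setT f :=
    measurable_funD (@measurable_id _ _ setT) (measurable_cst a) in
  HB.pack (f : measurableTypeR R -> measurableTypeR R)
    (isMeasurableFun.Build _ _ (measurableTypeR R) (measurableTypeR R) _ mf).

Lemma lebesgue_measureD (a : R) (A : set R) : measurable A ->
  pushforward lebesgue_measure (shift_mfun a) A = lebesgue_measure A.
Proof.
move=> mA; apply/esym; move: A mA; apply: lebesgue_measure_unique.
move=> _ [[b c]] _ <-; rewrite /= /pushforward.
rewrite (_ : _ @^-1` _ = `]b - a, c - a]%classic)%R; last first.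
  by apply/seteqP; split=> x /=; rewrite !in_itv/= ltrBlDr lerBrDr.
rewrite !lebesgue_measure_itv/= !lte_fin ltrD2r.
by case: ifP => // _; rewrite -!EFinB; congr EFin; ring.
Qed.

(** Both sides are the integral over [B] of the normal density with mean [a]: the left one by
    translation invariance of Lebesgue measure, the right one because the exponential is the ratio
    of the densities with means [a] and 0. *)
Lemma normal_prob_shift (sigma a : R) (B : set R) : (0 < sigma)%R ->
  measurable B ->
  normal_prob 0 sigma [set x | B (x + a)%R] =
  \int[normal_prob 0 sigma]_(x in B)
    (expR (a * x / sigma ^+ 2 - a ^+ 2 / (2 * sigma ^+ 2)))%:E.
Proof.
move=> s0 mB; have s0' : sigma != 0%R by rewrite gt_eqF.
pose pdf_ge0 := @normal_pdf_ge0 R.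
transitivity (\int[lebesgue_measure]_(x in B) (normal_pdf a sigma x)%:E).
  transitivity (\int[pushforward lebesgue_measure (shift_mfun a)]_(x in B)
      (normal_pdf a sigma x)%:E).
    rewrite ge0_integral_pushforward; last 3 first.
    - exact: mB.
    - by apply/measurable_EFinP/measurable_funTS; exact: measurable_normal_pdf.
    - by move=> x _; rewrite lee_fin pdf_ge0.
    - rewrite /normal_prob; apply: eq_integral => x _ /=; congr EFin.
      by rewrite !normal_pdfE// /normal_fun addrK subr0.
    - exact: measurable_funPT.
  by apply: eq_measure_integral => A mA _; exact: lebesgue_measureD.
rewrite (@ge0_integral_density _ _ _ lebesgue_measure (normal_prob 0 sigma)
  (normal_pdf 0 sigma))//.
- apply: eq_integral => x _; rewrite -EFinM; congr EFin.
  rewrite !normal_pdfE// /normal_fun mulrCA -expRD; congr (_ * expR _)%R.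
  by field.
- exact: measurable_normal_pdf.
- apply/measurable_EFinP; apply: measurableT_comp => //.
  by apply: measurable_funB => //; apply: measurable_funM.
Qed.

End normal_shift.

(** * Boxes as a determining class on tuples *)

Section boxes.
Context (R : realType) (M : nat).

Definition box (B : 'I_M -> set R) : set (M.-tuple R) :=
  [set y | forall m, B m (tnth y m)].

Lemma measurable_box (B : 'I_M -> set R) :
  (forall m, measurable (B m)) -> measurable (box B).
Proof.
move=> mB; rewrite (_ : box B =
    \bigcap_(m in setT) ((@tnth M R)^~ m @^-1` B m)).
  apply: fin_bigcap_measurable => // m _.
  by rewrite -[_ @^-1` _]setTI; exact: measurable_tnth.
by apply/seteqP; split => y By m => [_|]; [exact: By|exact: (By m I)].
Qed.

(** Boxes are stable under intersection, include the whole space and generate the product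
    sigma-algebra. *)
Lemma tuple_measure_unique (m1 m2 : {measure set (M.-tuple R) -> \bar R}) :
  (m1 setT < +oo)%E ->
  (forall B : 'I_M -> set R, (forall m, measurable (B m)) ->
    m1 (box B) = m2 (box B)) ->
  forall A, measurable A -> m1 A = m2 A.
Proof.
move=> m1T m12.
pose boxes := [set box B | B in [set B | forall m, measurable (B m)]].
apply: (measure_unique boxes (fun=> setT)).
- apply/seteqP; split.
    apply: smallest_sub; first exact: smallest_sigma_algebra.
    move=> A; rewrite -bigcup_seq => -[i _ [B mB <-]]; rewrite setTI.
    apply: sub_sigma_algebra.
    exists (fun j => if j == i then B else setT).
      by move=> j; case: ifP.
    apply/seteqP; split => [y /(_ i)|y By j]; first by rewrite eqxx.
    by case: eqP => // ->.
  apply: smallest_sub; first exact: sigma_algebra_measurable.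
  by move=> _ [B mB <-]; exact: measurable_box.
- move=> _ _ [B mB <-] [B' mB' <-]; exists (fun m => B m `&` B' m).
    by move=> m; exact: measurableI.
  apply/seteqP; split => [y BB'|y [By B'y] m]; last by split.
  by split=> m; have [] := BB' m.
- by move=> _; exists (fun=> setT) => //; apply/seteqP; split.
- exact: bigcup_const.
- by move=> _ [B mB <-]; exact: m12.
- by move=> _; exact: m1T.
Qed.

End boxes.

(** * The Cameron-Martin formula for the noise *)

Section cameron_martin.
Context (R : realType) (sigma : R) (M : nat).
Variable gamma : probability (M.-tuple R) R.
Hypothesis sigma0 : 0 < sigma.
Hypothesis gammaE : forall B : 'I_M -> set R, (forall m, measurable (B m)) ->
  gamma (box B) = (\prod_m fine (normal_prob 0 sigma (B m)))%:E.
Implicit Types (y : M.-tuple R) (m : 'I_M) (a : R).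

Definition shift_coord m a y : M.-tuple R :=
  [tuple if j == m then tnth y j + a else tnth y j | j < M].

Definition shift_density m a y : R :=
  expR (a * tnth y m / sigma ^+ 2 - a ^+ 2 / (2 * sigma ^+ 2)).

Lemma measurable_shift_coord m a : measurable_fun setT (shift_coord m a).
Proof.
apply/measurable_fun_tnthP => j /=.
rewrite (_ : _ \o _ =
    fun y => if j == m then tnth y j + a else tnth y j); last first.
  by apply/funext => y /=; rewrite tnth_mktuple.
case: (j == m); last exact: measurable_tnth.
by apply: measurable_funD => //; exact: measurable_tnth.
Qed.

Lemma measurable_shift_density m a : measurable_fun setT (shift_density m a).
Proof.
apply: measurableT_comp => //; apply: measurable_funB => //.
by apply: measurable_funM => //; apply: measurable_funM => //; exact: measurable_tnth.
Qed.

HB.instance Definition _ m a :=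
  isMeasurableFun.Build _ _ _ _ _ (measurable_shift_coord m a).

Local Open Scope ereal_scope.

(** Both sides are measures in [A], so boxes suffice; on a box the coordinates other than [m]
    contribute a constant factor, and what remains is the shift of a normal law on the line. *)
Lemma gamma_shift_coord m a (A : set (M.-tuple R)) : measurable A ->
  gamma (shift_coord m a @^-1` A) = \int[gamma]_(y in A) (shift_density m a y)%:E.
Proof.
have q0 y : (0 <= shift_density m a y)%R by exact: expR_ge0.
have mq := measurable_shift_density m a.
rewrite -[RHS]/(weighted gamma mq q0 A).
rewrite -[LHS]/(pushforward gamma (shift_coord m a) A).
move: A; apply: tuple_measure_unique.
  by rewrite /= /pushforward preimage_setT probability_setT ltry.
move=> B mB; rewrite /= /pushforward.
pose rest := box (fun j => if j == m then setT else B j).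
have mrest : measurable rest by apply: measurable_box => j; case: ifP.
pose c := (\prod_(j | j != m) fine (normal_prob 0 sigma (B j)))%R.
have c0 : (0 <= c)%R.
  by apply: prodr_ge0 => j _; rewrite fine_ge0.
(* The product formula says that the m-th marginal of [gamma] restricted to [rest] is [c] times the
   normal law. It is used twice: to compute the left-hand side, and to turn the integral on the line
   back into an integral over tuples. *)
have boxE D : measurable D ->
    gamma ((@tnth M R)^~ m @^-1` D `&` rest) = c%:E * normal_prob 0 sigma D.
  move=> mD.
  rewrite (_ : _ `&` _ = box (fun j => if j == m then D else B j)).
    rewrite gammaE; last by move=> j; case: ifP.
    rewrite (bigD1 m)//= eqxx EFinM fineK; last exact: fin_num_measure.
    rewrite muleC; congr (_%:E * _).
    by apply: eq_bigr => j /negbTE ->.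
  apply/seteqP; split=> [y [Dy By] j|y By].
    by have := By j; case: eqP => // ->.
  split=> [|j]; first by have := By m; rewrite eqxx.
  by have := By j; case: eqP.
transitivity (c%:E * normal_prob 0 sigma [set x | B m (x + a)%R]).
  rewrite -boxE; last first.
    have : measurable_fun setT (fun x : R => x + a)%R by exact: measurable_funD.
    by move=> /(_ measurableT _ (mB m)); rewrite setTI.
  congr (gamma _); apply/seteqP; split=> [y By|y [By Dy]].
    split; first by have := By m; rewrite tnth_mktuple eqxx.
    by move=> j; have := By j; rewrite tnth_mktuple; case: eqP.
  move=> j; rewrite tnth_mktuple; case: eqP => [->//|/eqP jm].
  by have := Dy j; rewrite (negbTE jm).
rewrite normal_prob_shift// /weighted.
set h := fun x : R => expR (a * x / sigma ^+ 2 - a ^+ 2 / (2 * sigma ^+ 2)).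
have mh : measurable_fun setT (fun x : R => (h x)%:E).
  apply/measurable_EFinP; apply: measurableT_comp => //.
  by apply: measurable_funB => //; apply: measurable_funM.
have cN : (0 <= c)%R by [].
pose cnn : {nonneg R} := NngNum cN.
rewrite -[c]/(cnn%:num) -ge0_integral_mscale//; last 2 first.
- exact: mB.
- exact: measurable_funTS.
have mtn : measurable_fun setT ((@tnth M R)^~ m) by exact: measurable_tnth.
pose tn : {mfun M.-tuple R >-> measurableTypeR R} :=
  HB.pack ((@tnth M R)^~ m : M.-tuple R -> measurableTypeR R)
    (isMeasurableFun.Build _ _ (M.-tuple R) (measurableTypeR R) _ mtn).
transitivity (\int[pushforward (mrestr gamma mrest) tn]_(x in B m) (h x)%:E).
  apply: eq_measure_integral => D mD _.
  exact: (esym (boxE D mD)).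
rewrite ge0_integral_pushforward//; last 3 first.
- exact: mB.
- exact: measurable_funTS.
- by move=> x _; rewrite lee_fin expR_ge0.
rewrite ge0_integral_mrestr//; last 3 first.
- by rewrite -[_ @^-1` _]setTI; exact: (mtn measurableT _ (mB m)).
- by apply: measurable_funTS; exact: (measurableT_comp mh mtn).
- by move=> x _; rewrite lee_fin expR_ge0.
rewrite (_ : _ `&` _ = box B)//.
apply/seteqP; split=> [y [By Dy] j|y By].
  by have := Dy j; case: eqP => // ->.
by split=> [|j]; [exact: By|case: eqP].
Qed.

Definition shift_upto (g : M.-tuple R) (k : nat) y : M.-tuple R :=
  [tuple (if (j < k)%N then tnth y j + tnth g j else tnth y j)%R | j < M].

Definition log_shift_density (g : M.-tuple R) m y : R :=
  (tnth g m * tnth y m / sigma ^+ 2 - tnth g m ^+ 2 / (2 * sigma ^+ 2))%R.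

Lemma measurable_shift_upto g k : measurable_fun setT (shift_upto g k).
Proof.
apply/measurable_fun_tnthP => j /=.
rewrite (_ : _ \o _ = fun y =>
    if (j < k)%N then tnth y j + tnth g j else tnth y j)%R; last first.
  by apply/funext => y /=; rewrite tnth_mktuple.
case: (j < k)%N; last exact: measurable_tnth.
by apply: measurable_funD => //; exact: measurable_tnth.
Qed.

Lemma measurable_log_shift_density (g : M.-tuple R) m :
  measurable_fun setT (log_shift_density g m).
Proof.
apply: measurable_funB => //; apply: measurable_funM => //.
by apply: measurable_funM => //; exact: measurable_tnth.
Qed.

HB.instance Definition _ g k :=
  isMeasurableFun.Build _ _ _ _ _ (measurable_shift_upto g k).

Let gamma_shift_upto (g : M.-tuple R) k (A : set (M.-tuple R)) :
  (k <= M)%N -> measurable A ->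
  gamma (shift_upto g k @^-1` A) =
  \int[gamma]_(y in A)
    (expR (\sum_(m < M | (m < k)%N) log_shift_density g m y))%:E.
Proof.
elim: k A => [|k IH] A kM mA.
  rewrite (_ : shift_upto g 0 = id) ?preimage_id; last first.
    by apply/funext => y; apply: eq_from_tnth => j; rewrite tnth_mktuple.
  under eq_integral do rewrite big_pred0_eq expR0.
  by rewrite integral_cst// mul1e.
pose k' : 'I_M := Ordinal kM.
have mS (h : measurable_fun setT (shift_upto g k)) :
    measurable (shift_upto g k @^-1` A).
  by rewrite -[_ @^-1` _]setTI; exact: h.
have {}mS := mS (measurable_shift_upto g k).
have -> : shift_upto g k.+1 @^-1` A =
    shift_coord k' (tnth g k') @^-1` (shift_upto g k @^-1` A).
  apply/funext => y /=; congr (A _); apply: eq_from_tnth => j.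
  rewrite !tnth_mktuple ltnS leq_eqVlt -(inj_eq val_inj)/=.
  case: eqP => //= jk; rewrite jk ltnn; congr (_ + tnth g _)%R.
  exact: val_inj.
rewrite gamma_shift_coord; last exact: mS.
pose q (y : M.-tuple R) := (shift_density k' (tnth g k') y)%:E.
have mq : measurable_fun setT q.
  by apply/measurable_EFinP; exact: measurable_shift_density.
(* The factor [q] reads only coordinate k, which [shift_upto g k] leaves alone. The integral can
   therefore be transported to the image measure, whose density is given by the induction
   hypothesis. *)
transitivity (\int[distribution gamma (shift_upto g k)]_(y in A) q y).
  rewrite ge0_integral_pushforward; last 3 first.
  - exact: mA.
  - exact: measurable_funTS.
  - by move=> y _; rewrite lee_fin expR_ge0.
  - apply: eq_integral => y _; rewrite /q /= /shift_density tnth_mktuple.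
    by rewrite ltnn.
  - exact: measurable_shift_upto.
rewrite (@ge0_integral_density _ _ _ gamma (distribution gamma (shift_upto g k))
  (fun y => expR (\sum_(m < M | (m < k)%N) log_shift_density g m y)))//.
- apply: eq_integral => y _; rewrite -EFinM -expRD; congr (expR _)%:E.
  rewrite [RHS](bigD1 k')//=; congr (_ + _)%R.
  by apply: eq_bigl => j; rewrite ltnS ltn_neqAle andbC.
- apply: measurableT_comp => //; under eq_fun do rewrite big_mkcond/=.
  apply: measurable_sum => j; case: (j < k)%N => //.
  exact: measurable_log_shift_density.
- by move=> B mB; exact: (IH B (ltnW kM) mB).
- exact: measurable_funTS.
- by move=> y; rewrite lee_fin expR_ge0.
Qed.

(** The exponent sums to <g, y> / sigma^2 - |g|^2 / (2 sigma^2). *)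
Lemma cameron_martin (g : M.-tuple R) (A : set (M.-tuple R)) : measurable A ->
  gamma [set y | A (addt g y)] =
  \int[gamma]_(y in A) (expR (\sum_m log_shift_density g m y))%:E.
Proof.
move=> mA; rewrite -(_ : shift_upto g M @^-1` A = [set y | A (addt g y)]).
  rewrite gamma_shift_upto; [|exact: leqnn|exact: mA]; apply: eq_integral => y _.
  by congr (expR _)%:E; apply: eq_bigl => j; rewrite ltn_ord.
apply/funext => y /=; congr (A _); apply: eq_from_tnth => j.
by rewrite !tnth_mktuple ltn_ord addrC.
Qed.

End cameron_martin.

(** * The Euclidean norm on tuples and elementary Lipschitz estimates *)

Section tuples.
Context (R : realType) (M : nat).

Lemma norm2_sqr (y : M.-tuple R) : norm2 y ^+ 2 = \sum_m tnth y m ^+ 2.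
Proof. by rewrite sqr_sqrtr// sumr_ge0// => m _; exact: sqr_ge0. Qed.

Lemma measurable_addt d (T : measurableType d) (f g : T -> M.-tuple R) :
  measurable_fun setT f -> measurable_fun setT g ->
  measurable_fun setT (fun x => addt (f x) (g x)).
Proof.
move=> /measurable_fun_tnthP mf /measurable_fun_tnthP mg.
apply/measurable_fun_tnthP => m.
rewrite (_ : _ \o _ = fun x => tnth (f x) m + tnth (g x) m).
  exact: measurable_funD (mf m) (mg m).
by apply/funext => x /=; rewrite tnth_mktuple.
Qed.

End tuples.

Section norm2_theory.
Context (R : realType) (M : nat).
Implicit Types (x y z : M.-tuple R).

Lemma norm2_ge0 y : 0 <= norm2 y. Proof. exact: sqrtr_ge0. Qed.

(** The product B (A B - C^2) is the sum of the squares (B a_m - C b_m)^2; when B = 0 all the b_m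
    vanish. *)
Lemma cauchy_schwarz_sum (a b : 'I_M -> R) :
  (\sum_m a m * b m) ^+ 2 <= (\sum_m a m ^+ 2) * (\sum_m b m ^+ 2).
Proof.
set A := \sum_m a m ^+ 2; set B := \sum_m b m ^+ 2; set C := \sum_m _.
have B0 : 0 <= B by apply: sumr_ge0 => m _; exact: sqr_ge0.
have : 0 <= B * (A * B - C ^+ 2).
  have -> : B * (A * B - C ^+ 2) = \sum_m (B * a m - C * b m) ^+ 2.
    under eq_bigr do rewrite sqrrB !exprMn.
    rewrite big_split/= sumrB -!mulr_sumr -/A -/B.
    have -> : \sum_i B * a i * (C * b i) *+ 2 = B * C * (2 * C).
      by rewrite [2 * C]mulr_sumr mulr_sumr; apply: eq_bigr => m _; ring.
    by ring.
  by apply: sumr_ge0 => m _; exact: sqr_ge0.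
have [B_eq0 _|B_neq0] := eqVneq B 0; last first.
  by rewrite pmulr_rge0 ?lt0r ?B_neq0// subr_ge0.
have b0 m : b m = 0.
  have : b m ^+ 2 = 0 by apply: (psumr_eq0P (fun j _ => sqr_ge0 (b j)) B_eq0).
  by move=> /eqP; rewrite sqrf_eq0 => /eqP.
by rewrite /C big1 ?expr0n ?B_eq0 ?mulr0// => m _; rewrite b0 mulr0.
Qed.

Lemma norm2_addt y z : norm2 (addt y z) <= norm2 y + norm2 z.
Proof.
have yz0 : 0 <= norm2 y + norm2 z by rewrite addr_ge0 ?norm2_ge0.
rewrite -(@ler_pXn2r _ 2%N)// ?nnegrE ?norm2_ge0//.
rewrite sqrrD !norm2_sqr.
under eq_bigr do rewrite tnth_mktuple sqrrD.
rewrite big_split big_split/= sumrMnl lerD2r lerD2l lerMn2r/=.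
rewrite (le_trans (ler_norm _))//.
rewrite -(@ler_pXn2r _ 2%N)// ?nnegrE ?mulr_ge0 ?norm2_ge0//.
by rewrite exprMn !norm2_sqr real_normK ?num_real// cauchy_schwarz_sum.
Qed.

Lemma norm2_subtC y z : norm2 (subt y z) = norm2 (subt z y).
Proof.
congr Num.sqrt; apply: eq_bigr => m _.
by rewrite !tnth_mktuple -opprB sqrrN.
Qed.

Lemma norm2_sub_lipschitz x y z :
  `|norm2 (subt x y) - norm2 (subt x z)| <= norm2 (subt y z).
Proof.
have tri u v : norm2 (subt x u) - norm2 (subt x v) <= norm2 (subt u v).
  rewrite lerBlDr norm2_subtC [norm2 (subt x v)]norm2_subtC.
  rewrite (_ : subt u x = addt (subt u v) (subt v x)) ?norm2_addt//.
  by apply: eq_from_tnth => m; rewrite !tnth_mktuple addrA subrK.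
by rewrite ler_norml tri lerNl opprB [norm2 (subt y z)]norm2_subtC tri.
Qed.

End norm2_theory.

(** Let a <= b. If b - a >= 1, the left-hand side is at most 1. Otherwise 1 - exp(-(b^2 - a^2)) <=
    (b - a)(b + a), and b + a <= 2 a + 1 <= 3 (1 + a^2) <= 3 exp(a^2), which is where the constant
    comes from. *)
Lemma gauss_lipschitz (R : realType) (a b : R) : 0 <= a -> 0 <= b ->
  `|expR (- a ^+ 2) - expR (- b ^+ 2)| <= 3 * `|a - b|.
Proof.
wlog ab : a b / a <= b.
  move=> wl a0 b0; have [ab|/ltW ba] := leP a b; first exact: wl.
  by rewrite distrC [`|a - b|]distrC; exact: wl.
move=> a0 b0; have ab2 : a ^+ 2 <= b ^+ 2 by rewrite ler_pXn2r.
rewrite ger0_norm ?subr_ge0 ?ler_expR ?lerN2// distrC ger0_norm ?subr_ge0//.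
have a1 : expR (- a ^+ 2) <= 1 by rewrite -expR0 ler_expR oppr_le0 sqr_ge0.
have [ba1|ba1] := leP 1 (b - a).
  have := expR_ge0 (- b ^+ 2); lra.
have -> : expR (- b ^+ 2) = expR (- a ^+ 2) * expR (- (b ^+ 2 - a ^+ 2)).
  by rewrite -expRD; congr expR; ring.
rewrite -{1}[expR (- a ^+ 2)]mulr1 -mulrBr expRN ler_pdivrMl ?expR_gt0//.
have ea := expR_ge1Dx (a ^+ 2).
have eb := expR_ge1Dx (- (b ^+ 2 - a ^+ 2)).
apply: (@le_trans _ _ ((b - a) * (b + a))); first by nra.
rewrite [leRHS]mulrA [leRHS]mulrC ler_wpM2l ?subr_ge0//.
by nra.
Qed.

(** With u, v the roots of Z1, Z2 and w that of c, the difference r1 / u - r2 / v splits into (r1 -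
    r2) / u, at most D / w, and r2 (v - u) / (u v), at most D / w^3. *)
Lemma normalized_root_lipschitz (R : rcfType) (c D r1 r2 Z1 Z2 : R) :
  0 < c -> c <= Z1 -> c <= Z2 -> 0 <= r1 -> 0 <= r2 <= 1 ->
  `|r1 - r2| <= D -> `|Z1 - Z2| <= 2 * D ->
  `|Num.sqrt (Z1^-1 * r1 ^+ 2) - Num.sqrt (Z2^-1 * r2 ^+ 2)| <=
  ((Num.sqrt c)^-1 + (Num.sqrt c)^-1 ^+ 3) * D.
Proof.
move=> c0 cZ1 cZ2 r10 /andP[r20 r21] rD ZD.
have D0 : 0 <= D by exact: le_trans rD.
have w0 : 0 < Num.sqrt c by rewrite sqrtr_gt0.
have w1 : Num.sqrt c <= Num.sqrt Z1 by rewrite ler_wsqrtr.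
have w2 : Num.sqrt c <= Num.sqrt Z2 by rewrite ler_wsqrtr.
have Z10 : 0 <= Z1 by apply: le_trans cZ1; exact: ltW.
have Z20 : 0 <= Z2 by apply: le_trans cZ2; exact: ltW.
have sqrtE (Z r : R) : 0 <= Z -> 0 <= r ->
    Num.sqrt (Z^-1 * r ^+ 2) = (Num.sqrt Z)^-1 * r.
  by move=> Z0 r0; rewrite sqrtrM ?invr_ge0// sqrtrV// sqrtr_sqr ger0_norm.
rewrite !sqrtE//.
rewrite -[Z1]sqr_sqrtr// -[Z2]sqr_sqrtr// in ZD.
move: (Num.sqrt c) (Num.sqrt Z1) (Num.sqrt Z2) w0 w1 w2 ZD.
move=> w u v w0 wu wv uvD.
have u0 : 0 < u by exact: lt_le_trans wu.
have v0 : 0 < v by exact: lt_le_trans wv.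
have -> : u^-1 * r1 - v^-1 * r2 = u^-1 * (r1 - r2) + r2 * (v - u) / (u * v).
  by field; rewrite !gt_eqF.
rewrite (le_trans (ler_normD _ _))// mulrDl lerD//.
  rewrite normrM gtr0_norm ?invr_gt0// ler_pM ?invr_ge0 ?(ltW u0)//.
  by rewrite lef_pV2.
(* Divide |u^2 - v^2| <= 2 D by u + v >= 2 w. *)
have uv1 : `|v - u| * w <= D.
  have uvE : `|u ^+ 2 - v ^+ 2| = `|v - u| * (u + v).
    by rewrite subr_sqr normrM distrC (gtr0_norm (addr_gt0 u0 v0)).
  have := normr_ge0 (v - u); move: uvD; rewrite uvE; nra.
rewrite normrM normrM (ger0_norm r20) (gtr0_norm (_ : 0 < (u * v)^-1)); last first.
  by rewrite invr_gt0 mulr_gt0.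
rewrite ler_pdivrMr ?mulr_gt0//.
have -> : w^-1 ^+ 3 * D * (u * v) = (D / w) * ((u / w) * (v / w)).
  by field; rewrite gt_eqF.
have uw : 1 <= u / w by rewrite ler_pdivlMr// mul1r.
have vw : 1 <= v / w by rewrite ler_pdivlMr// mul1r.
apply: (@le_trans _ _ `|v - u|); first by rewrite ler_piMl.
apply: (@le_trans _ _ (D / w)); first by rewrite ler_pdivlMr.
by rewrite ler_peMr ?divr_ge0 ?(ltW w0)// (le_trans uw)// ler_peMr// (le_trans ler01).
Qed.

(** A zero integral would make [f] vanish almost everywhere, so the whole space would be null. *)
Lemma probability_integral_gt0 d (T : measurableType d) (R : realType)
    (P : probability T R) (f : T -> R) :
  measurable_fun setT f -> (forall x, 0 < f x) ->
  (0 < \int[P]_x (f x)%:E)%E.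
Proof.
move=> mf f0; rewrite lt0e; apply/andP; split; last first.
  by apply: integral_ge0 => s _; rewrite lee_fin ltW.
apply/eqP => I0.
have : ae_eq P setT (EFin \o f) (cst 0%E).
  apply/ae_eq_integral_abs => //; first exact/measurable_EFinP.
  by rewrite -I0; apply: eq_integral => s _; rewrite gee0_abs// lee_fin ltW.
move=> [N [mN N0 sub]].
have : P setT = 0%E.
  apply/eqP; rewrite eq_le measure_ge0 andbT -N0 le_measure ?inE//.
  apply: subset_trans sub => s _ /(_ I) [] /eqP.
  by rewrite gt_eqF.
by rewrite probability_setT => /eqP; rewrite onee_eq0.
Qed.

(** * The posterior as a measure with a density *)

Section bayes_formula.
Context (R : realType) d (S : measurableType d) (prior : probability S R).
Context (M : nat) (G : S -> M.-tuple R) (sigma : R).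
Hypotheses (mG : measurable_fun setT G) (sigma0 : 0 < sigma).
Implicit Types (y : M.-tuple R) (s : S).

Let Phi := neg_log_likelihood G sigma.

Lemma neg_log_likelihood_ge0 y s : 0 <= Phi y s.
Proof. by rewrite mulr_ge0 ?sqr_ge0// invr_ge0 mulr_ge0// sqr_ge0. Qed.

Lemma likelihood_le1 y s : expR (- Phi y s) <= 1.
Proof. by rewrite -expR0 ler_expR oppr_le0 neg_log_likelihood_ge0. Qed.

Lemma measurable_likelihood_pair :
  measurable_fun setT (fun x : S * M.-tuple R => expR (- Phi x.2 x.1)).
Proof.
apply: measurableT_comp => //; apply: measurable_funN.
apply: measurable_funM => //.
under eq_fun do rewrite norm2_sqr.
apply: measurable_sum => m; apply: measurable_funX => //.
rewrite (_ : (fun _ => _) =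
    fun x : S * M.-tuple R => tnth (G x.1) m - tnth x.2 m); last first.
  by apply/funext => x; rewrite tnth_mktuple.
apply: measurable_funB.
- apply: (measurableT_comp (measurable_tnth m)).
  exact: measurableT_comp.
- by apply: (measurableT_comp (measurable_tnth m)).
Qed.

Lemma measurable_likelihood y : measurable_fun setT (fun s => expR (- Phi y s)).
Proof. exact: (measurableT_comp measurable_likelihood_pair (pair2_measurable y)). Qed.

Definition evidence y : R := (\int[prior]_s expR (- Phi y s))%R.

Lemma integrable_likelihood y :
  prior.-integrable setT (fun s => (expR (- Phi y s))%:E).
Proof.
apply: (le_integrable measurableT (g := EFin \o cst 1)).
- by apply/measurable_EFinP; exact: measurable_likelihood.
- by move=> s _; rewrite /= lee_fin normr1 ger0_norm ?expR_ge0 ?likelihood_le1.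
- exact: finite_measure_integrable_cst.
Qed.

Lemma EFin_evidence y :
  (evidence y)%:E = (\int[prior]_s (expR (- Phi y s))%:E)%E.
Proof.
by rewrite /evidence /Rintegral fineK//; exact: integrable_fin_num (integrable_likelihood y).
Qed.

Lemma evidence_gt0 y : 0 < evidence y.
Proof.
rewrite -lte_fin EFin_evidence; apply: probability_integral_gt0 => [|s].
  exact: measurable_likelihood.
exact: expR_gt0.
Qed.

Definition posterior_density y s : R := (evidence y)^-1 * expR (- Phi y s).

Lemma measurable_posterior_density y :
  measurable_fun setT (posterior_density y).
Proof. by apply: measurable_funM => //; exact: measurable_likelihood. Qed.

Lemma posterior_density_ge0 y s : 0 <= posterior_density y s.
Proof. by rewrite mulr_ge0 ?expR_ge0// invr_ge0 ltW// evidence_gt0. Qed.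

Definition posterior y : set S -> \bar R :=
  weighted prior (measurable_posterior_density y) (posterior_density_ge0 y).

HB.instance Definition _ y := Measure.on (posterior y).

Lemma posteriorE y A : measurable A ->
  posterior y A =
  ((evidence y)^-1%:E * \int[prior]_(s in A) (expR (- Phi y s))%:E)%E.
Proof.
move=> mA; rewrite -ge0_integralZl//.
- by apply/measurable_EFinP/measurable_funTS; exact: measurable_likelihood.
- by rewrite lee_fin invr_ge0 ltW// evidence_gt0.
Qed.

Let posterior_setT y : posterior y setT = 1%E.
Proof.
by rewrite posteriorE// -EFin_evidence -EFinM mulVf// gt_eqF// evidence_gt0.
Qed.

HB.instance Definition _ y :=
  Measure_isProbability.Build _ _ _ (posterior y) (posterior_setT y).

Lemma posterior_dominates y : posterior y `<< prior.
Proof.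
apply/null_content_dominatesP => A mA A0; apply: null_set_integral => //.
by apply/measurable_EFinP/measurable_funTS; exact: measurable_posterior_density.
Qed.

Lemma density_posterior y :
  density (posterior y) prior = (fun s => (posterior_density y s)%:E) %[ae prior].
Proof.
apply: integral_ae_eq => //.
- by apply: Radon_Nikodym_integrable; exact: posterior_dominates.
- by apply/measurable_EFinP; exact: measurable_posterior_density.
- move=> A _ mA; rewrite /density -Radon_Nikodym_integral//.
  exact: posterior_dominates.
Qed.

Lemma measurable_integral_likelihood A : measurable A -> measurable_fun setT
  (fun y => \int[prior]_(s in A) (expR (- Phi y s))%:E)%E.
Proof.
move=> mA; apply: (@measurable_integral_on _ _ _ _ _ prior A
  (fun x : S * M.-tuple R => (expR (- Phi x.2 x.1))%:E)) => //.
by apply/measurable_EFinP; exact: measurable_likelihood_pair.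
Qed.

Lemma measurable_evidence : measurable_fun setT evidence.
Proof.
apply/measurable_EFinP; rewrite (_ : _ \o _ =
  fun y => \int[prior]_s (expR (- Phi y s))%:E)%E.
  exact: measurable_integral_likelihood.
by apply/funext => y /=; rewrite EFin_evidence.
Qed.

Lemma measurable_posterior A : measurable A ->
  measurable_fun setT (fun y => posterior y A).
Proof.
move=> mA; under eq_fun do rewrite posteriorE//.
apply: emeasurable_funM; last exact: measurable_integral_likelihood.
(* Measurability of 1 / Z is read off exp(- ln Z), which is legitimate as Z > 0. *)
under eq_fun do rewrite -[_^-1]lnK ?posrE ?invr_gt0 ?evidence_gt0//.
apply/measurable_EFinP; apply: measurableT_comp => //.
under eq_fun do rewrite lnV ?posrE ?evidence_gt0//.
apply: measurable_funN; apply: measurableT_comp; first exact: measurable_ln.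
exact: measurable_evidence.
Qed.

(** * The posterior is a conditional law *)

Section conditional_law.
Context dT (T : measurableType dT) (P : probability T R).
Variables (U : {mfun T >-> S}) (E : {mfun T >-> M.-tuple R}).
Hypothesis U_law : forall A, measurable A -> P (U @^-1` A) = prior A.
Hypothesis E_law : isotropic_gaussian P sigma E.
Hypothesis UE_indep : independent P U E.

Let Y t : M.-tuple R := addt (G (U t)) (E t).
Let gamma := distribution P E.

Local Open Scope ereal_scope.

(** At x = (s, y) this is the density at y of the law of G(s) + E with respect to the law [gamma] of
    E. *)
Let L (x : S * M.-tuple R) : R :=
  expR (\sum_m log_shift_density sigma (G x.1) m x.2).

(** Completing the square isolates a factor independent of s. *)
Let LE x : L x =
  (expR ((2 * sigma ^+ 2)^-1 * norm2 x.2 ^+ 2) * expR (- Phi x.2 x.1))%R.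
Proof.
rewrite /L -expRD; congr expR.
rewrite /Phi /neg_log_likelihood !norm2_sqr -mulrN -mulrDr -sumrN -big_split/=.
rewrite mulr_sumr; apply: eq_bigr => m _.
rewrite /log_shift_density tnth_mktuple.
by field; rewrite gt_eqF.
Qed.

Let measurable_weight : measurable_fun setT
  (fun y : M.-tuple R => expR ((2 * sigma ^+ 2)^-1 * norm2 y ^+ 2))%R.
Proof.
apply: measurableT_comp => //; apply: measurable_funM => //.
under eq_fun do rewrite norm2_sqr.
apply: measurable_sum => m; apply: measurable_funX => //.
exact: measurable_tnth.
Qed.

Let measurable_L : measurable_fun setT L.
Proof.
rewrite (funext LE); apply: measurable_funM; last exact: measurable_likelihood_pair.
exact: (measurableT_comp measurable_weight).
Qed.

Let integral_L A y : measurable A -> \int[prior]_(s in A) (L (s, y))%:E =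
  (expR ((2 * sigma ^+ 2)^-1 * norm2 y ^+ 2))%:E *
  \int[prior]_(s in A) (expR (- Phi y s))%:E.
Proof.
move=> mA; rewrite -ge0_integralZl//.
- by apply: eq_integral => s _; rewrite LE EFinM.
- by apply/measurable_EFinP/measurable_funTS; exact: measurable_likelihood.
Qed.

Let measurable_Y : measurable_fun setT Y.
Proof. by apply: measurable_addt => //; exact: measurableT_comp. Qed.

(** By independence (U, E) has law [prior] times [gamma]. The slice over s in [A] of the event is
    the set of noises that G(s) translates into [B], so the Cameron-Martin formula applies to each
    slice, and Tonelli's theorem exchanges the integrals. *)
Let joint_law A B : measurable A -> measurable B ->
  P (U @^-1` A `&` Y @^-1` B) =
  \int[gamma]_(y in B) \int[prior]_(s in A) (L (s, y))%:E.
Proof.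
move=> mA mB.
have mUE : measurable_fun setT (fun t => (U t, E t)).
  exact: measurable_fun_pair.
pose UE : {mfun T >-> (S * M.-tuple R)%type} :=
  HB.pack (fun t => (U t, E t)) (isMeasurableFun.Build _ _ _ _ _ mUE).
pose W := [set x : S * M.-tuple R | A x.1 /\ B (addt (G x.1) x.2)].
have mW : measurable W.
  rewrite (_ : W = fst @^-1` A `&`
      (fun x : S * M.-tuple R => addt (G x.1) x.2) @^-1` B)//.
  apply: measurableI; first by rewrite -[_ @^-1` _]setTI; exact: measurable_fst.
  rewrite -[_ @^-1` _]setTI; apply: measurable_addt => //.
  exact: measurableT_comp.
rewrite -[LHS]/(distribution P UE W).
rewrite -(@product_measure_unique _ _ _ _ _ prior gamma (distribution P UE))//;
    last first.
  move=> A' B' mA' mB'; transitivity (P (U @^-1` A') * P (E @^-1` B')).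
    exact: UE_indep.
  by congr (_ * _); exact: U_law.
rewrite -(@tonelli_on _ _ _ _ _ prior gamma A B (EFin \o L))//; last 2 first.
- exact/measurable_EFinP.
- by move=> x; rewrite lee_fin expR_ge0.
rewrite /product_measure1 [RHS]integral_mkcond; apply: eq_integral => s _ /=.
rewrite patchE; case: ifPn => [|/negP] /[!inE] sA; last first.
  rewrite (_ : xsection _ _ = set0) ?measure0//.
  by apply/seteqP; split => // y; rewrite /xsection/= inE => -[].
rewrite (_ : xsection _ _ = [set y | B (addt (G s) y)]); last first.
  apply/seteqP; split => y; rewrite /xsection/= inE; first by case.
  by move=> By; split.
exact: cameron_martin.
Qed.

Let Y_law B : measurable B -> P (Y @^-1` B) =
  \int[gamma]_(y in B)
    (expR ((2 * sigma ^+ 2)^-1 * norm2 y ^+ 2) * evidence y)%:E.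
Proof.
move=> mB; have := joint_law measurableT mB.
rewrite preimage_setT setTI => ->; apply: eq_integral => y _.
by rewrite integral_L// -EFin_evidence.
Qed.

(** The law of Y has a density with factor Z(y), which cancels the normalization of the posterior;
    what is left is the density of [joint_law]. *)
Lemma posterior_is_conditional_law : is_conditional_law P U Y posterior.
Proof.
split=> [A|A B mA mB]; first exact: measurable_posterior.
rewrite joint_law//.
pose Ym : {mfun T >-> M.-tuple R} :=
  HB.pack Y (isMeasurableFun.Build _ _ _ _ _ measurable_Y).
transitivity (\int[distribution P Ym]_(y in B) posterior y A); last first.
  rewrite ge0_integral_pushforward; [by []|exact: measurable_Y|exact: mB| |].
    by apply: measurable_funTS; exact: measurable_posterior.
  by move=> y _; exact: measure_ge0.
rewrite (@ge0_integral_density _ _ _ gamma (distribution P Ym) (fun y =>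
  expR ((2 * sigma ^+ 2)^-1 * norm2 y ^+ 2) * evidence y)%R); last 6 first.
- exact: measurable_funM measurable_weight measurable_evidence.
- by move=> y; rewrite mulr_ge0 ?expR_ge0// ltW// evidence_gt0.
- exact: Y_law.
- exact: mB.
- by apply: measurable_funTS; exact: measurable_posterior.
- by move=> y; exact: measure_ge0.
apply: eq_integral => y _; rewrite posteriorE//.
rewrite integral_L//; move: (expR (_ * _)) => e.
by rewrite [RHS]muleAC -EFinM mulrCA mulVf ?mulr1// gt_eqF// evidence_gt0.
Qed.

End conditional_law.

(** * Lipschitz dependence of the posterior on the data *)

Section hellinger_bound.

Let root y s : R := expR (- (norm2 (subt (G s) y) / (2 * sigma)) ^+ 2).

Let likelihoodE y s : expR (- Phi y s) = root y s ^+ 2.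
Proof.
rewrite /root expr2 -expRD; congr expR; rewrite /Phi /neg_log_likelihood.
by field; rewrite gt_eqF.
Qed.

Let root_ge0 y s : 0 <= root y s. Proof. exact: expR_ge0. Qed.

Let root_le1 y s : root y s <= 1.
Proof. by rewrite -expR0 ler_expR oppr_le0 sqr_ge0. Qed.

Let root_lipschitz y1 y2 s :
  `|root y1 s - root y2 s| <= 3 / (2 * sigma) * norm2 (subt y1 y2).
Proof.
have s2 : 0 < 2 * sigma by rewrite mulr_gt0.
apply: le_trans (gauss_lipschitz _ _) _; rewrite ?divr_ge0 ?norm2_ge0 ?(ltW s2)//.
rewrite -mulrBl normrM [`|_^-1|]gtr0_norm ?invr_gt0// -mulrA ler_pM2l//.
by rewrite mulrC ler_pM2l ?invr_gt0// norm2_sub_lipschitz.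
Qed.

(** The likelihood is the square of [root], and squares of numbers in [0, 1] differ by at most twice
    the difference of the numbers. *)
Let evidence_lipschitz y1 y2 : `|evidence y1 - evidence y2| <=
  2 * (3 / (2 * sigma) * norm2 (subt y1 y2)).
Proof.
set D := _ * norm2 _.
have le_evidence u v (zu zv e : R) :
    zu%:E = (\int[prior]_s (expR (- Phi u s))%:E)%E ->
    zv%:E = (\int[prior]_s (expR (- Phi v s))%:E)%E ->
    (forall s, `|root u s - root v s| <= e) -> zu <= zv + 2 * e.
  move=> zuE zvE uv; rewrite -lee_fin [(zv + _)%:E]EFinD zuE zvE.
  have -> : (2 * e)%:E = (\int[prior]_s (2 * e)%:E)%E.
    by rewrite integral_cst//= probability_setT mule1.
  have e0 : 0 <= e by exact: le_trans (uv point).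
  rewrite -ge0_integralD//; last 2 first.
  - by apply/measurable_EFinP; exact: measurable_likelihood.
  - by move=> s _; rewrite lee_fin mulr_ge0.
  apply: ge0_le_integral => //.
  - by apply/measurable_EFinP; exact: measurable_likelihood.
  - apply/measurable_EFinP; apply: measurable_funD => //.
    exact: measurable_likelihood.
  - move=> s _; rewrite lee_fin !likelihoodE.
    have := uv s; rewrite ler_norml => /andP[_].
    have := root_le1 u s; have := root_le1 v s.
    have := root_ge0 u s; have := root_ge0 v s.
    by nra.
have le12 : evidence y1 <= evidence y2 + 2 * D.
  apply: le_evidence (EFin_evidence y1) (EFin_evidence y2) _ => s.
  exact: root_lipschitz.
have le21 : evidence y2 <= evidence y1 + 2 * D.
  apply: le_evidence (EFin_evidence y2) (EFin_evidence y1) _ => s.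
  by rewrite distrC; exact: root_lipschitz.
move: (evidence y1) (evidence y2) (2 * D) le12 le21 => a b e ab ba.
by rewrite ler_norml lerNl opprB !lerBlDl ab ba.
Qed.

(** For |y| < r, |G(s) - y|^2 <= 2 |G(s)|^2 + 2 r^2, so the likelihood is bounded below by a
    positive function [f] of s alone. Its integral is positive however large |G| may be. *)
Let evidence_lower_bound r : 0 < r ->
  exists2 c, 0 < c & forall y, norm2 y < r -> c <= evidence y.
Proof.
move=> r0; pose f s : R :=
  expR (- ((2 * sigma ^+ 2)^-1 * (2 * norm2 (G s) ^+ 2 + 2 * r ^+ 2))).
have mf : measurable_fun setT f.
  apply: measurableT_comp => //; apply: measurable_funN.
  apply: measurable_funM => //; apply: measurable_funD => //.
  apply: measurable_funM => //; under eq_fun do rewrite norm2_sqr.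
  apply: measurable_sum => m; apply: measurable_funX => //.
  exact: (measurableT_comp (measurable_tnth m)).
have fle y : norm2 y < r -> (\int[prior]_s (f s)%:E <= (evidence y)%:E)%E.
  move=> yr; rewrite EFin_evidence; apply: ge0_le_integral => //.
  - by move=> s _; rewrite lee_fin expR_ge0.
  - exact/measurable_EFinP.
  - by apply/measurable_EFinP; exact: measurable_likelihood.
  - move=> s _; rewrite lee_fin ler_expR lerN2 ler_pM2l; last first.
      by rewrite invr_gt0 mulr_gt0// exprn_gt0.
    apply: (@le_trans _ _ (2 * norm2 (G s) ^+ 2 + 2 * norm2 y ^+ 2)); last first.
      by rewrite lerD2l ler_pM2l// ler_pXn2r ?nnegrE ?norm2_ge0 ?(ltW r0)// ltW.
    rewrite !norm2_sqr !mulr_sumr -big_split/=; apply: ler_sum => m _.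
    rewrite tnth_mktuple -subr_ge0 (_ : _ - _ = (tnth (G s) m + tnth y m) ^+ 2).
      exact: sqr_ge0.
    by ring.
have fpos := probability_integral_gt0 prior mf (fun=> expR_gt0 _).
have ffin : (\int[prior]_s (f s)%:E)%E \is a fin_num.
  rewrite ge0_fin_numE ?(ltW fpos)//.
  (* The zero vector lies in the ball, so the finite evidence there bounds the integral of [f]. *)
  apply: (le_lt_trans (fle [tuple 0 | m < M] _)); last exact: ltry.
  rewrite /norm2 big1 ?sqrtr0// => m _.
  by rewrite tnth_mktuple expr0n.
exists (fine (\int[prior]_s (f s)%:E)%E).
  by rewrite fine_gt0// fpos -ge0_fin_numE ?(ltW fpos).
by move=> y yr; rewrite -lee_fin fineK// fle.
Qed.

Lemma posterior_hellinger_lipschitz r : 0 < r ->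
  exists2 kappa, 0 < kappa & forall y1 y2, Num.max (norm2 y1) (norm2 y2) < r ->
    hellinger prior (posterior y1) (posterior y2) <=
    kappa * norm2 (subt y1 y2).
Proof.
move=> r0; have [c c0 cZ] := evidence_lower_bound r0.
have w0 : 0 < (Num.sqrt c)^-1 by rewrite invr_gt0 sqrtr_gt0.
(* The first factor is the constant of [normalized_root_lipschitz] for evidences at least c, the
   second the Lipschitz constant of [root] in y. *)
pose kappa := ((Num.sqrt c)^-1 + (Num.sqrt c)^-1 ^+ 3) * (3 / (2 * sigma)).
have kappa0 : 0 < kappa.
  by rewrite mulr_gt0 ?addr_gt0 ?exprn_gt0// divr_gt0// mulr_gt0.
exists kappa => // y1 y2; rewrite gt_max => /andP[y1r y2r].
set K := kappa * _; have K0 : 0 <= K by rewrite mulr_ge0 ?norm2_ge0// ltW.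
pose g s := (Num.sqrt (fine (density (posterior y1) prior s)) -
             Num.sqrt (fine (density (posterior y2) prior s))) ^+ 2.
have mroot y : measurable_fun setT
    (fun s => Num.sqrt (fine (density (posterior y) prior s))).
  apply: measurableT_comp.
    by apply: continuous_measurable_fun; exact: sqrt_continuous.
  apply: measurableT_comp => //; apply: measurable_int.
  by apply: Radon_Nikodym_integrable; exact: posterior_dominates.
have mg : measurable_fun setT g.
  by apply: measurable_funX; exact: measurable_funB.
(* The roots of the densities differ by at most K almost everywhere and the prior has mass one, so
   the integral of the squared difference is at most K^2. *)
have gK : (\int[prior]_s (g s)%:E <= (K ^+ 2)%:E)%E.
  have -> : (K ^+ 2)%:E = (\int[prior]_s (K ^+ 2)%:E)%E.
    by rewrite integral_cst//= probability_setT mule1.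
  apply: ae_ge0_le_integral => //.
  - by move=> s _; rewrite lee_fin sqr_ge0.
  - exact/measurable_EFinP.
  - by move=> s _; rewrite lee_fin sqr_ge0.
  have pointwise s (a b : \bar R) : a = (posterior_density y1 s)%:E ->
      b = (posterior_density y2 s)%:E ->
      (((Num.sqrt (fine a) - Num.sqrt (fine b)) ^+ 2)%:E <= (K ^+ 2)%:E)%E.
    move=> -> ->; rewrite lee_fin /=.
    rewrite -[leLHS]real_normK ?num_real// ler_pXn2r ?nnegrE//.
    rewrite /posterior_density !likelihoodE /K /kappa -mulrA.
    apply: normalized_root_lipschitz => //; first exact: cZ.
    - exact: cZ.
    - by rewrite root_ge0 root_le1.
  apply: filterS2 (density_posterior y1) (density_posterior y2).
  by move=> s /(_ I) d1 /(_ I) d2 _; exact: pointwise d1 d2.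
rewrite /hellinger -(@ler_pXn2r _ 2%N)// ?nnegrE ?sqrtr_ge0//.
have I0 : 0 <= (\int[prior]_s g s)%R.
  by apply: Rintegral_ge0 => s _; exact: sqr_ge0.
rewrite sqr_sqrtr ?mulr_ge0 ?invr_ge0//.
have : (\int[prior]_s g s)%R <= K ^+ 2.
  rewrite /Rintegral -lee_fin fineK// ge0_fin_numE.
    exact: le_lt_trans gK (ltry _).
  by apply: integral_ge0 => s _; rewrite lee_fin sqr_ge0.
by rewrite -/g; lra.
Qed.

End hellinger_bound.

End bayes_formula.

(** * Uniqueness of the posterior: the Borel sets of the profile space *)

Section square_integral_approximation.
Context d (T : measurableType d) (R : realType).
Variable mu : {measure set T -> \bar R}.
Hypothesis muT : (mu setT < +oo)%E.
Context (I : countType) (b : I -> set T).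
Hypothesis mb : forall i, measurable (b i).
Implicit Types (f g : T -> R) (k : seq (rat * I)).

Definition step_fun k : T -> R :=
  fun x => \sum_(p <- k) ratr p.1 * \1_(b p.2) x.

(** The squared L2 distance is an extended real here, so closeness can be stated without first
    proving square integrability. *)
Definition step_approximable f := forall e : R, 0 < e ->
  exists k, (\int[mu]_x ((f x - step_fun k x) ^+ 2)%:E < e%:E)%E.

Lemma measurable_step_fun k : measurable_fun setT (step_fun k).
Proof.
by apply: measurable_sum => p; apply: measurable_funM.
Qed.

Local Open Scope ereal_scope.

Lemma integral_sqrD f g : measurable_fun setT f -> measurable_fun setT g ->
  \int[mu]_x ((f x + g x) ^+ 2)%:E <=
  2%:E * \int[mu]_x (f x ^+ 2)%:E + 2%:E * \int[mu]_x (g x ^+ 2)%:E.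
Proof.
move=> mf mg.
have msqr (h : T -> R) : measurable_fun setT h ->
    measurable_fun setT (fun x => (h x ^+ 2)%:E).
  by move=> mh; apply/measurable_EFinP; exact: measurable_funX.
have m2 (h : T -> R) : measurable_fun setT h ->
    measurable_fun setT (fun x => 2%:E * (h x ^+ 2)%:E).
  by move=> mh; apply: emeasurable_funM => //; exact: msqr.
have sqr_pos (h : T -> R) x : 0 <= (h x ^+ 2)%:E by rewrite lee_fin sqr_ge0.
have sqr_pos2 (h : T -> R) x : 0 <= 2%:E * (h x ^+ 2)%:E.
  by rewrite mule_ge0.
rewrite -!ge0_integralZl//; [|exact: msqr|exact: msqr].
rewrite -ge0_integralD//; [|exact: m2|exact: m2].
apply: ge0_le_integral => //.
- by move=> x _; rewrite lee_fin sqr_ge0.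
- by apply: msqr; exact: measurable_funD.
- by apply: emeasurable_funD; exact: m2.
- move=> x _; rewrite -!EFinM -EFinD lee_fin.
  have := sqr_ge0 (f x - g x)%R; nra.
Qed.

Let lt_quarters (x y : \bar R) (e : R) : x < (e / 4)%:E -> y < (e / 4)%:E ->
  2%:E * x + 2%:E * y < e%:E.
Proof.
move=> xe ye.
have -> : e%:E = 2%:E * (e / 4)%:E + 2%:E * (e / 4)%:E.
  by rewrite -EFinM -EFinD; congr EFin; field.
by rewrite lteD// lte_pmul2l.
Qed.

Lemma step_approximable_lim f : measurable_fun setT f ->
  (forall e : R, (0 < e)%R -> exists g, [/\ measurable_fun setT g,
    step_approximable g & \int[mu]_x ((f x - g x) ^+ 2)%:E < e%:E]) ->
  step_approximable f.
Proof.
move=> mf fg e e0; have e4 : (0 < e / 4)%R by rewrite divr_gt0.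
have [g [mg /(_ _ e4)[k gk] fge]] := fg _ e4; exists k.
rewrite (_ : (fun _ => _) = fun x =>
    (((f x - g x) + (g x - step_fun k x)) ^+ 2)%:E); last first.
  by apply/funext => x; rewrite addrA subrK.
apply: le_lt_trans (integral_sqrD _ _) _.
- exact: measurable_funB.
- by apply: measurable_funB => //; exact: measurable_step_fun.
exact: lt_quarters.
Qed.

Lemma step_approximableD f g : measurable_fun setT f -> measurable_fun setT g ->
  step_approximable f -> step_approximable g ->
  step_approximable (fun x => f x + g x)%R.
Proof.
move=> mf mg fa ga e e0; have e4 : (0 < e / 4)%R by rewrite divr_gt0.
have [k fk] := fa _ e4; have [k' gk'] := ga _ e4; exists (k ++ k').
rewrite (_ : (fun _ => _) = fun x =>
    (((f x - step_fun k x) + (g x - step_fun k' x)) ^+ 2)%:E); last first.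
  by apply/funext => x; rewrite /step_fun big_cat/= opprD addrACA.
apply: le_lt_trans (integral_sqrD _ _) _.
- by apply: measurable_funB => //; exact: measurable_step_fun.
- by apply: measurable_funB => //; exact: measurable_step_fun.
exact: lt_quarters.
Qed.

Lemma step_approximable_ratr (q : rat) f : measurable_fun setT f ->
  step_approximable f -> step_approximable (fun x => ratr q * f x)%R.
Proof.
(* The added 1 keeps c positive when q = 0, so that e / c is a valid tolerance. *)
move=> mf fa e e0; pose c : R := (ratr q ^+ 2 + 1)%R.
have c0 : (0 < c)%R by rewrite ltr_wpDl// sqr_ge0.
have ec : (0 < e / c)%R by rewrite divr_gt0.
have [k fk] := fa _ ec; exists [seq (q * p.1, p.2)%R | p <- k].
apply: (@le_lt_trans _ _ (c%:E * \int[mu]_x ((f x - step_fun k x) ^+ 2)%:E)).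
  have mfk : measurable_fun setT (fun x => ((f x - step_fun k x) ^+ 2)%:E).
    apply/measurable_EFinP/measurable_funX; apply: measurable_funB => //.
    exact: measurable_step_fun.
  rewrite -ge0_integralZl//; last 2 first.
  - by move=> x _; rewrite lee_fin sqr_ge0.
  - by rewrite lee_fin ltW.
  apply: ge0_le_integral => //.
  - by move=> x _; rewrite lee_fin sqr_ge0.
  - apply/measurable_EFinP/measurable_funX; apply: measurable_funB.
      exact: measurable_funM.
    exact: measurable_step_fun.
  - exact: emeasurable_funM.
  move=> x _; rewrite -EFinM lee_fin.
  rewrite (_ : step_fun _ x = ratr q * step_fun k x)%R; last first.
    rewrite /step_fun big_map mulr_sumr; apply: eq_bigr => p _.
    by rewrite rmorphM/= mulrA.
  by rewrite -mulrBr exprMn ler_wpM2r ?sqr_ge0// lerDl.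
by rewrite muleC -lte_pdivlMr.
Qed.

Lemma step_approximableB f g : measurable_fun setT f -> measurable_fun setT g ->
  step_approximable f -> step_approximable g ->
  step_approximable (fun x => f x - g x)%R.
Proof.
move=> mf mg fa ga.
rewrite (_ : (fun _ => _) = fun x => f x + ratr (-1) * g x)%R; last first.
  by apply/funext => x; rewrite rmorphN1 mulN1r.
apply: step_approximableD => //; first exact: measurable_funM.
exact: step_approximable_ratr.
Qed.

Hypothesis bT : exists i, b i = setT.
Hypothesis bI : forall i j, exists l, b i `&` b j = b l.
Hypothesis bgen : @measurable _ T `<=` <<s range b >>.

Let integral_sqr_indic (A : set T) : measurable A ->
  \int[mu]_x ((\1_A x : R) ^+ 2)%:E = mu A.
Proof.
move=> mA; rewrite -[A in RHS]setIT -integral_indic//.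
apply: eq_integral => x _; rewrite indicE; case: (_ \in _) => /=.
  by rewrite expr1n.
by rewrite expr0n.
Qed.

(** The measurable sets with approximable indicator form a lambda-system containing the sets [b i],
    which are stable under intersection and generate. For increasing unions the approximation comes
    from continuity from below and the finite mass of [mu]. *)
Lemma step_approximable_indic (A : set T) : measurable A ->
  step_approximable (\1_A).
Proof.
move=> mA; suff : <<s range b >> `<=`
    [set B | measurable B /\ step_approximable (\1_B)].
  by move=> /(_ A (bgen mA))[].
have approxb i : step_approximable (\1_(b i)).
  move=> e e0; exists [:: (1%R, i)].
  rewrite integral0_eq// => x _; rewrite /step_fun big_seq1/=.
  by rewrite rmorph1 mul1r subrr expr0n.
apply: lambda_system_subset => //.
- by move=> _ _ [i _ <-] [j _ <-]; have [k ->] := bI i j; exists k.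
- split => //.
  + by case: bT => i bi; split => //; rewrite -bi.
  + move=> B C CB [mB Ba] [mC Ca]; split; first exact: measurableD.
    rewrite (_ : \1_(B `\` C) = fun x => \1_B x - \1_C x)%R; last first.
      apply/funext => x; rewrite !indicE in_setD.
      have [xC|xC] := boolP (x \in C); last by rewrite andbT subr0.
      have -> : x \in B by rewrite inE; apply: CB; rewrite inE in xC.
      by rewrite subrr.
    by apply: step_approximableB => //; exact: measurable_indic.
  + move=> F ndF FH; have mF n : measurable (F n) by have [] := FH n.
    have mUF : measurable (\bigcup_n F n) by exact: bigcup_measurable.
    split => //; apply: step_approximable_lim; first exact: measurable_indic.
    move=> e e0.
    have fin B : measurable B -> mu B < +oo.
      by move=> mB; apply: le_lt_trans muT; rewrite le_measure// inE.
    have cvgF : mu \o F @ \oo --> mu (\bigcup_n F n).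
      exact: nondecreasing_cvg_mu.
    have [n Fn] : exists n, mu (\bigcup_n F n) - e%:E < mu (F n).
      apply: contrapT => /forallNP noF.
      have : limn (mu \o F) <= mu (\bigcup_n F n) - e%:E.
        apply: lime_le; first by apply/cvg_ex; eexists; exact: cvgF.
        by apply: nearW => n /=; rewrite leNgt; apply/negP/noF.
      rewrite (cvg_lim _ cvgF)// leNgt lteBlDr// lteDl ?lte_fin ?e0//.
      by rewrite ge0_fin_numE// fin.
    exists (\1_(F n)); split; [exact: measurable_indic|by have [] := FH n|].
    rewrite (_ : (fun _ => _) =
        fun x => ((\1_(\bigcup_n F n `\` F n) x : R) ^+ 2)%:E); last first.
      apply/funext => x; rewrite !indicE in_setD; congr (_ ^+ 2)%:E.
      have [xF|xF] := boolP (x \in F n); last by rewrite andbT subr0.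
      have -> : x \in \bigcup_n F n by rewrite !inE in xF *; exists n.
      by rewrite subrr.
    rewrite integral_sqr_indic; last exact: measurableD.
    rewrite measureD//; last by rewrite fin.
    rewrite setIidr; last exact: bigcup_sup.
    by rewrite lteBlDr ?ge0_fin_numE ?fin// addeC -lteBlDr// ge0_fin_numE// fin.
- by move=> _ [i _ <-]; split.
Qed.

Lemma step_approximableM (c : R) (A : set T) : measurable A ->
  step_approximable (fun x => c * \1_A x)%R.
Proof.
move=> mA; have mAi : measurable_fun setT (\1_A : T -> R) by exact: measurable_indic.
apply: step_approximable_lim => [|e e0]; first exact: measurable_funM.
have muTr : mu setT = (fine (mu setT))%:E by rewrite fineK// ge0_fin_numE.
(* The added 1 allows a measure of zero mass; a rational q with (c - q)^2 < e / m then makes the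
   squared L2 error less than e. *)
pose m := (fine (mu setT) + 1)%R.
have m0 : (0 < m)%R by rewrite ltr_wpDl// fine_ge0.
pose e' := Num.sqrt (e / m).
have e'0 : (0 < e')%R by rewrite sqrtr_gt0 divr_gt0.
have [q /andP[cq qc]] : exists q : rat, (c - e' < ratr q < c + e')%R.
  have /rat_in_itvoo[q] : (c - e' < c + e')%R by rewrite ltrBlDr -addrA ltr_pwDr// addr_gt0.
  by rewrite in_itv/= => ?; exists q.
exists (fun x => ratr q * \1_A x)%R; split; first exact: measurable_funM.
  by apply: step_approximable_ratr => //; exact: step_approximable_indic.
apply: (@le_lt_trans _ _ (((c - ratr q) ^+ 2)%:E * mu A)).
  rewrite -integral_sqr_indic// -ge0_integralZl//.
  - under eq_integral do rewrite -mulrBl exprMn EFinM.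
    exact: lexx.
  - by apply/measurable_EFinP; exact: measurable_funX.
  - by rewrite lee_fin sqr_ge0.
apply: (@le_lt_trans _ _ (((c - ratr q) ^+ 2)%:E * mu setT)).
  by rewrite lee_wpmul2l ?lee_fin ?sqr_ge0// le_measure// inE.
rewrite muTr -EFinM lte_fin.
apply: (@le_lt_trans _ _ ((e / m) * fine (mu setT))%R).
  rewrite ler_wpM2r ?fine_ge0//.
  rewrite -[leRHS](@sqr_sqrtr _ (e / m)) ?divr_ge0 ?(ltW e0) ?(ltW m0)// -/e'.
  rewrite -[leLHS]real_normK ?num_real// ler_pXn2r ?nnegrE ?(ltW e'0)//.
  by rewrite ler_norml; apply/andP; split; apply/ltW; lra.
by rewrite mulrAC ltr_pdivrMr// ltr_pM2l// /m ltrDl.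
Qed.

Import HBNNSimple.

Lemma step_approximable_nnsfun (g : {nnsfun T >-> R}) : step_approximable g.
Proof.
have [s gE] : exists s : seq R, (g : T -> R) =
    fun x => (\sum_(y <- s) y * \1_(g @^-1` [set y]) x)%R.
  exists (finmap.enum_fset (fset_set (range g))).
  by apply/funext => x; rewrite fimfunE fsbig_finite.
rewrite {1}gE; elim: s {gE} => [|y s IH].
  move=> e e0; exists [::]; rewrite integral0_eq// => x _.
  by rewrite big_nil /step_fun big_nil subr0 expr0n.
under eq_fun do rewrite big_cons.
apply: step_approximableD => //; first exact: measurable_funM.
- by apply: measurable_sum => z; exact: measurable_funM.
- exact: step_approximableM.
Qed.

(** Increasing simple functions g_n below f converge to it, and (f - g_n)^2 <= f^2, so dominated
    convergence gives convergence in L2. *)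
Let step_approximable_ge0 f : measurable_fun setT f -> (forall x, (0 <= f x)%R) ->
  \int[mu]_x (f x ^+ 2)%:E < +oo -> step_approximable f.
Proof.
move=> mf f0 f2; have mEf : measurable_fun setT (EFin \o f) by exact/measurable_EFinP.
pose g n := nnsfun_approx measurableT mEf n.
have g_cvg x : EFin \o g^~ x @ \oo --> (f x)%:E.
  by apply: (cvg_nnsfun_approx measurableT mEf) => // y _; rewrite lee_fin.
have g_le n x : (g n x <= f x)%R.
  rewrite -lee_fin /g nnsfun_approxE.
  by apply: (le_approx _ (D := setT)) => // y _; rewrite lee_fin.
have mg n : measurable_fun setT (g n) by exact: measurable_funPT.
pose h n x := ((f x - g n x) ^+ 2)%:E.
have mh n : measurable_fun setT (h n).
  by apply/measurable_EFinP; apply: measurable_funX; exact: measurable_funB.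
have h_cvg x : h ^~ x @ \oo --> 0.
  have /fine_cvgP[_ gf] := g_cvg x.
  have fg0 : ((f x - g n x) ^+ 2 @[n --> \oo] --> (0 : R))%R.
    rewrite (_ : 0 = (f x - f x) ^+ 2)%R; last by rewrite subrr expr0n.
    by apply: cvgM; apply: cvgB => //; exact: cvg_cst.
  by apply: cvg_EFin => //; exact: nearW.
have if2 : mu.-integrable setT (fun x => (f x ^+ 2)%:E).
  apply/integrableP; split.
    by apply/measurable_EFinP; exact: measurable_funX.
  by under eq_integral do rewrite gee0_abs ?lee_fin ?sqr_ge0//.
have h_le n x : `|h n x| <= (f x ^+ 2)%:E.
  rewrite gee0_abs ?lee_fin ?sqr_ge0// ler_pXn2r ?nnegrE ?f0//.
    by rewrite lerBlDr lerDl.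
  by rewrite subr_ge0.
have [_ _ hint] := dominated_convergence measurableT mh (measurable_cst 0)
  (aeW mu (fun x _ => h_cvg x)) if2 (aeW mu (fun x n _ => h_le n x)).
rewrite integral0 in hint.
apply: step_approximable_lim => // e e0.
have [n hn] : exists n, \int[mu]_x h n x < e%:E.
  have /fine_cvgP[fin_near cvg_near] := hint.
  have near_e : \forall n \near \oo, (fine (\int[mu]_x h n x) < e)%R.
    exact: cvgr_lt 0%R cvg_near _ e0.
  have [n _ /(_ n (leqnn n))[]] := filterI fin_near near_e.
  by move=> /= hfin hlt; exists n; rewrite -(fineK hfin) lte_fin.
exists (g n); split => //; exact: step_approximable_nnsfun.
Qed.

Lemma step_approximable_square_integrable f : measurable_fun setT f ->
  \int[mu]_x (f x ^+ 2)%:E < +oo -> step_approximable f.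
Proof.
move=> mf f2.
have le_f2 (u : T -> R) : measurable_fun setT u ->
    (forall x, u x ^+ 2 <= f x ^+ 2)%R -> \int[mu]_x (u x ^+ 2)%:E < +oo.
  move=> mu_ uf; apply: le_lt_trans f2; apply: ge0_le_integral => //.
  - by move=> x _; rewrite lee_fin sqr_ge0.
  - by apply/measurable_EFinP; exact: measurable_funX.
  - by apply/measurable_EFinP; exact: measurable_funX.
  - by move=> x _; rewrite lee_fin.
pose pos (u : T -> R) x := Num.max (u x) 0%R.
have mpos u : measurable_fun setT u -> measurable_fun setT (pos u).
  by move=> m; exact: measurable_maxr.
pose Nf x := (- f x)%R.
have mNf : measurable_fun setT Nf by exact: measurable_funN.
rewrite (_ : f = fun x => pos f x - pos Nf x)%R; last first.
  by apply/funext => x; rewrite /pos /Nf; case: (leP (f x) 0%R) => ?;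
     case: (leP (- f x)%R 0%R) => ? /=; lra.
have pos_le u x : (pos u x ^+ 2 <= u x ^+ 2)%R.
  by rewrite /pos; case: (leP (u x) 0%R) => // _; rewrite expr0n sqr_ge0.
apply: step_approximableB; [exact: mpos|exact: mpos| |].
- apply: step_approximable_ge0; first exact: mpos.
    by move=> x; rewrite le_max lexx orbT.
  by apply: le_f2 => [|x]; [exact: mpos|exact: pos_le].
- apply: step_approximable_ge0; first exact: mpos.
    by move=> x; rewrite le_max lexx orbT.
  by apply: le_f2 => [|x]; [exact: mpos|rewrite -[leRHS]sqrrN; exact: pos_le].
Qed.

End square_integral_approximation.

(** * A countable family generating the Borel sets of the plane *)

Section plane.
Context (R : realType).
Let plane : Type := (measurableTypeR R * measurableTypeR R)%type.

(** The index [None] adds the whole plane to the rational quadrants, because the approximation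
    results ask for a family that contains the total space. *)
Definition quadrant (i : option (rat * rat)) : set plane :=
  if i is Some (p, q) then [set x | x.1 < ratr p /\ x.2 < ratr q] else setT.

Lemma measurable_quadrant i : measurable (quadrant i).
Proof.
case: i => [[p q]|] /=; last exact: measurableT.
rewrite (_ : [set _ | _] = `]-oo, ratr p[%classic `*` `]-oo, ratr q[%classic).
  by apply: measurableX; exact: measurable_itv.
by apply/seteqP; split=> [[x y]|[x y]] /=; rewrite !in_itv.
Qed.

Lemma quadrantI i j : exists l, quadrant i `&` quadrant j = quadrant l.
Proof.
case: i j => [[p q]|] [[p' q']|]; last 3 first.
- by exists (Some (p, q)); rewrite setIT.
- by exists (Some (p', q')); rewrite setTI.
- by exists None; rewrite setTI.
exists (Some (Num.min p p', Num.min q q')); apply/seteqP; split => x /=.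
  move=> [[? ?] [? ?]]; split; [case: (leP p p')|case: (leP q q')] => //.
move=> [xp xq]; have le_r (a c : rat) : a <= c -> ratr a <= ratr c :> R.
  by rewrite ler_rat.
split; split.
- by apply: lt_le_trans xp _; apply: le_r; rewrite ge_min lexx.
- by apply: lt_le_trans xq _; apply: le_r; rewrite ge_min lexx.
- by apply: lt_le_trans xp _; apply: le_r; rewrite ge_min lexx orbT.
- by apply: lt_le_trans xq _; apply: le_r; rewrite ge_min lexx orbT.
Qed.

Lemma plane_generated : (@measurable _ plane) `<=` <<s range quadrant>>.
Proof.
pose K := g_sigma_algebraType (range quadrant).
have mquad i : measurable (quadrant i : set K).
  by apply: sub_sigma_algebra; exists i.
have mfst : measurable_fun setT (fst : K -> measurableTypeR R).
  apply: (measurability _ (RGenInftyO.measurableE R)) => _ [_ [x ->] <-].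
  (* A half-plane is the countable union of the quadrants with rational abscissa q < x; the integer
     n exhausts the other coordinate. *)
  rewrite setTI (_ : _ @^-1` _ = \bigcup_(q : rat) \bigcup_(n : nat)
      (if ratr q < x then quadrant (Some (q, n%:R)) else set0) :> set K).
    apply: bigcupT_measurable_rat => q; apply: bigcupT_measurable => n.
    by case: ifP => _; [exact: mquad|exact: measurable0].
  apply/seteqP; split => p /=; rewrite in_itv/=; last first.
    move=> [q _ [n _]]; case: ifP => // qx [pq _]; exact: lt_trans qx.
  move=> /rat_in_itvoo[q]; rewrite in_itv/= => /andP[pq qx].
  exists q => //; have [n pn] : exists n : nat, p.2 < n%:R.
    exists (Num.bound `|p.2|); apply: le_lt_trans (ler_norm _) _.
    exact: archi_boundP.
  by exists n => //; rewrite qx; split => //; rewrite ratr_nat.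
have msnd : measurable_fun setT (snd : K -> measurableTypeR R).
  apply: (measurability _ (RGenInftyO.measurableE R)) => _ [_ [x ->] <-].
  rewrite setTI (_ : _ @^-1` _ = \bigcup_(q : rat) \bigcup_(n : nat)
      (if ratr q < x then quadrant (Some (n%:R, q)) else set0) :> set K).
    apply: bigcupT_measurable_rat => q; apply: bigcupT_measurable => n.
    by case: ifP => _; [exact: mquad|exact: measurable0].
  apply/seteqP; split => p /=; rewrite in_itv/=; last first.
    move=> [q _ [n _]]; case: ifP => // qx [_ pq]; exact: lt_trans qx.
  move=> /rat_in_itvoo[q]; rewrite in_itv/= => /andP[pq qx].
  exists q => //; have [n pn] : exists n : nat, p.1 < n%:R.
    exists (Num.bound `|p.1|); apply: le_lt_trans (ler_norm _) _.
    exact: archi_boundP.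
  by exists n => //; rewrite qx; split => //; rewrite ratr_nat.
move=> A mA; have := measurable_fun_pair mfst msnd measurableT mA.
rewrite setTI (_ : _ @^-1` _ = A)//.
by apply/seteqP; split => -[].
Qed.

End plane.

(** * Almost sure uniqueness of conditional laws *)

Section conditional_law_unique.
Context (R : realType) (d d1 d2 : measure_display).
Context (T : measurableType d) (P : probability T R).
Context (T1 : measurableType d1) (T2 : measurableType d2).
Context (U : T -> T1) (V : {mfun T >-> T2}).
Context (I : countType) (b : I -> set T1).
Hypothesis mb : forall i, measurable (b i).
Hypothesis bT : exists i, b i = setT.
Hypothesis bI : forall i j, exists l, b i `&` b j = b l.
Hypothesis bgen : @measurable _ T1 `<=` <<s range b >>.

(** For a fixed set the two kernels have the same integrals over every event of V, hence agree
    almost surely. The null sets of the countably many [b i] have a null union, outside of which the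
    two probabilities agree on a generating class stable under intersection. *)
Lemma conditional_law_ae_unique (post post' : T2 -> probability T1 R) :
  is_conditional_law P U V post -> is_conditional_law P U V post' ->
  {ae P, forall t, forall A, measurable A -> post' (V t) A = post (V t) A}.
Proof.
move=> [mpost condpost] [mpost' condpost'].
pose law := distribution P V.
have ae_eqA A : measurable A -> {ae P, forall t, post' (V t) A = post (V t) A}.
  move=> mA.
  have law_int (p : T2 -> probability T1 R) B :
      measurable_fun setT (fun y => p y A) -> measurable B ->
      (\int[law]_(y in B) p y A = \int[P]_(t in V @^-1` B) p (V t) A)%E.
    move=> mp mB; rewrite ge0_integral_pushforward; first by [].
    - exact: measurable_funPT.
    - exact: mB.
    - exact: measurable_funTS.
    - by move=> y _; exact: measure_ge0.
  have ae_law : ae_eq law setT (fun y => post' y A) (fun y => post y A).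
    apply: integral_ae_eq => //.
    - apply: (le_integrable measurableT (g := EFin \o cst 1)).
      + exact: mpost'.
      + move=> y _; rewrite /= normr1 gee0_abs//; exact: probability_le1.
      + exact: finite_measure_integrable_cst.
    - exact: mpost.
    - move=> B _ mB; rewrite !law_int//; [|exact: mpost|exact: mpost'].
      by rewrite -condpost// -condpost'.
  have [N [mN N0 sub]] := ae_law.
  exists (V @^-1` N); split.
  - by rewrite -[_ @^-1` _]setTI; exact: measurable_funPT.
  - exact: N0.
  - by move=> t /= neq; apply: sub => /= /(_ Logic.I).
(* The index type is enumerated through its codes; an integer that codes no index contributes a
   trivial statement. *)
have : {ae P, forall t, forall n : nat,
    if unpickle n is Some i then post' (V t) (b i) = post (V t) (b i)
    else True}.
  apply/ae_foralln => n; case: unpickle => [i|]; first exact: ae_eqA.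
  exact: aeW.
apply: filterS => t tE A mA.
apply: (g_sigma_algebra_measure_unique (range b) _ (fun=> setT)).
- by move=> _ [i _ <-]; exact: mb.
- by move=> _; case: bT => i bi; exists i.
- exact: bigcup_const.
- by move=> _ _ [i _ <-] [j _ <-]; have [l ->] := bI i j; exists l.
- by move=> _ [i _ <-]; have := tE (pickle i); rewrite pickleK.
- by move=> _; apply: le_lt_trans (ltry 1); exact: probability_le1.
- exact: bgen.
Qed.

End conditional_law_unique.

Section Lnorm2.
Context d (T : measurableType d) (R : realType).
Variable mu : {measure set T -> \bar R}.
Lemma Lnorm2_lt (h : T -> R) (e : R) : 0 < e ->
  (\int[mu]_x (h x ^+ 2)%:E < (e ^+ 2)%:E)%E ->
  (Lnorm mu 2%:E (EFin \o h) < e%:E)%E.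
Proof.
move=> e0; apply: contra_lt => eN.
have <- : (Lnorm mu 2%:E (EFin \o h) `^ 2)%E = (\int[mu]_x (h x ^+ 2)%:E)%E.
  rewrite poweR_Lnorm//; apply: eq_integral => x _ /=.
  by rewrite powR_mulrn// real_normK ?num_real.
have -> : (e ^+ 2)%:E = (e%:E `^ 2)%E by rewrite poweR_EFin powR_mulrn// ltW.
apply: gt0_ler_poweR => //; rewrite in_itv/= ?leey ?andbT ?Lnorm_ge0//.
by rewrite lee_fin ltW.
Qed.

End Lnorm2.

(** * A countable base of the profile space *)

Section profile_base.
Context (R : realType) (Q : square R).

Lemma area_Omega_lty : (area (Omega Q) < +oo)%E.
Proof.
rewrite /area /= /Omega product_measure1E; [|exact: measurable_itv..].
have itv_fin (a c : R) : (lebesgue_measure `]a, c[ < +oo)%E.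
  by rewrite lebesgue_measure_itv/=; case: ifP => _; rewrite -?EFinB ltry.
apply: lte_mul_pinfty; [exact: measure_ge0| |exact: itv_fin].
by rewrite ge0_fin_numE; [exact: itv_fin|exact: measure_ge0].
Qed.

Lemma area_Omega_fin : (area_Omega Q setT < +oo)%E.
Proof. by rewrite /area_Omega /= /mrestr setTI; exact: area_Omega_lty. Qed.

Let step_dist (f : L2_Omega Q) (k : seq (rat * option (rat * rat))) : \bar R :=
  Lnorm (area_Omega Q) 2%:E
    (EFin \o (fun x => fun_of_L2 f x - step_fun R (@quadrant R) k x)).

(* The centres are rational combinations of indicators of quadrants, which are
   functions rather than elements of [L2_Omega Q]. *)
Let norm2_ball k (n : nat) : set (L2_Omega Q) :=
  [set f | (step_dist f k < (n.+1%:R^-1)%:E)%E].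

Lemma measurable_L2 (f : L2_Omega Q) : measurable_fun setT (fun_of_L2 f).
Proof. by have := fun_of_L2_Lfun f; rewrite inE => /andP[+ _]; rewrite inE. Qed.

Let measurable_step k : measurable_fun setT (step_fun R (@quadrant R) k).
Proof. by apply: measurable_step_fun; exact: measurable_quadrant. Qed.

Let L2_triangle (f g : L2_Omega Q) k :
  (step_dist g k <= (L2_dist f g)%:E + step_dist f k)%E.
Proof.
rewrite /step_dist L2_distC L2_distE.
rewrite (_ : (fun x => fun_of_L2 g x - step_fun R (@quadrant R) k x) =
    ((fun_of_L2 g - fun_of_L2 f) \+
     (fun x => fun_of_L2 f x - step_fun R (@quadrant R) k x))); last first.
  by apply/funext => x /=; rewrite addrA subrK.
apply: eminkowski; last exact: lee1n.
- by apply: measurable_funB; exact: measurable_L2.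
- by apply: measurable_funB; [exact: measurable_L2|exact: measurable_step].
Qed.

Let L2_dist_lt (f g : L2_Omega Q) k n :
  norm2_ball k n f -> norm2_ball k n g -> L2_dist f g < 2 * n.+1%:R^-1.
Proof.
move=> fk gk; rewrite -lte_fin L2_distE.
rewrite (_ : fun_of_L2 f - fun_of_L2 g =
    (fun x => fun_of_L2 f x - step_fun R (@quadrant R) k x) \+
    (\- (fun x => fun_of_L2 g x - step_fun R (@quadrant R) k x))%R); last first.
  by apply/funext => x /=; rewrite opprB addrA subrK.
apply: le_lt_trans (eminkowski _ _ _ (lee1n 2)) _.
- by apply: measurable_funB; [exact: measurable_L2|exact: measurable_step].
- apply: measurable_funN.
  by apply: measurable_funB; [exact: measurable_L2|exact: measurable_step].
have -> : (2 * n.+1%:R^-1)%:E =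
    ((n.+1%:R^-1)%:E + (n.+1%:R^-1)%:E)%E :> \bar R.
  by rewrite -EFinD mulr_natl mulr2n.
rewrite lteD//.
by move: gk; rewrite /norm2_ball/= /step_dist -oppe_Lnorm.
Qed.

Let norm2_ball_open k n : open (norm2_ball k n).
Proof.
rewrite openE => f fk; apply/nbhs_ballP.
have [r rE] : exists r, step_dist f k = r%:E.
  move: fk; rewrite /norm2_ball/=; have : (0 <= step_dist f k)%E.
    exact: Lnorm_ge0.
  by case: (step_dist f k) => [r| |]// _ _; exists r.
exists (n.+1%:R^-1 - r).
  by move: fk; rewrite /norm2_ball/= rE lte_fin subr_gt0.
move=> g /= fg; rewrite /norm2_ball/=; apply: le_lt_trans (L2_triangle f g k) _.
rewrite rE -EFinD lte_fin -ltrBrDr.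
exact: fg.
Qed.

(** This is the separability of L2 on Omega: for each radius, countably many centres suffice. *)
Let norm2_ball_dense (f : L2_Omega Q) n : exists k, norm2_ball k n f.
Proof.
have n0 : 0 < n.+1%:R^-1 :> R by rewrite invr_gt0.
have [] := @step_approximable_square_integrable _ _ R (area_Omega Q)
  area_Omega_fin _ (@quadrant R) (@measurable_quadrant R) _ (@quadrantI R)
  (@plane_generated R) (fun_of_L2 f) (@measurable_L2 f) _ (n.+1%:R^-1 ^+ 2).
- by exists None.
- have /integrableP[_] := Lfun2_integrable_sqr (fun_of_L2_Lfun f).
  by under eq_integral do rewrite gee0_abs ?lee_fin ?sqr_ge0//.
- by rewrite exprn_gt0.
by move=> k fk; exists k; exact: Lnorm2_lt.
Qed.

Context (S : ptopologicalType) (carrier : S -> L2_Omega Q * R * R).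
Hypothesis hS : is_profile_space carrier.

Definition profile_box
    (j : seq (rat * option (rat * rat)) * rat * rat * nat) : set S :=
  let: (k, p, q, n) := j in
  [set s | [/\ norm2_ball k n (carrier s).1.1,
    `|(carrier s).1.2 - ratr p| < n.+1%:R^-1 &
    `|(carrier s).2 - ratr q| < n.+1%:R^-1]].

Lemma continuous_carrier : continuous carrier.
Proof.
by apply/continuousP => V oV; apply/(proj2 hS); exists V.
Qed.

Lemma continuous_field : continuous (fun s => (carrier s).1.1).
Proof.
move=> s; apply: (continuous_comp (g := fst \o fst)).
  exact: continuous_carrier.
by apply: continuous_comp; exact: cvg_fst.
Qed.

Lemma continuous_cp : continuous (fun s => (carrier s).1.2).
Proof.
move=> s; apply: (continuous_comp (g := snd \o fst)).
  exact: continuous_carrier.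
by apply: continuous_comp; [exact: cvg_fst|exact: cvg_snd].
Qed.

Lemma continuous_cn : continuous (fun s => (carrier s).2).
Proof.
by move=> s; apply: continuous_comp; [exact: continuous_carrier|exact: cvg_snd].
Qed.

Lemma profile_box_open j : open (profile_box j).
Proof.
move: j => [[[k p] q] n] /=.
have c11 := continuous_field; have c12 := continuous_cp.
have c2 := continuous_cn.
rewrite (_ : [set _ | _] = (fun s => (carrier s).1.1) @^-1` norm2_ball k n `&`
   ((fun s => (carrier s).1.2) @^-1` ball (ratr p : R) n.+1%:R^-1 `&`
    (fun s => (carrier s).2) @^-1` ball (ratr q : R) n.+1%:R^-1)).
  apply: openI; first by apply: open_comp => // s _; exact: c11.
  by apply: openI; apply: open_comp => //; exact: ball_open.
apply/seteqP; split => s /=; rewrite /ball/= [`|ratr p - _|]distrC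
    [`|ratr q - _|]distrC.
  by move=> [].
by move=> [? []].
Qed.

Lemma profile_box_base (V : set S) s : open V -> V s ->
  exists2 j, profile_box j s & profile_box j `<=` V.
Proof.
move=> /(proj2 hS)[W oW ->] /= Ws.
have /nbhs_ballP[e /= e0 eW] := open_nbhs_nbhs (conj oW Ws).
(* Two points of a common box are within 1 / (n + 1) of the same centre, hence within 2 / (n + 1) of
   each other in each of the three components. *)
have [n ne] : exists n : nat, 2 * n.+1%:R^-1 < e.
  have [n ne] : exists n : nat, 2 / e < n%:R.
    by exists (Num.bound (2 / e)); apply: archi_boundP; rewrite divr_ge0// ltW.
  exists n; rewrite ltr_pdivrMr// mulrC -ltr_pdivrMr//; apply: lt_trans ne _.
  by rewrite ltr_nat.
have n0 : 0 < n.+1%:R^-1 :> R by rewrite invr_gt0.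
have approx_rat (x : R) : exists q : rat, `|x - ratr q| < n.+1%:R^-1.
  have /rat_in_itvoo[q] : x - n.+1%:R^-1 < x + n.+1%:R^-1.
    by rewrite ltrBlDr -addrA ltrDl addr_gt0.
  rewrite in_itv/= => /andP[qx xq]; exists q.
  move: qx xq; move: (_^-1) (ratr q) => r z qx xq.
  by rewrite ltr_norml; apply/andP; split; lra.
have [k sk] := norm2_ball_dense (carrier s).1.1 n.
have [p sp] := approx_rat (carrier s).1.2.
have [q sq] := approx_rat (carrier s).2.
have rat_close (x y : R) r : `|x - ratr r| < n.+1%:R^-1 ->
    `|y - ratr r| < n.+1%:R^-1 -> `|x - y| < e.
  move=> xr yr; apply: lt_trans ne; rewrite -(subrKA (ratr r)).
  apply: le_lt_trans (ler_normD _ _) _.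
  by rewrite mulr_natl mulr2n ltrD// distrC.
exists (k, p, q, n) => // t [tk tp tq]; apply: eW; split; first split.
- by apply: lt_trans ne; exact: L2_dist_lt sk tk.
- exact: rat_close sp tp.
- exact: rat_close sq tq.
Qed.

(** An intersection of boxes need not be a box; the finite intersections form a countable class
    stable under intersection, with the whole space as the empty one. *)
Definition profile_cell
    (js : seq (seq (rat * option (rat * rat)) * rat * rat * nat)) : set S :=
  [set s | forall j, j \in js -> profile_box j s].

Lemma profile_cellT : profile_cell [::] = setT.
Proof. by apply/seteqP; split. Qed.

Lemma profile_cellI js ls :
  exists js', profile_cell js `&` profile_cell ls = profile_cell js'.
Proof.
exists (js ++ ls); apply/seteqP; split => s.
  by move=> [sj sl] j; rewrite mem_cat => /orP[/sj|/sl].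
by move=> sjl; split=> j jj; apply: sjl; rewrite mem_cat jj ?orbT.
Qed.

Lemma open_profile_cell js : open (profile_cell js).
Proof.
elim: js => [|j js IH]; first by rewrite profile_cellT; exact: openT.
rewrite (_ : profile_cell _ = profile_box j `&` profile_cell js).
  by apply: openI => //; exact: profile_box_open.
apply/seteqP; split => s.
  move=> sj; split; first by apply: sj; rewrite mem_head.
  by move=> i ijs; apply: sj; rewrite inE ijs orbT.
by move=> [sj sjs] i; rewrite inE => /orP[/eqP->//|]; exact: sjs.
Qed.

Lemma measurable_profile_cell js : measurable (profile_cell js : set (Borel S)).
Proof. by apply: sub_sigma_algebra; exact: open_profile_cell. Qed.

(** An open set is the union of the boxes that it contains, and there are only countably many
    boxes. *)
Lemma borel_profile_generated :
  (@measurable _ (Borel S)) `<=` <<s range profile_cell>>.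
Proof.
apply: smallest_sub; first exact: smallest_sigma_algebra.
move=> V oV; pose K := g_sigma_algebraType (range profile_cell).
have -> : V = \bigcup_j (if `[< profile_cell [:: j] `<=` V >]
    then profile_cell [:: j] else set0).
  apply/seteqP; split => [s Vs|s [j _]].
    have [j sj jV] := profile_box_base oV Vs; exists j => //.
    case: asboolP => [_ i|notV]; first by rewrite inE => /eqP->.
    by exfalso; apply: notV => t tj; apply: jV; apply: tj; rewrite mem_head.
  by case: asboolP => // jV; exact: jV.
apply: (@countable_bigcupT_measurable _ K) => [|j].
  exact: countableP.
case: asboolP => _; last exact: (@measurable0 _ K).
by apply: sub_sigma_algebra; exists [:: j].
Qed.

End profile_base.

(** * Measurability of functionals of solutions of equations *)

Section row_vectors.
Context (R : realType) (n : nat).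

Lemma continuous_row (X : topologicalType) (f : X -> 'rV[R]_n) :
  (forall j, continuous (fun x => f x ord0 j)) -> continuous f.
Proof.
move=> fc x A [P fxP PA].
have nbP j : nbhs x [set y | P ord0 j (f y ord0 j)] by exact: (fc j x).
have allP : nbhs x [set y | forall j, P ord0 j (f y ord0 j)].
  exact: filter_forall.
rewrite nbhs_filterE; apply: filterS allP => y yP; apply: PA => i j.
by rewrite (ord1 i); exact: yP.
Qed.

Lemma row_hausdorff : hausdorff_space 'rV[R]_n.
Proof.
rewrite ball_hausdorff => a b ab.
have [j abj] : exists j, a ord0 j != b ord0 j.
  apply: contrapT => /forallNP ab0; move/eqP: ab; apply; apply/rowP => j.
  by apply/eqP/negPn/negP/ab0.
have := @Rhausdorff R; rewrite ball_hausdorff => /(_ _ _ abj)[r rE].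
exists r; apply/eqP/seteqP; split => // v [[_ av] [_ bv]].
have : (ball (a ord0 j) r.1%:num `&` ball (b ord0 j) r.2%:num) (v ord0 j).
  by split; [exact: av|exact: bv].
by rewrite (eqP rE).
Qed.

Definition cube (k : nat) : set 'rV[R]_n :=
  [set v | forall j, v ord0 j \in `[- k%:R, k%:R]].

Lemma cube_compact k : compact (cube k).
Proof.
apply: (@rV_compact R n (fun=> `[- k%:R, k%:R]%classic)) => _.
exact: segment_compact.
Qed.

Lemma cube_cover v : exists k, cube k v.
Proof.
exists (\max_j Num.bound `|v ord0 j|) => j.
rewrite in_itv/= -ler_norml; apply/ltW; apply: lt_le_trans (archi_boundP _) _ => //.
by rewrite ler_nat; exact: leq_bigmax.
Qed.

Lemma borel_measurable_closed (S : ptopologicalType) (A : set S) :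
  closed A -> measurable (A : set (Borel S)).
Proof.
move=> cA; rewrite -(setCK A); apply: measurableC; apply: sub_sigma_algebra.
exact: closed_openC.
Qed.

(* The preimages of [f] are built from preimages under [b] of images under [A]
   of compact sets, so that the solutions need not depend measurably on [s] a
   priori, nor exist. *)
Lemma measurable_solution_functional (S : ptopologicalType)
    (A : 'rV[R]_n -> 'rV[R]_n) (b : S -> 'rV[R]_n) (L : 'rV[R]_n -> R)
    (f : S -> R) :
  continuous A -> continuous b -> continuous L ->
  (forall s U, A U = b s -> f s = L U) ->
  (forall s, ~ (exists U, A U = b s) -> f s = 0) ->
  measurable_fun setT (f : Borel S -> R).
Proof.
move=> cA cb cL fL f0.
have mimg (C : set 'rV[R]_n) : closed C ->
    measurable ([set s | exists2 U, C U & A U = b s] : set (Borel S)).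
  move=> cC; rewrite (_ : [set _ | _] =
      \bigcup_k (b @^-1` (A @` (cube k `&` C))) :> set (Borel S)); last first.
    apply/seteqP; split => [s [U CU AU]|s [k _ [U [_ CU] AU]]].
      by have [k kU] := cube_cover U; exists k => //; exists U.
    by exists U.
  apply: bigcupT_measurable => k; apply: borel_measurable_closed.
  apply: (closed_comp (f := b)) => [s _|]; first exact: cb.
  apply: compact_closed; first exact: row_hausdorff.
  apply: continuous_compact; first exact: continuous_subspaceT.
  by apply: compact_closedI => //; exact: cube_compact.
apply: (measurability _ (RGenCInfty.measurableE R)) => _ [_ [x ->] <-].
(* Either a solution exists at which L reaches the level x, or there is no solution and the default
   value 0 reaches it. *)
rewrite setTI (_ : _ @^-1` _ =
    [set s | exists2 U, (L @^-1` [set r | x <= r]) U & A U = b s] `|`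
    ((~` [set s | exists2 U, setT U & A U = b s]) `&` [set _ | x <= 0])).
  apply: measurableU.
    apply: mimg; apply: closed_comp => [U _|]; first exact: cL.
    exact: closed_ge.
  apply: measurableI.
    by apply: measurableC; apply: mimg; exact: closedT.
  have [x0|x0] := leP x 0.
    by rewrite (_ : [set _ | _] = setT)//; apply/seteqP.
  by rewrite (_ : [set _ | _] = set0)//; apply/seteqP; split => //.
apply/seteqP; split => s /=; rewrite in_itv/= andbT.
  move=> xf; have [[U AU]|noU] := pselect (exists U, A U = b s).
    by left; exists U => //=; rewrite -(fL _ _ AU).
  right; split; last by rewrite -(f0 s noU).
  by move=> [U _ AU]; apply: noU; exists U.
move=> [[U /= LU AU]|[noU x0]]; first by rewrite (fL _ _ AU).
by rewrite f0// => -[U AU]; apply: noU; exists U.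
Qed.

End row_vectors.

(** * Hat functions and the discrete problem *)

Section barycentric.
Context (R : realType) (n : nat) (pt : 'I_n -> R * R).
Implicit Types (K : {set 'I_n}) (x y p q : R * R) (c : 'I_n -> R).

Definition cross p q : R := p.1 * q.2 - p.2 * q.1.

Lemma sum_three (f : 'I_n -> R) (a b c : 'I_n) :
  a != b -> a != c -> b != c ->
  (forall i, i \notin [set a; b; c]%SET -> f i = 0) ->
  \sum_i f i = f a + f b + f c.
Proof.
move=> ab ac bc f0.
rewrite (bigD1 a)//= (bigD1 b) 1?eq_sym//= (bigD1 c) ?[c == a]eq_sym ?[c == b]eq_sym ?ac ?bc//=.
rewrite big1 ?addr0 ?addrA// => i /andP[/andP[ia ib] ic].
by apply: f0; rewrite !inE !negb_or ia ib ic.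
Qed.

Lemma card3_set K : #|K| = 3%N ->
  exists a b c : 'I_n, [/\ a != b, a != c, b != c & K = [set a; b; c]%SET].
Proof.
move=> K3; have /card_gt0P[a aK] : (0 < #|K|)%N by rewrite K3.
have /eqP/cards2P[b [c [bc KE]]] : #|(K :\ a)%SET| = 2%N.
  by have := cardsD1 a K; rewrite aK K3 add1n => -[].
have : b \in (K :\ a)%SET by rewrite KE !inE eqxx.
have : c \in (K :\ a)%SET by rewrite KE !inE eqxx orbT.
rewrite !inE => /andP[ca cK] /andP[ba bK].
exists a, b, c; split=> //; [by rewrite eq_sym|by rewrite eq_sym|].
by rewrite -finset.setUA -KE finset.setD1K.
Qed.

(* A coordinate system on the plane attached to the vertices of [K]: the
   [L i] are affine with linear parts [D i]. *)
Record barycentric K (L : 'I_n -> R * R -> R) (D : 'I_n -> R * R) : Prop :=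
  Barycentric {
    bary_supported : forall x, supported (L^~ x) K;
    bary_sum : forall x, \sum_i L i x = 1;
    bary_combination : forall x, combination pt (L^~ x) = x;
    bary_affine : forall i x y, L i y = L i x + dot (D i) (y - x);
    bary_unique : forall c, supported c K -> \sum_i c i = 1 ->
      forall i, c i = L i (combination pt c);
    bary_spans : forall p,
      (forall i j, i \in K -> j \in K -> dot p (pt i - pt j) = 0) -> p = 0 }.

(** This is Cramer's rule: the coordinates at b and c are quotients of cross products by
    [cross p q], twice the signed area of the triangle, which affine independence makes nonzero. *)
Lemma barycentric_ex K : #|K| = 3%N -> affinely_independent pt K ->
  exists LD : ('I_n -> R * R -> R) * ('I_n -> R * R), barycentric K LD.1 LD.2.
Proof.
move=> /card3_set[a [b [c [ab ac bc ->]]]] indep.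
have [ba ca cb] : [/\ b != a, c != a & c != b] by split; rewrite eq_sym.
pose f (u v w : R) (i : 'I_n) : R :=
  if i == a then u else if i == b then v else if i == c then w else 0.
have f_supp u v w : supported (f u v w) [set a; b; c]%SET.
  by move=> i; rewrite !inE !negb_or /f => /andP[/andP[/negbTE-> /negbTE->] /negbTE->].
have fa u v w : f u v w a = u by rewrite /f eqxx.
have fb u v w : f u v w b = v by rewrite /f (negbTE ba) eqxx.
have fc u v w : f u v w c = w by rewrite /f (negbTE ca) (negbTE cb) eqxx.
have sum_f u v w : \sum_i f u v w i = u + v + w.
  by rewrite (@sum_three _ a b c)// ?fa ?fb ?fc//; exact: f_supp.
have comb_g (g : 'I_n -> R) : supported g [set a; b; c]%SET -> combination pt g =
    (g a * (pt a).1 + g b * (pt b).1 + g c * (pt c).1,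
     g a * (pt a).2 + g b * (pt b).2 + g c * (pt c).2).
  move=> g0; rewrite /combination.
  by congr (_, _); rewrite (@sum_three _ a b c)// => i iK; rewrite g0// mul0r.
pose p := pt b - pt a; pose q := pt c - pt a.
have indep_pq u v : u * p.1 + v * q.1 = 0 -> u * p.2 + v * q.2 = 0 -> u = 0 /\ v = 0.
  move=> e1 e2; have := indep (f (- (u + v)) u v) (f_supp _ _ _).
  rewrite sum_f => /(_ _ _) h.
  have {}h : forall i, f (- (u + v)) u v i = 0.
    apply: h; first by ring.
    rewrite comb_g ?fa ?fb ?fc; last exact: f_supp.
    by move: e1 e2; rewrite /p /q /= => e1 e2; congr (_, _); [rewrite -e1|rewrite -e2]; ring.
  by split; [rewrite -(fb (- (u + v)) u v)|rewrite -(fc (- (u + v)) u v)]; exact: h.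
have D0 : cross p q != 0.
  apply/eqP => D0.
  (* With zero area, the pairs (q.1, - p.1) and (q.2, - p.2) are coefficients of linear relations
     between p and q, so both vectors vanish; then (1, 0) is a relation too. *)
  have [q1 /eqP] : q.1 = 0 /\ - p.1 = 0.
    apply: indep_pq; first by ring.
    by rewrite -oppr0 -D0 /cross; ring.
  rewrite oppr_eq0 => /eqP p1.
  have [q2 /eqP] : q.2 = 0 /\ - p.2 = 0.
    apply: indep_pq; last by ring.
    by rewrite -D0 /cross; ring.
  rewrite oppr_eq0 => /eqP p2.
  have [/eqP] : 1 = 0 :> R /\ 0 = 0 :> R.
    by apply: indep_pq; rewrite ?p1 ?p2 ?q1 ?q2; ring.
  by rewrite oner_eq0.
pose lb x := cross (x - pt a) q / cross p q.
pose lc x := cross p (x - pt a) / cross p q.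
pose L i x := f (1 - lb x - lc x) (lb x) (lc x) i.
pose Db : R * R := (q.2 / cross p q, - q.1 / cross p q).
pose Dc : R * R := (- p.2 / cross p q, p.1 / cross p q).
pose D i := (f (- Db.1 - Dc.1) Db.1 Dc.1 i, f (- Db.2 - Dc.2) Db.2 Dc.2 i).
have suppL x : supported (L^~ x) [set a; b; c]%SET by exact: f_supp.
have sumL x : \sum_i L i x = 1 by rewrite sum_f; ring.
have combL x : combination pt (L^~ x) = x.
  rewrite comb_g// /L fa fb fc [RHS]surjective_pairing; congr (_, _).
    by rewrite /lb /lc /cross /p /q /=; field; exact: D0.
  by rewrite /lb /lc /cross /p /q /=; field; exact: D0.
exists (L, D); split => //=.
- move=> i x y; rewrite /L /D /lb /lc /Db /Dc /=.
  move: (cross p q)^-1 => e; rewrite /f /dot /cross /=.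
  by case: ifP => _; [|case: ifP => _; [|case: ifP => _]]; ring.
- move=> g g_supp sum_g i.
  apply/eqP; rewrite -subr_eq0; apply/eqP.
  apply: (indep (fun i => g i - L i (combination pt g))).
  + by move=> j jK; rewrite g_supp// suppL// subrr.
  + by rewrite sumrB sum_g sumL subrr.
  + have := combL (combination pt g); rewrite /combination => -[e1 e2].
    by congr (_, _); under eq_bigr do rewrite mulrBl; rewrite sumrB ?e1 ?e2 subrr.
- move=> r rK.
  have r1 : dot r p = 0 by apply: rK; rewrite !inE eqxx ?orbT.
  have r2 : dot r q = 0 by apply: rK; rewrite !inE eqxx ?orbT.
  rewrite [r]surjective_pairing; congr (_, _).
    apply: (mulIf D0); rewrite mul0r.
    rewrite (_ : _ * _ = dot r p * q.2 - dot r q * p.2); last first.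
      by rewrite /cross /dot; ring.
    by rewrite r1 r2; ring.
  apply: (mulIf D0); rewrite mul0r.
  rewrite (_ : _ * _ = dot r q * p.1 - dot r p * q.1); last first.
    by rewrite /cross /dot; ring.
  by rewrite r1 r2; ring.
Qed.

End barycentric.

(** * Hat functions of the triangulation *)

Section hat_functions.
Context (R : realType) (Q : square R) (tri : triangulation Q).
Local Notation n := (nb_nodes tri).
Local Notation pt := (@node R Q tri).
Implicit Types (K : {set 'I_n}) (i j : 'I_n) (x y p q : R * R)
  (v : R * R -> R) (c U : 'I_n -> R).

Definition bary_pair K : ('I_n -> R * R -> R) * ('I_n -> R * R) :=
  xget (fun _ _ => 0, fun=> 0) [set LD | barycentric pt K LD.1 LD.2].

Definition bary K := (bary_pair K).1.

Definition bslope K := (bary_pair K).2.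

Lemma baryP K : K \in cells tri -> barycentric pt K (bary K) (bslope K).
Proof.
move=> Kc; have [LD h] := barycentric_ex (card_cell Kc) (cell_nondegenerate Kc).
by rewrite /bary /bslope /bary_pair; case: xgetP => [? _ //|/(_ LD)].
Qed.

Lemma hullP K x : K \in cells tri ->
  hull pt K x <-> forall i, 0 <= bary K i x.
Proof.
move=> Kc; split => [[c [c0 cK c1 ->]] i|x0].
  by rewrite -(bary_unique (baryP Kc) cK c1).
by exists (bary K ^~ x); split=> //;
  [exact: (bary_supported (baryP Kc))|exact: (bary_sum (baryP Kc))|
   rewrite (bary_combination (baryP Kc))].
Qed.

(** By conformity the shared point is a convex combination of the common vertices. Its coefficients
    are supported in both cells, so uniqueness of barycentric coordinates in each cell identifies
    them with both sides. This makes the hat functions independent of the cell chosen. *)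
Lemma bary_coherent K K' x i : K \in cells tri -> K' \in cells tri ->
  hull pt K x -> hull pt K' x -> bary K i x = bary K' i x.
Proof.
move=> Kc K'c xK xK'.
have : hull pt (K :&: K') x by rewrite -(cells_conforming Kc K'c); split.
move=> [c [_ cKK' c1 ->]].
rewrite -(bary_unique (baryP Kc) _ c1) -?(bary_unique (baryP K'c) _ c1)//.
  by move=> j jK; apply: cKK'; rewrite finset.inE negb_and jK orbT.
by move=> j jK; apply: cKK'; rewrite finset.inE negb_and jK.
Qed.

(* At a point shared by several cells this is the cell chosen by [grad]. *)
Definition cell_of x := [pick K in cells tri | `[< hull pt K x >]].

Definition hat i x := if cell_of x is Some K then bary K i x else 0.

Definition ghat i x := if cell_of x is Some K then bslope K i else 0.

Lemma cell_ofP x : closed_Omega Q x ->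
  exists K, [/\ K \in cells tri, hull pt K x & cell_of x = Some K].
Proof.
rewrite -(cells_cover tri) => -[K /= Kc xK]; rewrite /cell_of.
case: pickP => [K' /andP[K'c /asboolP xK']|/(_ K)]; first by exists K'.
by rewrite Kc/= => /asboolP.
Qed.

Lemma cell_closed_Omega K x : K \in cells tri -> hull pt K x -> closed_Omega Q x.
Proof. by move=> Kc xK; rewrite -(cells_cover tri); exists K. Qed.

Lemma hat_cell K x i : K \in cells tri -> hull pt K x -> hat i x = bary K i x.
Proof.
move=> Kc xK; rewrite /hat.
have [K' [K'c xK' ->]] := cell_ofP (cell_closed_Omega Kc xK).
exact: bary_coherent.
Qed.

Lemma bary_node K i j : K \in cells tri -> j \in K -> bary K i (pt j) = (i == j)%:R.
Proof.
move=> Kc jK; pose c k : R := (k == j)%:R.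
have sum_c (f : 'I_n -> R) : \sum_k c k * f k = f j.
  rewrite (bigD1 j)//= big1 ?addr0 /c ?eqxx ?mul1r// => k /negbTE->.
  by rewrite mul0r.
have -> : pt j = combination pt c.
  by rewrite /combination !sum_c -surjective_pairing.
rewrite -(bary_unique (baryP Kc))// => [k kK|].
  by rewrite /c; case: eqP kK => // ->; rewrite jK.
by rewrite -[RHS](sum_c (fun=> 1)); apply: eq_bigr => k _; rewrite mulr1.
Qed.

Lemma node_hull K j : K \in cells tri -> j \in K -> hull pt K (pt j).
Proof. by move=> Kc jK; apply/(hullP _ Kc) => i; rewrite bary_node// ler0n. Qed.

Lemma hat_node i j : hat i (pt j) = (i == j)%:R.
Proof.
have [K Kc jK] := node_used j.
by rewrite (hat_cell _ Kc (node_hull Kc jK)) bary_node.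
Qed.

Lemma node_closed_Omega j : closed_Omega Q (pt j).
Proof.
by have [K Kc jK] := node_used j; exact: (cell_closed_Omega Kc (node_hull Kc jK)).
Qed.

Lemma hat_ge0 i x : 0 <= hat i x.
Proof.
rewrite /hat /cell_of; case: pickP => // K /andP[Kc /asboolP xK].
exact: (hullP x Kc).1.
Qed.

Lemma sum_hat x : closed_Omega Q x -> \sum_i hat i x = 1.
Proof.
move=> /cell_ofP[K [Kc xK _]]; under eq_bigr do rewrite (hat_cell _ Kc xK).
exact: (bary_sum (baryP Kc)).
Qed.

Lemma hat_le1 i x : hat i x <= 1.
Proof.
have [xO|xO] := pselect (closed_Omega Q x).
  by rewrite -(sum_hat xO) (bigD1 i)//= lerDl sumr_ge0// => j _; exact: hat_ge0.
rewrite /hat /cell_of; case: pickP => [K /andP[Kc /asboolP xK]|_]; last exact: ler01.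
by exfalso; apply: xO; exact: (cell_closed_Omega Kc xK).
Qed.

Definition vcomb U (D : 'I_n -> R * R) : R * R :=
  (\sum_i U i * (D i).1, \sum_i U i * (D i).2).

Lemma dot_vcomb U D y : dot (vcomb U D) y = \sum_i U i * dot (D i) y.
Proof.
rewrite /dot /vcomb /= !mulr_suml -big_split/=.
by apply: eq_bigr => i _; rewrite mulrDr !mulrA.
Qed.

Lemma slope_on_unique K v p q : K \in cells tri ->
  slope_on K v p -> slope_on K v q -> p = q.
Proof.
move=> Kc vp vq; apply/eqP; rewrite -subr_eq0; apply/eqP.
apply: (bary_spans (baryP Kc)) => i j iK jK.
have := vp _ _ (node_hull Kc jK) (node_hull Kc iK).
rewrite (vq _ _ (node_hull Kc jK) (node_hull Kc iK)) => /addrI.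
rewrite /dot /= => e; rewrite mulrBl mulrBl.
apply/eqP; rewrite addrACA -opprD subr_eq0; apply/eqP; exact: esym.
Qed.

Lemma slope_on_nodal K v U : K \in cells tri ->
  (forall x, hull pt K x -> v x = \sum_i U i * hat i x) ->
  slope_on K v (vcomb U (bslope K)).
Proof.
move=> Kc vU x y xK yK; rewrite !vU// dot_vcomb -big_split/=.
apply: eq_bigr => i _; rewrite -mulrDr; congr (_ * _).
by rewrite !(hat_cell _ Kc)// (bary_affine (baryP Kc) i x y).
Qed.

Lemma P1_nodal v U :
  (forall x, closed_Omega Q x -> v x = \sum_i U i * hat i x) -> P1 tri v.
Proof.
move=> vU K Kc; exists (vcomb U (bslope K)); apply: slope_on_nodal => // x xK.
exact: vU (cell_closed_Omega Kc xK).
Qed.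

(** Expand the affine function around x in each node of a cell: the first-order terms cancel because
    x is the barycentre of the nodes with weights [bary K i x]. *)
Lemma P1_expand v x : P1 tri v -> closed_Omega Q x ->
  v x = \sum_i v (pt i) * hat i x.
Proof.
move=> vP /cell_ofP[K [Kc xK _]]; have [p vp] := vP _ Kc.
under eq_bigr do rewrite (hat_cell _ Kc xK).
transitivity (\sum_i (v x + dot p (pt i - x)) * bary K i x); last first.
  apply: eq_bigr => i _; have [iK|iK] := boolP (i \in K).
    by rewrite (vp x (pt i))//; exact: node_hull.
  by rewrite (bary_supported (baryP Kc))// !mulr0.
under eq_bigr do rewrite mulrDl.
rewrite big_split/= -mulr_sumr (bary_sum (baryP Kc)) mulr1.
have e := bary_combination (baryP Kc) x.
have e1 : \sum_i bary K i x * (pt i).1 = x.1 by rewrite -[in RHS]e.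
have e2 : \sum_i bary K i x * (pt i).2 = x.2 by rewrite -[in RHS]e.
rewrite [X in _ + X](_ : _ = dot p
    (\sum_i bary K i x * (pt i).1 - (\sum_i bary K i x) * x.1,
     \sum_i bary K i x * (pt i).2 - (\sum_i bary K i x) * x.2)).
  by rewrite (bary_sum (baryP Kc)) !mul1r e1 e2 !subrr /dot /= !mulr0 !addr0.
rewrite /dot /= !mulr_suml -!sumrB !mulr_sumr -big_split/=.
by apply: eq_bigr => i _; ring.
Qed.

Lemma P1_hat i : P1 tri (hat i).
Proof.
apply: (P1_nodal (U := fun j => (i == j)%:R)) => x _.
rewrite (bigD1 i)//= eqxx mul1r big1 ?addr0// => j.
by rewrite eq_sym => /negbTE->; rewrite mul0r.
Qed.

Lemma grad_P1 v x : P1 tri v -> grad tri v x = vcomb (v \o pt) (ghat ^~ x).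
Proof.
move=> vP; rewrite /grad /ghat /cell_of; case: pickP => [K /andP[Kc _]|_]; last first.
  by rewrite /vcomb; congr (_, _); rewrite big1// => i _; rewrite mulr0.
have vU : slope_on K v (vcomb (v \o pt) (bslope K)).
  apply: slope_on_nodal => // y yK.
  exact: P1_expand vP (cell_closed_Omega Kc yK).
case: xgetP => [p _ /= vp|/(_ _ vU)//].
exact: slope_on_unique Kc vp vU.
Qed.

Lemma nodal_basisP i : P1 tri (nodal_basis i) /\
  forall j, nodal_basis (tri := tri) i (pt j) = (i == j)%:R.
Proof.
rewrite /nodal_basis; case: xgetP => [//|/(_ (hat i))[]].
by split; [exact: P1_hat|move=> j; exact: hat_node].
Qed.

(** Nodal values determine a finite element function on the closed square only; outside it
    [nodal_basis] has the values of an arbitrary choice. *)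
Lemma nodal_basis_hat i x : closed_Omega Q x -> nodal_basis i x = hat i x.
Proof.
move=> xO; rewrite (P1_expand (nodal_basisP i).1 xO) (P1_expand (P1_hat i) xO).
by apply: eq_bigr => j _; rewrite (nodal_basisP i).2 hat_node.
Qed.

Lemma grad_nodal_basis i x : grad tri (nodal_basis i) x = ghat i x.
Proof.
rewrite grad_P1; last exact: (nodal_basisP i).1.
have sum_i (f : 'I_n -> R) : \sum_k (nodal_basis i \o pt) k * f k = f i.
  rewrite (bigD1 i)//= (nodal_basisP i).2 eqxx mul1r big1 ?addr0// => k.
  by rewrite (nodal_basisP i).2 eq_sym => /negbTE->; rewrite mul0r.
by rewrite /vcomb !sum_i -surjective_pairing.
Qed.

End hat_functions.

(** * Bounded measurable functions and their integrals *)

Section bounded_measurable_functions.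
Context d (X : measurableType d) (R : realType).
Implicit Types f g : X -> R.

Definition bounded_measurable f :=
  measurable_fun setT f /\ exists M, forall x, `|f x| <= M.

Lemma bounded_measurable_cst (a : R) : bounded_measurable (fun=> a).
Proof. by split=> //; exists `|a|. Qed.

Lemma bounded_measurableD f g : bounded_measurable f -> bounded_measurable g ->
  bounded_measurable (fun x => f x + g x).
Proof.
move=> [mf [M fM]] [mg [N gN]]; split; first exact: measurable_funD.
by exists (M + N) => x; rewrite (le_trans (ler_normD _ _))// lerD.
Qed.

Lemma bounded_measurableM f g : bounded_measurable f -> bounded_measurable g ->
  bounded_measurable (fun x => f x * g x).
Proof.
move=> [mf [M fM]] [mg [N gN]]; split; first exact: measurable_funM.
by exists (M * N) => x; rewrite normrM ler_pM.
Qed.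

Lemma bounded_measurable_sum (J : finType) (f : J -> X -> R) :
  (forall j, bounded_measurable (f j)) ->
  bounded_measurable (fun x => \sum_j f j x).
Proof.
move=> fP; split.
  by apply: measurable_sum => j; exact: (fP j).1.
exists (\sum_j xget 0 [set M | forall x, `|f j x| <= M]) => x.
apply: (le_trans (ler_norm_sum _ _ _)); apply: ler_sum => j _.
have [_ [M fM]] := fP j.
by case: xgetP => [N _ //|/(_ M)].
Qed.

(** The index picked depends on x only through the set of indices satisfying [P x]. There are
    finitely many such sets, and on the measurable event that the set is A the choice is
    constant. *)
Lemma bounded_measurable_pick (J : finType) (P : X -> pred J) (h : J -> X -> R) :
  (forall j, measurable [set x | P x j]) ->
  (forall j, measurable_fun setT (h j)) ->
  (exists M, forall j x, P x j -> `|h j x| <= M) ->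
  bounded_measurable (fun x => if [pick j | P x j] is Some j then h j x else 0).
Proof.
move=> mP mh [M hM]; split; last first.
  exists `|M| => x; case: pickP => [j Pj|_]; last by rewrite normr0.
  by rewrite (le_trans (hM _ _ Pj))// ler_norm.
rewrite (_ : (fun x => _) = fun x => \sum_(A : {set J})
    (if [set j | P x j]%SET == A then
       (if [pick j in A] is Some j then h j x else 0) else 0)); last first.
  apply/funext => x; rewrite (bigD1 [set j | P x j]%SET)//= eqxx big1 ?addr0.
    suff -> : [pick j in [set j | P x j]%SET] = [pick j | P x j] by [].
    by apply: eq_pick => j; rewrite /= finset.inE.
  by move=> A; rewrite eq_sym => /negbTE->.
apply: measurable_sum => A; apply: measurable_fun_ifT => //.
  apply: (measurable_fun_bool true); rewrite setTI.
  rewrite (_ : _ @^-1` _ = \bigcap_(j in [set: J]) [set x | P x j = (j \in A)]).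
    apply: fin_bigcap_measurable => // j _.
    case: (j \in A); first exact: mP.
    rewrite (_ : [set _ | _] = ~` [set x | P x j]); first exact: measurableC.
    by apply/seteqP; split => x /=; [move=> ->|move/negP/negbTE].
  apply/seteqP; split => x /=.
    by move=> /eqP <- j _; rewrite finset.inE.
  by move=> h'; apply/eqP/finset.setP => j; rewrite finset.inE h'.
by case: pickP.
Qed.

Variable mu : {measure set X -> \bar R}.
Variable (D : set X) (mD : measurable D) (finD : (mu D < +oo)%E).

Lemma bounded_measurable_integrable f : bounded_measurable f ->
  mu.-integrable D (EFin \o f).
Proof.
move=> [mf [M fM]]; apply: measurable_bounded_integrable => //.
  exact: measurable_funTS.
by exists M; split; rewrite ?num_real// => N MN x _; exact: (le_trans (fM x) (ltW MN)).
Qed.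

Lemma bounded_measurable_RintegralZ a f : bounded_measurable f ->
  (\int[mu]_(x in D) (a * f x) = a * \int[mu]_(x in D) f x)%R.
Proof. by move=> fP; rewrite RintegralZl//; exact: bounded_measurable_integrable. Qed.

Lemma bounded_measurable_Rintegral_sum (J : finType) (f : J -> X -> R) :
  (forall j, bounded_measurable (f j)) ->
  (\int[mu]_(x in D) (\sum_j f j x) = \sum_j \int[mu]_(x in D) f j x)%R.
Proof.
move=> fP; rewrite /Rintegral -[RHS]/(\sum_j fine (\int[mu]_(x in D) (EFin \o f j) x)).
have intf j := bounded_measurable_integrable (fP j).
rewrite sum_fine; last by move=> j _; exact: integrable_fin_num.
congr fine; rewrite -integral_sum//.
by apply: eq_integral => x _; rewrite /= sumEFin.
Qed.

End bounded_measurable_functions.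

(** * Measurability and boundary behaviour of the hat functions *)

Section hat_measurability.
Context (R : realType) (Q : square R) (tri : triangulation Q).
Local Notation n := (nb_nodes tri).
Local Notation pt := (@node R Q tri).
Local Notation plane := (measurableTypeR R * measurableTypeR R)%type.
Implicit Types (K : {set 'I_n}) (i j : 'I_n) (x y p : R * R).

Lemma measurable_bary K i : K \in cells tri ->
  measurable_fun setT (bary K i : plane -> R).
Proof.
move=> Kc; rewrite (_ : bary K i = fun y => bary K i 0 +
    ((bslope K i).1 * y.1 + (bslope K i).2 * y.2)); last first.
  apply/funext => y; rewrite (bary_affine (baryP Kc) i 0 y) /dot /=.
  by rewrite !subr0.
apply: measurable_funD => //; apply: measurable_funD; apply: measurable_funM => //.
Qed.

Lemma measurable_hull K : K \in cells tri -> measurable (hull pt K : set plane).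
Proof.
move=> Kc; rewrite (_ : hull pt K = \bigcap_(i in [set: 'I_n])
    (bary K i @^-1` `[0, +oo[)).
  apply: fin_bigcap_measurable => // i _; rewrite -[X in measurable X]setTI.
  exact: (measurable_bary i Kc).
apply/seteqP; split => x /=.
  by move/(hullP _ Kc) => h i _ /=; rewrite in_itv/= h.
by move=> h; apply/(hullP _ Kc) => i; have := h i Logic.I; rewrite /= in_itv/= andbT.
Qed.

Lemma measurable_in_cell K :
  measurable ([set x | (K \in cells tri) && `[< hull pt K x >]] : set plane).
Proof.
have [Kc|Kc] := boolP (K \in cells tri); last first.
  by rewrite (_ : [set _ | _] = set0)//; apply/seteqP; split.
rewrite (_ : [set _ | _] = hull pt K); first exact: measurable_hull.
by apply/seteqP; split => x /= /asboolP.
Qed.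

Lemma bounded_measurable_hat i : bounded_measurable (hat i : plane -> R).
Proof.
(* Nothing is known of [bary K i] when K is not a cell, so the branch is replaced by 0 there; this
   changes no value, since only cells are picked. *)
have [m _] : bounded_measurable (fun x : plane => if [pick K in cells tri |
    `[< hull pt K x >]] is Some K then
      if K \in cells tri then bary K i x else 0 else 0).
  apply: bounded_measurable_pick => [K|K|].
  - exact: measurable_in_cell.
  - case: (boolP (K \in cells tri)) => [Kc|_]; last exact: measurable_cst.
    exact: measurable_bary.
  - exists 1 => K x /andP[Kc /asboolP xK]; rewrite Kc -(hat_cell _ Kc xK).
    by rewrite ger0_norm ?hat_le1 ?hat_ge0.
split; last by exists 1 => x; rewrite ger0_norm ?hat_le1 ?hat_ge0.
congr (measurable_fun _ _) : m; apply/funext => x; rewrite /hat /cell_of.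
by case: pickP => // K /andP[-> _].
Qed.

Lemma bounded_measurable_ghat i :
  bounded_measurable (fun x : plane => (ghat i x : R * R).1) /\
  bounded_measurable (fun x : plane => (ghat i x : R * R).2).
Proof.
have h (f : R * R -> R) : f 0 = 0 ->
    bounded_measurable (fun x : plane => f (ghat (tri := tri) i x)).
  move=> f0.
  have : bounded_measurable (fun x : plane => if [pick K in cells tri |
      `[< hull pt K x >]] is Some K then f (bslope K i) else 0).
    apply: bounded_measurable_pick => [K|K|].
    - exact: measurable_in_cell.
    - exact: measurable_cst.
    - exists (\sum_K `|f (bslope K i)|) => K _ _.
      by rewrite (bigD1 K)//= lerDl sumr_ge0.
  congr bounded_measurable; apply/funext => x; rewrite /ghat /cell_of.
  by case: pickP => [//|_]; rewrite f0.
by split; apply: h.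
Qed.

Lemma bounded_measurable_dot_ghat i j :
  bounded_measurable (fun x : plane => dot (ghat i x) (ghat (tri := tri) j x)).
Proof.
have [i1 i2] := bounded_measurable_ghat i.
have [j1 j2] := bounded_measurable_ghat j.
by apply: bounded_measurableD; exact: bounded_measurableM.
Qed.

Lemma bounded_measurable_nodal (U : 'I_n -> R) :
  bounded_measurable (fun x : plane => \sum_j U j * hat j x).
Proof.
apply: bounded_measurable_sum => j; apply: bounded_measurableM.
  exact: bounded_measurable_cst.
exact: bounded_measurable_hat.
Qed.

Lemma measurable_sinh : measurable_fun setT (@sinh R).
Proof.
apply: measurable_funM => //; apply: measurable_funB; first exact: measurable_expR.
by apply: measurableT_comp; [exact: measurable_expR|exact: oppr_measurable].
Qed.

Lemma sinh_bound (x M : R) : `|x| <= M -> `|sinh x| <= expR M.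
Proof.
move=> xM; rewrite /sinh normrM (ger0_norm (x := 2^-1)) ?invr_ge0//.
rewrite ler_pdivrMr// (le_trans (ler_normB _ _))// !ger0_norm ?expR_ge0//.
move: xM; rewrite ler_norml => /andP[Mx xM].
by rewrite mulr_natr mulr2n lerD// ler_expR// lerNl.
Qed.

Lemma bounded_measurable_sinh (f : plane -> R) : bounded_measurable f ->
  bounded_measurable (fun x => sinh (f x)).
Proof.
move=> [mf [M fM]]; split.
  by apply: measurableT_comp => //; exact: measurable_sinh.
by exists (expR M) => x; exact: sinh_bound.
Qed.

Lemma hat_combination x : closed_Omega Q x ->
  \sum_i hat (tri := tri) i x * (pt i).2 = x.2.
Proof.
move=> /(cell_ofP tri)[K [Kc xK _]].
under eq_bigr do rewrite (hat_cell _ Kc xK).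
by rewrite -[in RHS](bary_combination (baryP Kc) x).
Qed.

Lemma bottom_side_closed x : bottom_side Q x -> closed_Omega Q x.
Proof.
move=> [x1 /= x2]; split => //=; rewrite x2 in_itv/= lexx lerDl.
exact/ltW/side_gt0.
Qed.

Lemma top_side_closed x : top_side Q x -> closed_Omega Q x.
Proof.
move=> [x1 /= x2]; split => //=; rewrite x2 in_itv/= lexx lerDl andbT.
exact/ltW/side_gt0.
Qed.

(** The height of x is the mean of the node heights with weights [hat j x]. No node lies below the
    bottom side, so a mean equal to the minimum forces every node of nonzero weight onto that
    side. *)
Lemma bottom_side_hat i x : bottom_side Q x -> hat i x != 0 ->
  bottom_side Q (pt i).
Proof.
move=> xb hix; have xO := bottom_side_closed xb.
have [p1 p2] := node_closed_Omega i; split => //=; apply/eqP.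
have yge j : ymin Q <= (pt j).2.
  by have [_] := node_closed_Omega j; rewrite /= in_itv/= => /andP[].
have : \sum_j hat (tri := tri) j x * ((pt j).2 - ymin Q) = 0.
  under eq_bigr do rewrite mulrBr.
  rewrite sumrB hat_combination// -mulr_suml sum_hat// mul1r.
  by case: xb => _ /= ->; rewrite subrr.
have h0 j : 0 <= hat (tri := tri) j x * ((pt j).2 - ymin Q).
  by rewrite mulr_ge0 ?hat_ge0 ?subr_ge0.
move/eqP; rewrite psumr_eq0// => /allP /(_ i (mem_index_enum _)) /=.
by rewrite mulf_eq0 (negbTE hix)/= subr_eq0.
Qed.

Lemma top_side_hat i x : top_side Q x -> hat i x != 0 -> top_side Q (pt i).
Proof.
move=> xb hix; have xO := top_side_closed xb.
have [p1 p2] := node_closed_Omega i; split => //=; apply/eqP.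
have yge j : (pt j).2 <= ymin Q + side Q.
  by have [_] := node_closed_Omega j; rewrite /= in_itv/= => /andP[].
have : \sum_j hat (tri := tri) j x * (ymin Q + side Q - (pt j).2) = 0.
  under eq_bigr do rewrite mulrBr.
  rewrite sumrB hat_combination// -mulr_suml sum_hat// mul1r.
  by case: xb => _ /= ->; rewrite subrr.
have h0 j : 0 <= hat (tri := tri) j x * (ymin Q + side Q - (pt j).2).
  by rewrite mulr_ge0 ?hat_ge0 ?subr_ge0.
move/eqP; rewrite psumr_eq0// => /allP /(_ i (mem_index_enum _)) /=.
by rewrite mulf_eq0 (negbTE hix)/= subr_eq0 eq_sym.
Qed.

Lemma bottom_top_disjoint x : bottom_side Q x -> ~ top_side Q x.
Proof.
move=> [_ /= x2] [_ /= /eqP]; rewrite x2 -subr_eq0 opprD addrA subrr sub0r oppr_eq0.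
by rewrite gt_eqF// side_gt0.
Qed.

(** Nodes of the lateral sides, corners excepted, thus count as interior, in accordance with the
    Neumann condition there. *)
Lemma interior_indexP i :
  interior_index i <-> ~ (bottom_side Q `|` top_side Q) (pt i).
Proof.
split => [/asboolP h /h/eqP|h].
  by rewrite (nodal_basisP i).2 eqxx oner_eq0.
apply/asboolP => x; case => xb.
  rewrite nodal_basis_hat; last exact: bottom_side_closed.
  by apply: contra_notP h => /eqP /(bottom_side_hat xb); left.
rewrite nodal_basis_hat; last exact: top_side_closed.
by apply: contra_notP h => /eqP /(top_side_hat xb); right.
Qed.

Lemma sub_Omega_closed x : Omega Q x -> closed_Omega Q x.
Proof.
by move=> [/= x1 x2]; split; apply: subset_itv_oo_cc.
Qed.

End hat_measurability.

(** * The discrete problem as a nonlinear system for the nodal values *)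

Section nodal_system.
Context (R : realType) (eps delta : R) (Q : square R) (tri : triangulation Q).
Local Notation n := (nb_nodes tri).
Local Notation pt := (@node R Q tri).
Local Notation plane := (measurableTypeR R * measurableTypeR R)%type.
Implicit Types (i j : 'I_n) (x y p : R * R) (U V : 'rV[R]_n)
  (s : L2_Omega Q * R * R) (u v w g : R * R -> R).

Lemma eq_int_Omega u v : (forall x, Omega Q x -> u x = v x) ->
  int_Omega Q u = int_Omega Q v.
Proof. by move=> uv; apply: eq_Rintegral => x /set_mem /uv. Qed.

Definition stiffness i j : R := int_Omega Q (fun x => dot (ghat j x) (ghat i x)).

Definition sinh_load (U : 'rV[R]_n) i : R :=
  int_Omega Q (fun x => sinh (\sum_j U ord0 j * hat j x) * hat i x).

(** The Dirichlet nodal values are unknowns too, with identity rows, so that the system is square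
    and no lifting occurs in it. *)
Definition system U : 'rV[R]_n := \row_i
  (if interior_index i then
     eps * (\sum_j U ord0 j * stiffness i j) + 2 * delta ^+ 2 * sinh_load U i
   else U ord0 i).

(** Only non-interior nodes are looked up in [load], and such a node off the bottom side lies on the
    top side. *)
Definition boundary_value s i : R :=
  if `[< bottom_side Q (pt i) >] then arcsinh (s.1.2 / (2 * delta ^+ 2))
  else arcsinh (s.2 / (2 * delta ^+ 2)).

Definition load s : 'rV[R]_n := \row_i
  (if interior_index i then int_Omega Q (fun x => fun_of_L2 s.1.1 x * hat i x)
   else boundary_value s i).

Definition nodal_values u : 'rV[R]_n := \row_j u (pt j).

Lemma int_grad v i : P1 tri v ->
  int_Omega Q (fun x => eps * dot (grad tri v x) (grad tri (nodal_basis i) x)) =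
  eps * \sum_j v (pt j) * stiffness i j.
Proof.
move=> vP; rewrite mulr_sumr.
under eq_bigr => j _.
  rewrite /stiffness /int_Omega mulrA -bounded_measurable_RintegralZ; first over.
  - exact: measurable_Omega.
  - exact: area_Omega_lty.
  - exact: bounded_measurable_dot_ghat.
rewrite -bounded_measurable_Rintegral_sum.
- apply: eq_int_Omega => x _; rewrite grad_P1// grad_nodal_basis dot_vcomb.
  by rewrite mulr_sumr; apply: eq_bigr => j _; rewrite mulrA.
- exact: measurable_Omega.
- exact: area_Omega_lty.
- move=> j; apply: bounded_measurableM; last exact: bounded_measurable_dot_ghat.
  exact: bounded_measurable_cst.
Qed.

Lemma P1D w g : P1 tri w -> P1 tri g -> P1 tri (fun x => w x + g x).
Proof.
move=> wP gP; apply: (P1_nodal (U := fun j => w (pt j) + g (pt j))) => x xO.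
rewrite (P1_expand wP xO) (P1_expand gP xO) -big_split/=.
by apply: eq_bigr => j _; rewrite mulrDl.
Qed.

(** Once the gradient term of the lifting is moved to the left, w and g enter only through their
    sum, whose nodal values form the argument of the system. *)
Lemma weak_equation_nodal s g w i : P1 tri w -> P1 tri g -> interior_index i ->
  let phi := nodal_basis i in
  int_Omega Q (fun x => eps * dot (grad tri w x) (grad tri phi x)) +
    2 * delta ^+ 2 * int_Omega Q (fun x => sinh (w x + g x) * phi x) =
    int_Omega Q (fun x => fun_of_L2 s.1.1 x * phi x) -
    int_Omega Q (fun x => eps * dot (grad tri g x) (grad tri phi x)) <->
  system (nodal_values (fun x => w x + g x)) ord0 i = load s ord0 i.
Proof.
move=> wP gP iint phi; rewrite !mxE iint !int_grad//.
rewrite (eq_int_Omega (u := fun x => sinh (w x + g x) * phi x)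
  (v := fun x => sinh (\sum_j nodal_values (fun x => w x + g x) ord0 j *
    hat j x) * hat i x)); last first.
  move=> x /sub_Omega_closed xO; rewrite /phi (nodal_basis_hat i xO).
  rewrite (P1_expand (P1D wP gP) xO); congr (sinh _ * _).
  by apply: eq_bigr => j _; rewrite mxE.
rewrite (eq_int_Omega (u := fun x => fun_of_L2 s.1.1 x * phi x)
  (v := fun x => fun_of_L2 s.1.1 x * hat i x)); last first.
  by move=> x /sub_Omega_closed xO; rewrite /phi (nodal_basis_hat i xO).
rewrite -/(sinh_load _ i).
under [X in _ <-> eps * X + _ = _]eq_bigr do rewrite mxE mulrDl.
rewrite big_split/= mulrDr; move: (eps * _) (eps * _) (_ * sinh_load _ _) => a b c.
move: (int_Omega Q _) => e; split => [h|<-]; last by ring.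
by rewrite addrAC h subrK.
Qed.

Lemma sum_basis_nodal (W : 'I_n -> R) (P : pred 'I_n) x : closed_Omega Q x ->
  \sum_(j | P j) W j * nodal_basis j x =
  \sum_j (if P j then W j else 0) * hat j x.
Proof.
move=> xO; rewrite big_mkcond/=; apply: eq_bigr => j _.
by case: (P j); rewrite ?mul0r// nodal_basis_hat.
Qed.

Lemma P1_sum_basis (W : 'I_n -> R) (P : pred 'I_n) :
  P1 tri (fun x => \sum_(j | P j) W j * nodal_basis j x).
Proof. by apply: P1_nodal => x; exact: sum_basis_nodal. Qed.

Lemma sum_basis_node (W : 'I_n -> R) (P : pred 'I_n) i :
  \sum_(j | P j) W j * nodal_basis j (pt i) = if P i then W i else 0.
Proof.
rewrite sum_basis_nodal; last exact: node_closed_Omega.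
rewrite (bigD1 i)//= hat_node eqxx mulr1 big1 ?addr0// => j /negbTE ji.
by rewrite hat_node ji mulr0.
Qed.

Definition solution_set s : set (R * R -> R) :=
  [set u | exists g w, [/\ is_lifting delta tri s g,
     weak_solution eps delta tri s g w & u = fun x => w x + g x]].

Lemma solution_set_nodal s u : solution_set s u ->
  P1 tri u /\ system (nodal_values u) = load s.
Proof.
move=> [g [w [[gP gb gt] [[W wE] wg] ->]]].
have wP : P1 tri w by rewrite wE; exact: P1_sum_basis.
split; first exact: P1D.
apply/rowP => i; have [iint|iint] := boolP (interior_index i).
  by apply/weak_equation_nodal => //; exact: wg.
rewrite !mxE (negbTE iint) wE sum_basis_node (negbTE iint) add0r /boundary_value.
case: asboolP => [/gb//|ib]; apply: gt.
have : ~ interior_index i by exact/negP.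
by move=> /interior_indexP/contrapT[].
Qed.

(** The lifting g is the part of U carried by the Dirichlet nodes, and w the part carried by the
    interior ones. On a Dirichlet side only hats of nodes of that side are nonzero and they sum to
    one, so g is constant there. *)
Lemma nodal_solution_set s U : system U = load s ->
  exists2 u, solution_set s u & nodal_values u = U.
Proof.
move=> UE.
pose g x := \sum_(j | ~~ interior_index j) U ord0 j * nodal_basis j x.
pose w x := \sum_(j | interior_index j) U ord0 j * nodal_basis j x.
have gP : P1 tri g by exact: P1_sum_basis.
have wP : P1 tri w by exact: P1_sum_basis.
have uU : nodal_values (fun x => w x + g x) = U.
  apply/rowP => i; rewrite mxE /g /w !sum_basis_node.
  by case: interior_index; rewrite ?addr0 ?add0r.
have Ub i : ~~ interior_index i -> U ord0 i = boundary_value s i.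
  move=> iint; move/rowP: UE => /(_ i); rewrite !mxE (negbTE iint).
  by [].
have side_cst (side : set (R * R)) (c : R) :
    side `<=` closed_Omega Q ->
    (forall x i, side x -> hat i x != 0 -> side (pt i)) ->
    side `<=` bottom_side Q `|` top_side Q ->
    (forall i, side (pt i) -> boundary_value s i = c) ->
    forall x, side x -> g x = c.
  move=> sideO side_hat side_bd bv x xs; rewrite /g sum_basis_nodal; last exact: sideO.
  rewrite -[RHS]mulr1 -(sum_hat tri (sideO _ xs)) mulr_sumr.
  apply: eq_bigr => j _; have [->|/(side_hat _ _ xs) js] := eqVneq (hat j x) 0.
    by rewrite !mulr0.
  have jint : ~~ interior_index j.
    by apply/negP => /interior_indexP; apply; exact: side_bd.
  by rewrite jint Ub// bv.
exists (fun x => w x + g x) => //; exists g, w; split=> //.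
- split=> //.
  + apply: (side_cst (bottom_side Q)) => [x|x i|x|i].
    * exact: bottom_side_closed.
    * exact: bottom_side_hat.
    * by left.
    * by move=> ib; rewrite /boundary_value; case: asboolP.
  + apply: (side_cst (top_side Q)) => [x|x i|x|i].
    * exact: top_side_closed.
    * exact: top_side_hat.
    * by right.
    * by move=> it; rewrite /boundary_value; case: asboolP => // /bottom_top_disjoint.
- split; first by exists (U ord0).
  by move=> i iint; apply/weak_equation_nodal => //; rewrite uU UE.
Qed.

End nodal_system.

Lemma continuous_sum (R : realType) (X : topologicalType) (J : finType)
    (f : J -> X -> R) :
  (forall j, continuous (f j)) -> continuous (fun x => \sum_j f j x).
Proof.
move=> fc; apply: continuous_big => [[a b]|j _]; last exact: fc.
by apply: cvgD; [exact: cvg_fst|exact: cvg_snd].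
Qed.

Lemma continuous_add (R : realType) (X : topologicalType) (f g : X -> R) :
  continuous f -> continuous g -> continuous (fun x => f x + g x).
Proof. by move=> fc gc x; apply: cvgD; [exact: fc|exact: gc]. Qed.

Lemma continuous_scale (R : realType) (X : topologicalType) (a : R) (f : X -> R) :
  continuous f -> continuous (fun x => a * f x).
Proof. by move=> fc x; apply: cvgM; [exact: cvg_cst|exact: fc]. Qed.

(** * Injectivity of the nodal system *)

Section uniqueness.
Context (R : realType) (eps delta : R) (Q : square R) (tri : triangulation Q).
Hypotheses (heps : 0 < eps) (hdelta : 0 < delta).
Local Notation n := (nb_nodes tri).
Local Notation pt := (@node R Q tri).
Local Notation plane := (measurableTypeR R * measurableTypeR R)%type.
Implicit Types (i j : 'I_n) (x y p : R * R) (U V : 'rV[R]_n).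

Lemma int_Omega_sum (J : finType) (a : J -> R) (f : J -> plane -> R) :
  (forall k : J, bounded_measurable (f k)) ->
  int_Omega Q (fun x => \sum_(k : J) a k * f k x) = \sum_(k : J) a k * int_Omega Q (f k).
Proof.
move=> fP; rewrite /int_Omega bounded_measurable_Rintegral_sum.
- apply: eq_bigr => k _; rewrite bounded_measurable_RintegralZ//.
    exact: measurable_Omega.
  exact: area_Omega_lty.
- exact: measurable_Omega.
- exact: area_Omega_lty.
- by move=> k; apply: bounded_measurableM => //; exact: bounded_measurable_cst.
Qed.

Lemma ltr_sinh (a b : R) : a < b -> sinh a < sinh b.
Proof.
by move=> ab; rewrite /sinh ltr_pM2r ?invr_gt0// ltrB// ltr_expR// ltrN2.
Qed.

Lemma sinh_monotone (a b : R) : a != b -> 0 < (sinh a - sinh b) * (a - b).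
Proof.
case: (ltgtP a b) => // ab _.
  by rewrite -mulrNN !opprB mulr_gt0 ?subr_gt0// ltr_sinh.
by rewrite mulr_gt0 ?subr_gt0// ltr_sinh.
Qed.

Lemma continuous_bary (K : {set 'I_n}) i : K \in cells tri -> continuous (bary K i).
Proof.
move=> Kc x; rewrite (_ : bary K i = fun y => bary K i 0 +
    ((bslope K i).1 * y.1 + (bslope K i).2 * y.2)); last first.
  apply/funext => y; rewrite (bary_affine (baryP Kc) i 0 y) /dot /=.
  by rewrite !subr0.
apply: cvgD; first exact: cvg_cst.
apply: cvgD; apply: cvgM; try exact: cvg_cst.
  exact: cvg_fst.
exact: cvg_snd.
Qed.

(** An open box has room beyond each of its points: the midpoints between a point and the edges of
    the box still lie in the closed square, which makes the inequalities strict. *)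
Lemma box_closed_Omega (x : R * R) (r : R) : 0 < r ->
  `]x.1 - r, x.1 + r[ `*` `]x.2 - r, x.2 + r[ `<=` closed_Omega Q ->
  `]x.1 - r, x.1 + r[ `*` `]x.2 - r, x.2 + r[ `<=` Omega Q.
Proof.
case: x => x1 x2 /= r0 sub [y1 y2] [/=]; rewrite !in_itv/= => /andP[y1l y1r] /andP[y2l y2r].
have h (a b : R) : x1 - r < a -> a < x1 + r -> x2 - r < b -> b < x2 + r ->
    [/\ xmin Q <= a, a <= xmin Q + side Q, ymin Q <= b & b <= ymin Q + side Q].
  move=> h1 h2 h3 h4; have [] := sub (a, b); first by rewrite /= !in_itv/= h1 h2 h3 h4.
  by rewrite /= !in_itv/= => /andP[-> ->] /andP[-> ->].
have [l1 _ l2 _] : [/\ xmin Q <= (y1 + (x1 - r)) / 2, (y1 + (x1 - r)) / 2 <= xmin Q + side Q,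
    ymin Q <= (y2 + (x2 - r)) / 2 & (y2 + (x2 - r)) / 2 <= ymin Q + side Q].
  by apply: h; lra.
have [_ u1 _ u2] : [/\ xmin Q <= (y1 + (x1 + r)) / 2, (y1 + (x1 + r)) / 2 <= xmin Q + side Q,
    ymin Q <= (y2 + (x2 + r)) / 2 & (y2 + (x2 + r)) / 2 <= ymin Q + side Q].
  by apply: h; lra.
by split; rewrite /= in_itv/=; apply/andP; split; lra.
Qed.

(** Follow the segment from node i to the centroid of a cell K at this node. Its inner points have
    positive barycentric coordinates in K, and the combination cannot vanish at all of them since
    its value at node i is V i. Continuity then gives a whole box. *)
Lemma nodal_support (V : 'I_n -> R) i : V i != 0 -> exists x r, 0 < r /\
  `]x.1 - r, x.1 + r[ `*` `]x.2 - r, x.2 + r[ `<=`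
    Omega Q `&` [set y | \sum_j V j * hat j y != 0].
Proof.
move=> Vi0; have [K Kc iK] := node_used i.
pose v y := \sum_j V j * bary K j y.
pose c (t : R) j : R := (1 - t) * (j == i)%:R + t * (j \in K)%:R / 3.
have K3 : \sum_j (j \in K)%:R = 3 :> R.
  rewrite -[RHS]/(3%N%:R) -(card_cell Kc) -sum1_card natr_sum [RHS]big_mkcond/=.
  by apply: eq_bigr => j _; case: (j \in K).
have cK t : supported (c t) K.
  move=> j jK; rewrite /c (negbTE jK) mulr0 mul0r addr0.
  by case: eqP jK => [->|_ _]; rewrite ?iK ?mulr0.
have c1 t : \sum_j c t j = 1.
  rewrite big_split/= -mulr_suml -!mulr_sumr K3 (bigD1 i)//= eqxx big1 => [|j /negbTE->//].
  by rewrite addr0 mulr1 mulfK ?subrK// pnatr_eq0.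
have bc t j : bary K j (combination pt (c t)) = c t j.
  exact/esym/(bary_unique (baryP Kc)).
(* Along the segment the combination is the affine function (1 - t) V i + t e; vanishing at both 1/2
   and 1/3 would force V i = 0. *)
have [t [t0 t1 vt]] : exists t, [/\ 0 < t, t < 1 & v (combination pt (c t)) != 0].
  pose e := (\sum_j V j * (j \in K)%:R) / 3.
  have vE t : v (combination pt (c t)) = (1 - t) * V i + t * e.
    rewrite /v; under eq_bigr do rewrite bc /c mulrDr.
    rewrite big_split/= (bigD1 i)//= eqxx mulr1 big1 ?addr0 => [|j /negbTE->]; last first.
      by rewrite !mulr0.
    congr (_ + _); first by rewrite mulrC.
    by rewrite /e mulr_suml mulr_sumr; apply: eq_bigr => j _; rewrite !mulrA [V j * t]mulrC.
  have [v2|v2] := eqVneq (v (combination pt (c 2^-1))) 0; last first.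
    by exists 2^-1; split=> //; lra.
  exists 3^-1; split; [lra|lra|].
  apply/eqP; move: v2; rewrite !vE => v2 v3; move/eqP: Vi0; apply; lra.
have [x xK vx] : exists2 x, (forall j, j \in K -> 0 < bary K j x) & v x != 0.
  exists (combination pt (c t)) => // j jK.
  by rewrite bc /c jK mulr1 ltr_wpDl ?divr_gt0// mulr_ge0// subr_ge0; exact: ltW.
have xnear : nbhs x [set y | (forall j, j \in K -> 0 < bary K j y) /\ v y != 0].
  apply: filterI.
    have h j : nbhs x [set y | j \in K -> 0 < bary K j y].
      have [jK|jK] := boolP (j \in K); last by apply: filterE.
      have := cvgr_gt _ (@continuous_bary K j Kc x) 0 (xK _ jK).
      by move=> /(_ _); apply: filterS => y + _.
    exact: (@filter_forall _ _ _ _ (@nbhs_filter _ x) h).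
  have cv : v y @[y --> x] --> v x.
    apply: continuous_sum => j y; apply: cvgM; first exact: cvg_cst.
    exact: continuous_bary.
  have : open [set z : R | z != 0] by exact: open_neq.
  by rewrite openE => /(_ _ vx) /cv.
have [r /= r0 rO] := (nbhs_ballP _ _).1 xnear; exists x.
exists r; split=> //.
have rO' y : (`]x.1 - r, x.1 + r[ `*` `]x.2 - r, x.2 + r[) y ->
    (forall j, j \in K -> 0 < bary K j y) /\ v y != 0.
  move=> [/=]; rewrite !in_itv/= => y1 y2; apply: rO.
  by split => /=; rewrite /ball/= ltr_distlC.
have yhull y : (`]x.1 - r, x.1 + r[ `*` `]x.2 - r, x.2 + r[) y -> hull pt K y.
  move=> /rO'[y0 _]; apply/(hullP _ Kc) => j.
  have [/y0/ltW//|jK] := boolP (j \in K).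
  by rewrite (bary_supported (baryP Kc)).
move=> y yB; split.
  apply: (box_closed_Omega r0) yB => z /yhull; exact: cell_closed_Omega.
have [_ vy] := rO' y yB; rewrite /=.
by under eq_bigr do rewrite (hat_cell _ Kc (yhull _ yB)).
Qed.

(** If the integral vanished, so would f almost everywhere on the square; but f is positive on the
    box of [nodal_support], which has positive area. *)
Lemma nodal_integral_gt0 (V : 'I_n -> R) (f : plane -> R) i :
  V i != 0 -> bounded_measurable f -> (forall x, 0 <= f x) ->
  (forall x, \sum_j V j * hat (tri := tri) j x != 0 -> 0 < f x) ->
  0 < int_Omega Q f.
Proof.
move=> Vi0 fP f0 fpos; rewrite lt_neqAle Rintegral_ge0// andbT.
apply/eqP => /esym f_int.
have [x [r [r0 sub]]] := nodal_support Vi0.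
have mO := measurable_Omega Q.
have intf := bounded_measurable_integrable mO (area_Omega_lty Q) fP.
have : (\int[area]_(x in Omega Q) `|(EFin \o f) x|)%E = 0%E.
  under eq_integral do rewrite /= ger0_norm//.
  rewrite -[RHS]/(0%:E) -f_int /int_Omega /Rintegral fineK//.
  exact: integrable_fin_num.
move/(ae_eq_integral_abs _ _ _).1 => /(_ _)[//||N [mN N0 fN]].
  by have /integrableP[] := intf.
pose B : set plane := `]x.1 - r, x.1 + r[ `*` `]x.2 - r, x.2 + r[.
have mB : measurable B by apply: measurableX; exact: measurable_itv.
have : (area B <= area N)%E.
  apply: le_measure; rewrite ?inE//.
  move=> y /sub[yO yv]; apply: fN => /= /(_ yO) [] fy0.
  by have := fpos _ yv; rewrite fy0 ltxx.
rewrite N0 /area /= product_measure1E; [|exact: measurable_itv..].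
have len (a : R) : lebesgue_measure `]a - r, a + r[%classic = (r + r)%:E.
  rewrite lebesgue_measure_itv/= lte_fin ltrD2l gtrN// -EFinB; congr (_%:E).
  by rewrite opprB addrC addrA subrK.
rewrite [X in (X <= _)%E](_ : _ = ((r + r) * (r + r))%:E); last first.
  by rewrite EFinM; congr (_ * _)%E; exact: len.
by rewrite lee_fin leNgt mulr_gt0// addr_gt0.
Qed.

(* Testing the difference of the two equations with the difference of the two
   solutions leaves a sum of two non-negative terms, the second of which
   vanishes only if the solutions coincide. *)
Lemma system_inj : injective (system eps delta (tri := tri)).
Proof.
move=> U U' UU'; apply/rowP => i; apply/eqP; rewrite -subr_eq0.
pose V j := U ord0 j - U' ord0 j; rewrite -/(V i); apply: contraT => Vi0.
pose u x := \sum_j U ord0 j * hat (tri := tri) j x.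
pose u' x := \sum_j U' ord0 j * hat (tri := tri) j x.
have uB x : u x - u' x = \sum_j V j * hat j x.
  by rewrite -sumrB; apply: eq_bigr => j _; rewrite mulrBl.
have uP := bounded_measurable_nodal (U ord0) : bounded_measurable (u : plane -> R).
have u'P := bounded_measurable_nodal (U' ord0) : bounded_measurable (u' : plane -> R).
have NP (g : plane -> R) : bounded_measurable g -> bounded_measurable (fun x => - g x).
  move=> gP; rewrite (_ : (fun x => - g x) = fun x => -1 * g x).
    by apply: bounded_measurableM => //; exact: bounded_measurable_cst.
  by apply/funext => x; rewrite mulN1r.
have dsP : bounded_measurable (fun x : plane => sinh (u x) - sinh (u' x)).
  apply: bounded_measurableD; first exact: bounded_measurable_sinh.
  by apply: NP; exact: bounded_measurable_sinh.
pose F (x : plane) := (sinh (u x) - sinh (u' x)) * (u x - u' x).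
have FP : bounded_measurable F.
  apply: bounded_measurableM => //; apply: bounded_measurableD => //.
  exact: NP.
have Fpos x : \sum_j V j * hat (tri := tri) j x != 0 -> 0 < F x.
  by rewrite -uB subr_eq0 => uu'; apply: sinh_monotone.
have F0 x : 0 <= F x.
  have [uu'|/sinh_monotone/ltW//] := eqVneq (u x) (u' x).
  by rewrite /F uu' !subrr mulr0.
have F_gt0 := nodal_integral_gt0 Vi0 FP F0 Fpos.
have FE : int_Omega Q F = \sum_j V j * (sinh_load U j - sinh_load U' j).
  rewrite /F; under [in LHS]eq_fun do rewrite uB mulr_sumr.
  rewrite (_ : (fun x => _) = fun x => \sum_j V j *
      ((sinh (u x) - sinh (u' x)) * hat j x)); last first.
    by apply/funext => x; apply: eq_bigr => j _; rewrite mulrCA.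
  rewrite int_Omega_sum; last first.
    by move=> j; apply: bounded_measurableM => //; exact: bounded_measurable_hat.
  apply: eq_bigr => j _; congr (_ * _).
  under [in LHS]eq_fun do rewrite mulrBl.
  rewrite /int_Omega RintegralB//; [exact: measurable_Omega| |].
    apply: bounded_measurable_integrable; [exact: measurable_Omega|exact: area_Omega_lty|].
    apply: bounded_measurableM; first exact: bounded_measurable_sinh.
    exact: bounded_measurable_hat.
  apply: bounded_measurable_integrable; [exact: measurable_Omega|exact: area_Omega_lty|].
  apply: bounded_measurableM; first exact: bounded_measurable_sinh.
  exact: bounded_measurable_hat.
(* The stiffness form at V is the integral of the squared gradient of the combination with
   coefficients V. *)
have stiffE : 0 <= \sum_j V j * \sum_k V k * stiffness j k.
  pose gv (x : R * R) := vcomb V (ghat (tri := tri) ^~ x).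
  rewrite (_ : \sum_j _ = int_Omega Q (fun x => dot (gv x) (gv x))).
    by apply: Rintegral_ge0 => x _; rewrite /dot -!expr2 addr_ge0// sqr_ge0.
  have dotC (p q : R * R) : dot p q = dot q p by rewrite /dot mulrC [X in _ + X]mulrC.
  rewrite (_ : (fun x => _) = fun x => \sum_j V j *
      \sum_k V k * dot (ghat k x) (ghat j x)); last first.
    apply/funext => x; rewrite dot_vcomb; apply: eq_bigr => j _.
    by rewrite dotC dot_vcomb.
  have dP j : bounded_measurable (fun x : plane =>
      \sum_k V k * dot (ghat k x) (ghat (tri := tri) j x)).
    apply: bounded_measurable_sum => k; apply: bounded_measurableM.
      exact: bounded_measurable_cst.
    exact: bounded_measurable_dot_ghat.
  rewrite int_Omega_sum//; apply: eq_bigr => j _; rewrite int_Omega_sum// => k.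
  exact: bounded_measurable_dot_ghat.
have energy : eps * (\sum_j V j * \sum_k V k * stiffness j k) +
    2 * delta ^+ 2 * int_Omega Q F = 0.
  rewrite FE !mulr_sumr -big_split/=; apply: big1 => j _.
  move/rowP: UU' => /(_ j); rewrite !mxE.
  (* On an identity row the equality of the images gives V j = 0, so V is an admissible test vector
     and only the interior equations are tested. *)
  case: (boolP (interior_index j)) => [_|_ /eqP]; last first.
    by rewrite -subr_eq0 -/(V j) => /eqP ->; rewrite !mul0r !mulr0 addr0.
  move=> /eqP; rewrite -subr_eq0 => /eqP e.
  rewrite (_ : \sum_k V k * _ = \sum_k U ord0 k * stiffness j k -
      \sum_k U' ord0 k * stiffness j k); last first.
    by rewrite -sumrB; apply: eq_bigr => k _; rewrite mulrBl.
  move: (\sum_k U ord0 k * _) (\sum_k U' ord0 k * _) (sinh_load U j)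
    (sinh_load U' j) (V j) (2 * delta ^+ 2) e => a b c c' v D e.
  by rewrite -[RHS](mulr0 v) -e; ring.
have : 0 < eps * (\sum_j V j * \sum_k V k * stiffness j k) +
    2 * delta ^+ 2 * int_Omega Q F.
  rewrite ltr_wpDl//; first by rewrite mulr_ge0// ltW.
  by rewrite mulr_gt0// mulr_gt0// exprn_gt0.
by rewrite energy ltxx.
Qed.

End uniqueness.

(** * Continuity of the nodal system and of its right-hand side *)

Lemma continuous_at_dominated (R : realType) (X : topologicalType) (f g : X -> R)
    (x : X) :
  {for x, continuous g} -> g x = 0 -> (forall y, `|f x - f y| <= g y) ->
  {for x, continuous f}.
Proof.
move=> gc gx fg; apply/cvgrPdist_lt => e e0.
have gxe : g x < e by rewrite gx.
have := cvgr_lt _ gc _ gxe.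
by move=> /(_ _); apply: filterS => y; exact: le_lt_trans (fg y).
Qed.

Lemma continuous_at_lipschitz (R : realType) (X : pseudoMetricType R) (f : X -> R)
    (x : X) (c : R) : 0 <= c ->
  (forall y e, ball x e y -> `|f x - f y| <= e * c) -> {for x, continuous f}.
Proof.
move=> c0 fc; apply/cvgrPdist_lt => e e0.
have c1 : 0 < c + 1 by rewrite ltr_wpDl.
apply/nbhs_ballP; exists (e / (c + 1)) => /=; first exact: divr_gt0.
move=> y /fc /le_lt_trans; apply.
by rewrite -mulrA gtr_pMr// mulrC ltr_pdivrMr// mul1r ltrDl.
Qed.

(** For a <= b, exp(b) - exp(a) = exp(b) (1 - exp(a - b)) <= exp(b) (b - a). *)
Lemma expR_lipschitz (R : realType) (M a b : R) : a <= M -> b <= M ->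
  `|expR a - expR b| <= expR M * `|a - b|.
Proof.
wlog ab : a b / a <= b => [hw|] aM bM.
  have [/hw|/ltW/hw] := leP a b; first exact.
  by rewrite distrC [X in _ * X]distrC; apply.
rewrite distrC [X in _ * X]distrC !ger0_norm ?subr_ge0 ?ler_expR//.
rewrite (le_trans (y := expR b * (b - a)))//; last first.
  by rewrite ler_wpM2r ?subr_ge0// ler_expR.
have -> : expR a = expR b * expR (a - b) by rewrite -expRD addrC subrK.
rewrite -{1}[expR b]mulr1 -mulrBr ler_wpM2l ?expR_ge0//.
by have := expR_ge1Dx (a - b); lra.
Qed.

Lemma sinh_lipschitz (R : realType) (M a b : R) : `|a| <= M -> `|b| <= M ->
  `|sinh a - sinh b| <= expR M * `|a - b|.
Proof.
move=> /ler_normlP[Ma aM] /ler_normlP[Mb bM].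
have h1 := expR_lipschitz aM bM.
have h2 : `|expR (- b) - expR (- a)| <= expR M * `|a - b|.
  by have -> : a - b = - b - - a; [ring|exact: expR_lipschitz].
rewrite /sinh -mulrBl normrM (ger0_norm (x := 2^-1)) ?invr_ge0// ler_pdivrMr//.
rewrite (_ : _ - _ = (expR a - expR b) + (expR (- b) - expR (- a))); last by ring.
by rewrite (le_trans (ler_normD _ _))//; lra.
Qed.

Lemma continuous_arcsinh (R : realType) : continuous (@arcsinh R).
Proof.
move=> x; apply: (continuous_comp (f := fun y : R^o => y + Num.sqrt (y ^+ 2 + 1) : R^o)
  (g := @ln R : R^o -> R^o)).
  apply: cvgD; first exact: cvg_id.
  apply: (continuous_comp (f := fun y : R^o => y ^+ 2 + 1 : R^o)
    (g := @Num.sqrt R : R^o -> R^o)); last exact: sqrt_continuous.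
  by apply: cvgD; [exact: exprn_continuous|exact: cvg_cst].
apply: continuous_ln.
have : `|x| < Num.sqrt (x ^+ 2 + 1) by rewrite -sqrtr_sqr ltr_sqrt ?ltrDl ?ltr_wpDl// sqr_ge0.
by have := ler_norm (- x); rewrite normrN; lra.
Qed.

Lemma Lnorm1_le_Lnorm2 d (T : measurableType d) (R : realType)
    (mu : {measure set T -> \bar R}) (h : T -> R) : measurable_fun setT h ->
  (\int[mu]_x `|(h x)%:E| <=
   Lnorm mu 2%:E (EFin \o h) * (mu setT `^ 2^-1))%E.
Proof.
move=> mh.
have := @hoelder _ T R mu h (cst 1) 2 2 mh (measurable_cst _)
  (ltr0n _ 2) (ltr0n _ 2).
have -> : 2^-1 + 2^-1 = 1 :> R by lra.
move=> /(_ erefl); rewrite Lnorm1 Lnorm_cst1.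
rewrite (_ : (\int[mu]_x _)%E = (\int[mu]_x `|(h x)%:E|)%E)//.
by apply: eq_integral => x _; rewrite /= mulr1.
Qed.

(** * Measurability of the forward operator *)

Section forward_measurable.
Context (R : realType) (eps delta : R) (Q : square R) (tri : triangulation Q).
Hypotheses (heps : 0 < eps) (hdelta : 0 < delta).
Local Notation n := (nb_nodes tri).
Local Notation pt := (@node R Q tri).
Local Notation plane := (measurableTypeR R * measurableTypeR R)%type.
Implicit Types (i j : 'I_n) (x y p : R * R) (U V : 'rV[R]_n).

Let mO := measurable_Omega Q.

Lemma continuous_sinh_load i : continuous (sinh_load (tri := tri) ^~ i).
Proof.
move=> U.
(* Since hats take values in [0, 1], [N V] bounds the distance of the two fields at every point, and
   [B + N V] bounds both fields, which gives the Lipschitz constant of sinh there. *)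
pose N (V : 'rV[R]_n) := \sum_j `|U ord0 j - V ord0 j|.
pose B := \sum_j `|U ord0 j|.
pose a := fine (area (Omega Q)).
apply: (continuous_at_dominated (g := fun V => expR (B + N V) * N V * a)).
- have cN : {for U, continuous N}.
    apply: continuous_sum => j V.
    apply: (continuous_comp (f := fun V : 'rV[R]_n => U ord0 j - V ord0 j : R^o)
      (g := Num.norm : R^o -> R)); last exact: norm_continuous.
    by apply: continuousB; [exact: cst_continuous|exact: coord_continuous].
  apply: continuousM; last exact: cst_continuous.
  apply: continuousM; last exact: cN.
  apply: (continuous_comp (f := fun V => B + N V : R^o) (g := @expR R : R^o -> R^o)).
    by apply: continuousD; [exact: cst_continuous|exact: cN].
  exact: continuous_expR.
- have -> : N U = 0 by apply: big1 => j _; rewrite subrr normr0.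
  by rewrite mulr0 mul0r.
- move=> V; rewrite /sinh_load.
  have sP (W : 'rV[R]_n) : bounded_measurable (fun x : plane =>
      sinh (\sum_j W ord0 j * hat j x) * hat (tri := tri) i x).
    apply: bounded_measurableM; last exact: bounded_measurable_hat.
    by apply: bounded_measurable_sinh; exact: bounded_measurable_nodal.
  have intS W := bounded_measurable_integrable mO (area_Omega_lty Q) (sP W).
  rewrite /int_Omega -RintegralB//.
  rewrite (le_trans (le_normr_Rintegral _ _))//.
    have := integrableB mO (intS U) (intS V).
    by apply: eq_integrable => // x _ /=; rewrite EFinB.
  have -> : expR (B + N V) * N V * a =
      (\int[area]_(x in Omega Q) (expR (B + N V) * N V))%R.
    by rewrite Rintegral_cst.
  apply: le_Rintegral => //.
  + have := integrable_abse (integrableB mO (intS U) (intS V)).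
    by apply: eq_integrable => // x _ /=; rewrite -EFinB.
  + apply: bounded_measurable_integrable => //; first exact: area_Omega_lty.
    exact: bounded_measurable_cst.
  move=> x _; rewrite -mulrBl normrM -[leRHS]mulr1.
  have hn j : `|hat (tri := tri) j x| <= 1 by rewrite ger0_norm ?hat_le1 ?hat_ge0.
  apply: ler_pM => //.
  have uB (W : 'I_n -> R) : `|\sum_j W j * hat (tri := tri) j x| <= \sum_j `|W j|.
    rewrite (le_trans (ler_norm_sum _ _ _))//; apply: ler_sum => j _.
    by rewrite normrM ler_piMr.
  have N0 : 0 <= N V by apply: sumr_ge0.
  have uv : `|\sum_j U ord0 j * hat (tri := tri) j x - \sum_j V ord0 j * hat j x| <= N V.
    rewrite -sumrB; under eq_bigr do rewrite -mulrBl.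
    exact: uB.
  rewrite (le_trans (sinh_lipschitz (M := B + N V) _ _))//.
  + by rewrite (le_trans (uB _))// lerDl.
  + rewrite -[X in `|X|](subKr (\sum_j U ord0 j * hat j x)).
    by rewrite (le_trans (ler_normB _ _))// lerD.
  + by rewrite ler_wpM2l// expR_ge0.
Qed.

Lemma continuous_system : continuous (system eps delta (tri := tri)).
Proof.
apply: continuous_row => i; have [iint|iint] := boolP (interior_index i).
  rewrite (_ : (fun U => _) = fun U : 'rV[R]_n =>
    eps * (\sum_j U ord0 j * stiffness i j) + 2 * delta ^+ 2 * sinh_load U i).
    apply: continuous_add; apply: continuous_scale; last exact: continuous_sinh_load.
    apply: continuous_sum => j; rewrite (_ : (fun U => _) =
      fun U : 'rV[R]_n => stiffness i j * U ord0 j); last first.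
      by apply/funext => U; rewrite mulrC.
    by apply: continuous_scale; exact: coord_continuous.
  by apply/funext => U; rewrite mxE iint.
rewrite (_ : (fun U => _) = fun U : 'rV[R]_n => U ord0 i).
  exact: coord_continuous.
by apply/funext => U; rewrite mxE (negbTE iint).
Qed.

Lemma L1_L2 (h : plane -> R) : measurable_fun setT h ->
  (\int[area]_(x in Omega Q) `|(h x)%:E| <=
   Lnorm (area_Omega Q) 2%:E (EFin \o h) *
   ((fine (area (Omega Q))) `^ 2^-1)%:E)%E.
Proof.
move=> mh; have := Lnorm1_le_Lnorm2 (area_Omega Q) mh.
rewrite [X in (X <= _)%E -> _](_ : _ = \int[area]_(x in Omega Q) `|(h x)%:E|)%E; last first.
  rewrite ge0_integral_mrestr; last 3 first.
  - exact: measurableT.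
  - by apply: measurableT_comp => //; exact/measurable_EFinP.
  - by [].
  by rewrite setTI.
have -> : area_Omega Q setT = (fine (area (Omega Q)))%:E.
  rewrite fineK ?ge0_fin_numE//; last exact: area_Omega_lty.
  by rewrite /area_Omega/= /mrestr setTI.
by rewrite poweR_EFin.
Qed.

Lemma integrable_L2_hat (f : L2_Omega Q) i :
  area.-integrable (Omega Q) (EFin \o (fun x => fun_of_L2 f x * hat (tri := tri) i x)).
Proof.
have [mh _] := bounded_measurable_hat (tri := tri) i.
apply: (@le_integrable _ _ _ _ _ mO _ (EFin \o fun_of_L2 f)).
- apply/measurable_EFinP; apply: measurable_funTS.
  by apply: measurable_funM => //; exact: measurable_L2.
- move=> x _; rewrite /= lee_fin normrM ler_piMr//.
  by rewrite ger0_norm ?hat_le1 ?hat_ge0.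
- apply/integrableP; split.
    by apply/measurable_EFinP; apply: measurable_funTS; exact: measurable_L2.
  apply: le_lt_trans (L1_L2 (measurable_L2 f)) _.
  apply: lte_mul_pinfty; [exact: Lnorm_ge0| |exact: ltry].
  by have := fun_of_L2_Lfun f; rewrite inE => /andP[_]; rewrite inE/= ge0_fin_numE ?Lnorm_ge0.
Qed.

(** The map is Lipschitz: hats are bounded by 1, and on the square the L1 norm is at most c times
    the L2 norm. *)
Lemma continuous_load_field i : continuous (fun f : L2_Omega Q =>
  int_Omega Q (fun x => fun_of_L2 f x * hat (tri := tri) i x)).
Proof.
move=> f; pose c : R := fine (area (Omega Q)) `^ 2^-1.
have c0 : 0 <= c by exact: powR_ge0.
have bound (g : L2_Omega Q) : `|int_Omega Q (fun x => fun_of_L2 f x * hat (tri := tri) i x) -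
    int_Omega Q (fun x => fun_of_L2 g x * hat (tri := tri) i x)| <=
    L2_dist f g * c.
  have If := integrable_L2_hat f i; have Ig := integrable_L2_hat g i.
  rewrite /int_Omega -RintegralB// (le_trans (le_normr_Rintegral _ _))//.
    have := integrableB mO If Ig.
    by apply: eq_integrable => // x _ /=; rewrite EFinB.
  have Ifg : area.-integrable (Omega Q) (EFin \o (fun x =>
      `|fun_of_L2 f x * hat (tri := tri) i x - fun_of_L2 g x * hat i x|)).
    have := integrable_abse (integrableB mO If Ig).
    by apply: eq_integrable => // x _ /=; rewrite -EFinB.
  rewrite -lee_fin /Rintegral fineK; last exact: integrable_fin_num Ifg.
  rewrite EFinM L2_distE.
  have mfg : measurable_fun setT (fun_of_L2 f - fun_of_L2 g).
    by apply: measurable_funB; exact: measurable_L2.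
  apply: le_trans (L1_L2 mfg); apply: ge0_le_integral => //.
  - apply/measurable_EFinP; apply: measurableT_comp => //.
    have [mh _] := bounded_measurable_hat (tri := tri) i.
    by apply: measurable_funTS; apply: measurable_funB; apply: measurable_funM => //;
      exact: measurable_L2.
  - apply: measurableT_comp => //; apply/measurable_EFinP.
    exact: measurable_funTS.
  - move=> x _; rewrite lee_fin -mulrBl normrM ler_piMr//.
    by rewrite ger0_norm ?hat_le1 ?hat_ge0.
apply: (@continuous_at_lipschitz R (L2_Omega Q) _ _ c c0) => g e fg.
apply: le_trans (bound g) _; rewrite ler_wpM2r//; apply/ltW.
by move: fg; rewrite ballEmdist.
Qed.

Lemma continuous_load (S : topologicalType) (carrier : S -> L2_Omega Q * R * R) :
  continuous carrier ->
  continuous (fun s => load delta tri (carrier s)).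
Proof.
move=> cc.
have ccp : continuous (fun s => (carrier s).1.2).
  move=> s; apply: (continuous_comp (g := snd \o fst)); first exact: cc.
  by apply: continuous_comp; [exact: cvg_fst|exact: cvg_snd].
have ccn : continuous (fun s => (carrier s).2).
  by move=> s; apply: continuous_comp; [exact: cc|exact: cvg_snd].
have cfield : continuous (fun s => (carrier s).1.1).
  move=> s; apply: (continuous_comp (g := fst \o fst)); first exact: cc.
  by apply: continuous_comp; exact: cvg_fst.
have carc (g : S -> R) : continuous g ->
    continuous (fun s => arcsinh (g s / (2 * delta ^+ 2))).
  move=> gc s; apply: (continuous_comp (f := fun s => g s / (2 * delta ^+ 2) : R^o)
    (g := @arcsinh R : R^o -> R^o)); last exact: continuous_arcsinh.
  by apply: cvgM; [exact: gc|exact: cvg_cst].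
apply: continuous_row => i; have [iint|iint] := boolP (interior_index i).
  rewrite (_ : (fun s => _) = (fun f : L2_Omega Q =>
      int_Omega Q (fun x => fun_of_L2 f x * hat (tri := tri) i x)) \o
      (fun s => (carrier s).1.1)); last first.
    by apply/funext => s; rewrite mxE iint.
  by move=> s; apply: continuous_comp; [exact: cfield|exact: continuous_load_field].
have [ib|ib] := pselect (bottom_side Q (pt i)).
  rewrite (_ : (fun s => _) = fun s => arcsinh ((carrier s).1.2 / (2 * delta ^+ 2))).
    exact: carc.
  by apply/funext => s; rewrite mxE (negbTE iint) /boundary_value; case: asboolP.
rewrite (_ : (fun s => _) = fun s => arcsinh ((carrier s).2 / (2 * delta ^+ 2))).
  exact: carc.
by apply/funext => s; rewrite mxE (negbTE iint) /boundary_value; case: asboolP.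
Qed.

Lemma measurable_forward (S : ptopologicalType)
    (carrier : S -> L2_Omega Q * R * R) (M : nat) (I : 'I_M -> interval R) :
  continuous carrier ->
  (forall m, [set` I m] `<=` `[xmin Q, xmin Q + side Q]) ->
  measurable_fun setT
    ((fun s => forward eps delta tri I (carrier s)) : Borel S -> M.-tuple R).
Proof.
move=> cc hI; apply/measurable_fun_tnthP => m.
pose top (t : measurableTypeR R) : plane := (t, ymin Q + side Q).
have fluxP i : bounded_measurable (fun t => (ghat (tri := tri) i (top t)).2).
  have [_ [m2 [B hB]]] := bounded_measurable_ghat (tri := tri) i.
  split; last by exists B => t; exact: hB.
  by apply: (measurableT_comp m2); apply: measurable_fun_pair.
pose flux i : R := (\int[lebesgue_measure]_(t in [set` I m])
  (ghat (tri := tri) i (top t)).2)%R.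
(* A segment of the top side has finite length, so the bounded gradients of the hats are integrable
   along it. *)
have finI : (lebesgue_measure ([set` I m] : set (measurableTypeR R)) < +oo)%E.
  apply: (@le_lt_trans _ _ (lebesgue_measure
      (`[xmin Q, xmin Q + side Q]%classic : set (measurableTypeR R)))).
    by apply: le_measure; rewrite ?inE.
  by rewrite lebesgue_measure_itv/=; case: ifP => _; rewrite -?EFinB ltry.
(* The gradient is linear in the nodal values, hence so is each observation, with the fluxes of the
   hats as coefficients. *)
have forwardE s u : discrete_solution eps delta tri (carrier s) = u -> P1 tri u ->
    tnth (forward eps delta tri I (carrier s)) m = \sum_i u (pt i) * flux i.
  move=> uE uP; rewrite tnth_mktuple uE.
  transitivity ((\int[lebesgue_measure]_(t in [set` I m])
      \sum_i u (pt i) * (ghat (tri := tri) i (top t)).2)%R).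
    apply: eq_Rintegral => t _.
    by rewrite grad_P1// /dot /= mulr0 add0r mulr1.
  rewrite bounded_measurable_Rintegral_sum//.
    by apply: eq_bigr => i _; rewrite bounded_measurable_RintegralZ.
  by move=> i; apply: bounded_measurableM => //; exact: bounded_measurable_cst.
(* Whichever element of the solution set is chosen, its nodal values solve the system, and
   injectivity identifies them with U. *)
have solE s U : system eps delta U = load delta tri (carrier s) ->
    P1 tri (discrete_solution eps delta tri (carrier s)) /\
    nodal_values tri (discrete_solution eps delta tri (carrier s)) = U.
  move=> UE; have [v vs vU] := nodal_solution_set UE.
  rewrite /discrete_solution; case: xgetP => [u _ us|/(_ v)//].
  have [uP uE] := solution_set_nodal us; split=> //.
  by apply: (system_inj heps hdelta); rewrite uE UE.
apply: (@measurable_solution_functional _ _ _ (system eps delta (tri := tri))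
  (fun s => load delta tri (carrier s)) (fun U => \sum_i U ord0 i * flux i)).
- exact: continuous_system.
- exact: continuous_load.
- apply: continuous_sum => i; rewrite (_ : (fun U => _) =
    fun U : 'rV[R]_n => flux i * U ord0 i); last first.
    by apply/funext => U; rewrite mulrC.
  by apply: continuous_scale; exact: coord_continuous.
- move=> s U /solE[uP <-]; rewrite /= (forwardE s _ erefl uP).
  by apply: eq_bigr => i _; rewrite mxE.
- move=> s noU; have u0 : discrete_solution eps delta tri (carrier s) = fun=> 0.
    rewrite /discrete_solution; case: xgetP => // u _ us; exfalso; apply: noU.
    by exists (nodal_values tri u); have [] := solution_set_nodal us.
  have P0 : P1 tri (fun=> 0 : R).
    apply: (P1_nodal (U := fun=> 0)) => x _.
    by rewrite big1// => i _; rewrite mul0r.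
  by rewrite /= (forwardE s _ u0 P0) big1// => i _; rewrite mul0r.
Qed.

End forward_measurable.

Theorem theorem1 (R : realType) (Q : square R) (eps delta k sigma : R)
  (heps : 0 < eps) (hdelta : 0 < delta) (hk : 0 < k) (hsigma : 0 < sigma)
  (* prior *)
  (H : completeNormedModType R) (ip : H -> H -> R) (hip : is_inner_product ip)
  (ev : H -> R * R -> R) (hev : is_function_space Q ev)
  (C : {linear H -> H}) (hC : covariance_operator ip C)
  (muX : probability (Borel H) R) (hmuX : centered_gaussian ip C muX)
  (mup mun : probability R R)
  (S : ptopologicalType) (carrier : S -> L2_Omega Q * R * R)
  (hS : is_profile_space carrier)
  (F : doping_model -> {mfun (Borel H * R * R)%type >-> Borel S})
  (hF : forall l, is_doping_map ev k carrier l (F l))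
  (* discrete forward operator *)
  (tri : triangulation Q) (M : nat) (I : 'I_M -> interval R)
  (hI : forall m, [set` I m] `<=` `[xmin Q, xmin Q + side Q])
  (hIdisj : trivIset [set: 'I_M] (fun m => [set` I m]))
  (* random variables *)
  (d : measure_display) (T : measurableType d) (P : probability T R)
  (X : {mfun T >-> Borel H}) (Cp Cn : {mfun T >-> R})
  (E : {mfun T >-> M.-tuple R})
  (hlaw : forall A : set (Borel H * R * R), measurable A ->
     P [set t | A (X t, Cp t, Cn t)] = (muX \x mup \x mun)%E A)
  (l : doping_model)
  (hE : isotropic_gaussian P sigma E)
  (hindep : independent P (fun t => F l (X t, Cp t, Cn t)) E) :
  let prior : probability (Borel S) R :=
    distribution (muX \x mup \x mun)%E (F l) in
  let G : Borel S -> M.-tuple R :=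
    fun s => forward eps delta tri I (carrier s) in
  let Phi := neg_log_likelihood G sigma in
  let Z y := (\int[prior]_s expR (- Phi y s))%R in
  let profile : T -> Borel S := fun t => F l (X t, Cp t, Cn t) in
  let Y : T -> M.-tuple R := fun t => addt (G (profile t)) (E t) in
  exists post : M.-tuple R -> probability (Borel S) R,
    [/\ is_conditional_law P profile Y post,
        forall post', is_conditional_law P profile Y post' ->
          {ae P, forall t, forall A, measurable A ->
             post' (Y t) A = post (Y t) A},
        forall y, post y `<< prior /\
          density (post y) prior =
            (fun s => ((Z y)^-1 * expR (- Phi y s))%:E) %[ae prior]
      & forall r, 0 < r -> exists2 kappa, 0 < kappa &
          forall y1 y2, Num.max (norm2 y1) (norm2 y2) < r ->
            hellinger prior (post y1) (post y2) <=
              kappa * norm2 (subt y1 y2)].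
Proof.
move=> prior G Phi Z profile Y.
have mG : measurable_fun setT G.
  by apply: measurable_forward => //; exact: continuous_carrier hS.
have mprofile : measurable_fun setT profile.
  apply: (measurableT_comp (measurable_funPT (F l))).
  by apply: measurable_fun_pair => //; exact: measurable_fun_pair.
pose U : {mfun T >-> Borel S} :=
  HB.pack profile (isMeasurableFun.Build _ _ _ _ profile mprofile).
have mY : measurable_fun setT Y.
  apply: (@measurable_addt R M d T (fun t => G (profile t)) E).
    exact: (measurableT_comp mG mprofile).
  exact: measurable_funPT.
pose V : {mfun T >-> M.-tuple R} :=
  HB.pack Y (isMeasurableFun.Build _ _ _ _ Y mY).
have U_law A : measurable A -> P (U @^-1` A) = prior A.
  move=> mA; rewrite /prior /distribution /= /pushforward -hlaw//.
  by rewrite -[X in measurable X]setTI; exact: (measurable_funPT (F l)).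
have cond := posterior_is_conditional_law mG hsigma U_law hE hindep.
pose post y : probability (Borel S) R := posterior prior sigma mG y.
exists post; split.
- exact: cond.
- move=> post' cond'.
  apply: (@conditional_law_ae_unique R _ _ _ T P (Borel S) (M.-tuple R) profile V
    _ (profile_cell carrier)) cond' => //.
  + by move=> js; exact: measurable_profile_cell.
  + by exists [::]; exact: profile_cellT.
  + by move=> i j; exact: profile_cellI.
  + exact: borel_profile_generated.
- move=> y; split; first exact: posterior_dominates.
  exact: density_posterior.
- by move=> r r0; exact: posterior_hellinger_lipschitz.
Qed.
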